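(* Let $(G_m,\mu_m,\gamma_m)$ be the $m$-th generation weighted graph of a symmetric post-critically finite fractal given by $(K,\mathcal E_K,\mu,V_0)$, with discrete energy form $\mathcal E_m$ in $\ell_2(V_m,\mu_m)$. Let $\Lambda\in(0,1)$, $\ell_{0,0}>0$, let $M_m$ be the metric graph with underlying graph $G_m$ and edge lengths $\ell_{m,e}=\frac{\ell_{0,0}}{\gamma_{0,e_0}}\Lambda^m$ (where $e=F_w(e_0)$, $w\in W_m$, $e_0\in E_0$), and let $\widetilde{\mathcal E}_m=\tau_m\mathcal E_{M_m}$ with $\tau_m=\frac{\ell_{0,0}^2C_0N_0}{2}\bigl(\frac{N\Lambda^2}r\bigr)^m$. Then $\mathcal E_m$ and $\widetilde{\mathcal E}_m$ are $\delta_m$-quasi-unitarily equivalent with $\delta_m=O\bigl((r/N)^{m/2}\bigr)$ as $m\to\infty$.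
   Context: **Quasi-unitary equivalence.** An energy form in a Hilbert space $\mathcal H$ is a non-negative, densely defined, closed quadratic form $\mathcal E$; its domain $\mathcal H^1=\operatorname{dom}\mathcal E$ carries the norm $\|f\|_1^2=\|f\|^2+\mathcal E(f)$. For $\delta\ge0$, energy forms $\mathcal E$ in $\mathcal H$ and $\widetilde{\mathcal E}$ in $\widetilde{\mathcal H}$ are $\delta$-quasi-unitarily equivalent if there are bounded linear operators $J\colon\mathcal H\to\widetilde{\mathcal H}$, $J'\colon\widetilde{\mathcal H}\to\mathcal H$, $J^1\colon\mathcal H^1\to\widetilde{\mathcal H}^1$, $J'^1\colon\widetilde{\mathcal H}^1\to\mathcal H^1$ such that $\|Jf\|\le(1+\delta)\|f\|$, $|\langle Jf,u\rangle-\langle f,J'u\rangle|\le\delta\|f\|\|u\|$ for all $f\in\mathcal H$, $u\in\widetilde{\mathcal H}$, and for all $f\in\mathcal H^1$, $u\in\widetilde{\mathcal H}^1$: $\|f-J'Jf\|\le\delta\|f\|_1$, $\|u-JJ'u\|\le\delta\|u\|_1$, $\|J^1f-Jf\|\le\delta\|f\|_1$, $\|J'^1u-J'u\|\le\delta\|u\|_1$, $|\widetilde{\mathcal E}(J^1f,u)-\mathcal E(f,J'^1u)|\le\delta\|f\|_1\|u\|_1$. **Symmetric p.c.f. fractal.** $K\subset\mathbb R^d$ is compact, non-empty, $K=\bigcup_{j=1}^NF_j(K)$, $N\ge2$, where each $F_j\colon\mathbb R^d\to\mathbb R^d$ satisfies $|F_j(x)-F_j(y)|=\theta|x-y|$ with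 a common $\theta\in(0,1)$. $V_0$ is a non-empty subset of the set of fixed points of the $F_j$ (the boundary), $N_0=|V_0|$, and $F_j(K)\cap F_{j'}(K)\subset F_j(V_0)\cap F_{j'}(V_0)$ for $j\ne j'$ (post-critically finite). $W_m=\{1,\dots,N\}^m$, $F_w=F_{w_1}\circ\dots\circ F_{w_m}$. $G_0=(V_0,E_0)$ is the complete graph on $V_0$; $G_{m+1}=(V_{m+1},E_{m+1})$ with $V_{m+1}=\bigcup_jF_j(V_m)$ and edges $\{F_j(x'),F_j(y')\}$ for $\{x',y'\}\in E_m$; these graphs are simple and $V_m\subset V_{m+1}$. Edge weights: $\gamma_0\colon E_0\to(0,\infty)$ and $\gamma_{m,e}=r^{-m}\gamma_{0,e_0}$ if $e=F_w(e_0)$, $w\in W_m$, with $r\in(0,1)$ the energy renormalisation parameter. $\mathcal E_m(f)=\sum_{\{x,y\}\in E_m}\gamma_{m,\{x,y\}}|f(x)-f(y)|^2$; the sequence is assumed compatible: $\mathcal E_m(\phi)=\min\{\mathcal E_{m+1}(f): f|_{V_m}=\phi\}$ for all $\phi\colon V_m\to\mathbb C$. $\mathcal E_K(u)=\lim_m\mathcal E_m(u|_{V_m})$ is the resulting self-similar energy form on $K$, with domain the $u\in C(K)$ for which the limit is finite; it satisfies $\mathcal E_K(u)=\sum_jr^{-1}\mathcal E_K(u\circ F_j)$. $\mu$ is a Borel measure on $K$ with $\mu(K)=1$ and $\mu(F_w(K))=N^{-m}$ for all $w\in W_m$. For $v\in V_m$, $\psi_{m,v}\in\operatorname{dom}\mathcal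 E_K$ is the $m$-harmonic function: $\psi_{m,v}(v')=\delta_{v,v'}$ for $v'\in V_m$ with minimal $\mathcal E_K$-energy. Vertex weights: $\mu_m(v)=\int_K\psi_{m,v}\,d\mu$; $\ell_2(V_m,\mu_m)$ has norm $\|f\|^2=\sum_v|f(v)|^2\mu_m(v)$. ''$(K,\mathcal E_K,\mu,V_0)$ is symmetric'' means: (i) all $F_j$ have the same similitude factor $\theta$; (ii) $\mathcal E_K(u)=\sum_{j=1}^Nr^{-1}\mathcal E_K(u\circ F_j)$ with the same $r$ for all $j$; (iii) $\mu(F_w(K))=N^{-m}$ for all $w\in W_m$ and all $m$, i.e. the measure factor is the same for all $j$; and (iv) symmetry of the boundary: $\mu_0(v_0)=1/N_0$ for all $v_0\in V_0$ and there is $C_0>0$ with $\sum_{e_0\in E_0,\,e_0\ni v_0}1/\gamma_{0,e_0}=C_0$ for all $v_0\in V_0$. **Metric graph.** $M_m$ is obtained from intervals $[0,\ell_{m,e}]$, $e\in E_m$, by identifying end points according to $G_m$, with the sum of Lebesgue measures; $\mathcal E_{M_m}(u)=\sum_e\int_0^{\ell_{m,e}}|u_e'(x)|^2\,dx$ on $L_2(M_m)$, with domain the continuous functions $u=(u_e)_e$ on $M_m$ with $u_e\in H^1([0,\ell_{m,e}])$. *)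

(* Defs.v *)
From HB Require Import structures.
From mathcomp Require Import all_boot all_order all_algebra finmap.
From mathcomp Require Import all_classical all_reals all_analysis.
From mathcomp Require Import generic_quotient ring_quotient complex.

Set Implicit Arguments.
Unset Strict Implicit.
Unset Printing Implicit Defensive.

Import Order.TTheory GRing.Theory Num.Theory numFieldNormedType.Exports.
Import ComplexField.

Local Open Scope classical_set_scope.
Local Open Scope ring_scope.
Local Open Scope complex_scope.

(** * Quasi-unitary equivalence *)

(* The data of a sesquilinear form (linear in the first argument) with a domain
   in a complex inner product space.  The completeness of the space and the
   closedness and density of the form are properties of the particular forms
   considered below and are not recorded as fields. *)
Record form_space (R : realType) := FormSpace {
  fs_space :> lmodType R[i];
  fs_inner : fs_space -> fs_space -> R[i];
  fs_dom : set fs_space;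
  fs_form : fs_space -> fs_space -> R[i] }.

Section QuasiUnitary.
Context {R : realType}.

Definition hnorm (A : form_space R) (f : A) : R :=
  Num.sqrt (complex.Re (fs_inner f f)).

Definition hnorm1 (A : form_space R) (f : A) : R :=
  Num.sqrt (hnorm f ^+ 2 + complex.Re (fs_form f f)).

Definition bounded_operator (A B : form_space R)
    (J : {linear fs_space A -> fs_space B}) :=
  exists c : R, forall f, hnorm (J f) <= c * hnorm f.

(* Bounded linear operators from (dom A, hnorm1) to (dom B, hnorm1); the values
   of J1 outside of dom A are irrelevant. *)
Definition bounded_operator1 (A B : form_space R) (J1 : A -> B) :=
  [/\ forall f, fs_dom f -> fs_dom (J1 f),
      forall (a : R[i]) (f g : A), fs_dom f -> fs_dom g ->
        J1 (a *: f + g) = a *: J1 f + J1 g &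
      exists c : R, forall f, fs_dom f -> hnorm1 (J1 f) <= c * hnorm1 f].

Definition quasi_unitary_equivalent (delta : R) (A B : form_space R) :=
  exists (J : {linear fs_space A -> fs_space B})
         (J' : {linear fs_space B -> fs_space A})
         (J1 : A -> B) (J1' : B -> A),
    [/\ [/\ bounded_operator J, bounded_operator J',
            bounded_operator1 J1 & bounded_operator1 J1'],
        (forall f, hnorm (J f) <= (1 + delta) * hnorm f) /\
        (forall f u, Normc.normc (fs_inner (J f) u - fs_inner f (J' u))
                     <= delta * hnorm f * hnorm u),
        (forall f, fs_dom f -> hnorm (f - J' (J f)) <= delta * hnorm1 f) /\
        (forall u, fs_dom u -> hnorm (u - J (J' u)) <= delta * hnorm1 u),
        (forall f, fs_dom f -> hnorm (J1 f - J f) <= delta * hnorm1 f) /\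
        (forall u, fs_dom u -> hnorm (J1' u - J' u) <= delta * hnorm1 u) &
        forall f u, fs_dom f -> fs_dom u ->
          Normc.normc (fs_form (J1 f) u - fs_form f (J1' u))
            <= delta * hnorm1 f * hnorm1 u].

End QuasiUnitary.

(** * Metric graphs *)

Record metric_graph (R : realType) := MetricGraph {
  mg_vertex : Type;
  mg_edge : finType;
  mg_src : mg_edge -> mg_vertex;
  mg_tgt : mg_edge -> mg_vertex;
  mg_len : mg_edge -> R }.

Section IntervalMeasure.
Context {R : realType}.

Definition Cintegral (l : R) (f : R -> R[i]) : R[i] :=
  (\int[lebesgue_measure]_(x in `[0, l]) complex.Re (f x)) +i*
  (\int[lebesgue_measure]_(x in `[0, l]) complex.Im (f x)).

Definition interval_measure (l : R) : {measure set (measurableTypeR R) -> \bar R} :=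
  mrestr (@lebesgue_measure R) (measurable_itv `[0%R, l]).

End IntervalMeasure.

Section L2.
Context {R : realType} (M : metric_graph R).

Local Notation family := (mg_edge M -> R -> R[i]).

(* Square integrable representatives: families of functions on R of which only
   the values on [0, len e] matter. *)
Definition L2pred : {pred family} := [pred u : family | `[<
  forall e, (@complex.Re R \o u e) \in Lfun (interval_measure (mg_len e)) 2%:E /\
            (@complex.Im R \o u e) \in Lfun (interval_measure (mg_len e)) 2%:E >]].

Fact L2pred_submod_closed : submod_closed L2pred.
Proof.
have le12 : (1 <= 2%:E :> \bar R)%E by rewrite lee_fin ler1n.
split.
  apply/asboolP => e; split; have := Lfun_submod_closed
    (interval_measure (mg_len e)) le12 => -[+ _]; exact.
move=> a u v /asboolP uP /asboolP vP; apply/asboolP => e.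
have [ur ui] := uP e; have [vr vi] := vP e.
have cl := Lfun_submod_closed (interval_measure (mg_len e)) le12.
split.
- suff -> : @complex.Re R \o (a *: u + v) e =
    complex.Re a *: (@complex.Re R \o u e) +
    ((- complex.Im a) *: (@complex.Im R \o u e) + (@complex.Re R \o v e)).
    by apply: cl.2 => //; apply: cl.2.
  apply/funext => x /=.
  rewrite [X in _ X = _](_ : _ = a * u e x + v e x)//.
  rewrite [RHS](_ : _ = complex.Re a * complex.Re (u e x) +
    (- complex.Im a * complex.Im (u e x) + complex.Re (v e x)))//.
  by case: a (u e x) (v e x) => [a b] [p q] [s t] /=; rewrite mulNr addrA.
- suff -> : @complex.Im R \o (a *: u + v) e =
    complex.Re a *: (@complex.Im R \o u e) +
    (complex.Im a *: (@complex.Re R \o u e) + (@complex.Im R \o v e)).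
    by apply: cl.2 => //; apply: cl.2.
  apply/funext => x /=.
  rewrite [X in _ X = _](_ : _ = a * u e x + v e x)//.
  rewrite [RHS](_ : _ = complex.Re a * complex.Im (u e x) +
    (complex.Im a * complex.Re (u e x) + complex.Im (v e x)))//.
  by case: a (u e x) (v e x) => [a b] [p q] [s t] /=; rewrite addrA.
Qed.

HB.instance Definition _ :=
  GRing.isSubmodClosed.Build R[i] family L2pred L2pred_submod_closed.

Record L2fun := L2Fun { L2val :> family; L2valP : L2val \in L2pred }.

HB.instance Definition _ := [isSub for L2val].
HB.instance Definition _ := [Choice of L2fun by <:].
HB.instance Definition _ := [SubChoice_isSubLmodule of L2fun by <:].

Definition L2null : {pred L2fun} := [pred u : L2fun | `[<
  forall e, {ae interval_measure (mg_len e), forall x, u e x = 0} >]].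

Fact L2null_submod_closed : submod_closed L2null.
Proof.
split; first by apply/asboolP => e; apply: nearW.
move=> a u v /asboolP uP /asboolP vP; apply/asboolP => e.
have FF := ae_filter_ringOfSetsType (interval_measure (mg_len e)).
move: (uP e) (vP e); apply: filterS2 => x ux vx.
rewrite [LHS](_ : _ = a * u e x + v e x) //.
by rewrite ux vx mulr0 addr0.
Qed.

HB.instance Definition _ :=
  GRing.isSubmodClosed.Build R[i] L2fun L2null L2null_submod_closed.

(* The Hilbert space L_2(M): classes modulo equality almost everywhere. *)
Definition L2 : Type := Quotient.quot L2null.

HB.instance Definition _ := GRing.Zmodule.on L2.

Local Open Scope quotient_scope.

Definition L2class (u : L2fun) : L2 := \pi_(Quotient.quot L2null) u.
Definition L2repr (U : L2) : L2fun := repr U.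

Lemma L2classE u v : (L2class u = L2class v) <-> (u - v \in L2null).
Proof. by rewrite Quotient.idealrBE; split => [/eqP|/eqP]. Qed.

Lemma L2reprK U : L2class (L2repr U) = U.
Proof. exact: reprK. Qed.

Lemma L2classD u v : L2class (u + v) = L2class u + L2class v.
Proof. by rewrite /L2class raddfD. Qed.

Definition L2scale (a : R[i]) (U : L2) : L2 := L2class (a *: L2repr U).

Lemma L2scale_class a u : L2scale a (L2class u) = L2class (a *: u).
Proof.
apply/L2classE; rewrite -scalerBr rpredZ//.
by apply/L2classE; rewrite L2reprK.
Qed.

Fact L2scaleA a b U : L2scale a (L2scale b U) = L2scale (a * b) U.
Proof. by rewrite -[U]L2reprK !L2scale_class scalerA. Qed.

Fact L2scale1 : left_id 1 L2scale.
Proof. by move=> U; rewrite -[U]L2reprK !L2scale_class scale1r. Qed.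

Fact L2scaleDr : right_distributive L2scale +%R.
Proof.
move=> a U V; rewrite -[U]L2reprK -[V]L2reprK.
by rewrite -L2classD !L2scale_class -L2classD scalerDr.
Qed.

Fact L2scaleDl U : {morph L2scale^~ U : a b / a + b}.
Proof. by move=> a b; rewrite -[U]L2reprK !L2scale_class -L2classD scalerDl. Qed.

HB.instance Definition _ := GRing.Zmodule_isLmodule.Build R[i] L2
  L2scaleA L2scale1 L2scaleDr L2scaleDl.

Definition L2inner (U V : L2) : R[i] := \sum_(e : mg_edge M)
  Cintegral (mg_len e) (fun x => L2repr U e x * conjc (L2repr V e x)).

Definition test_function (l : R) (phi : R -> R) :=
  [/\ forall x, derivable phi x 1, continuous (derive1 phi : R -> R) &
      exists a b : R, [/\ 0 < a, b < l &
        forall x, x \notin `[a, b]%R -> phi x = 0]].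

Definition is_weak_derivative (u g : L2fun) :=
  forall (e : mg_edge M) (phi : R -> R), test_function (mg_len e) phi ->
    Cintegral (mg_len e) (fun x => u e x * (derive1 phi x)%:C) =
    - Cintegral (mg_len e) (fun x => g e x * (phi x)%:C).

(* The weak derivative is unique almost everywhere and depends only on the
   class of u, so that the choices made here and in dirichlet_form are
   immaterial. *)
Definition weak_derivative (u : L2fun) : L2fun :=
  xget 0 [set g | is_weak_derivative u g].

Definition continuous_on_graph (u : family) :=
  (forall e, {within `[0, mg_len e], continuous (u e : R -> R[i]^o)}) /\
  exists a : mg_vertex M -> R[i], forall e,
    u e 0 = a (mg_src e) /\ u e (mg_len e) = a (mg_tgt e).

Definition dirichlet_dom : set L2 := [set U | exists u : L2fun,
  [/\ U = L2class u, continuous_on_graph u &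
      exists g, is_weak_derivative u g]].

Definition dirichlet_form (U V : L2) : R[i] := \sum_(e : mg_edge M)
  Cintegral (mg_len e) (fun x => weak_derivative (L2repr U) e x *
                                 conjc (weak_derivative (L2repr V) e x)).

Definition metric_form_space (tau : R) : form_space R :=
  FormSpace L2inner dirichlet_dom (fun U V => tau%:C * dirichlet_form U V).

End L2.

(** * Symmetric post-critically finite fractals *)

Definition borel_space (R : realType) (d : nat) :=
  g_sigma_algebraType (@open 'rV[R]_d).

(* The measure on K is given as a Borel probability measure on the ambient
   space which gives full mass to K. *)
Record pcf_data (R : realType) (d : nat) := PcfData {
  pcf_N : nat;
  pcf_map : 'I_pcf_N -> 'rV[R]_d -> 'rV[R]_d;
  pcf_theta : R;
  pcf_K : set 'rV[R]_d;
  pcf_V0 : {fset 'rV[R]_d};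
  pcf_gamma0 : {fset 'rV[R]_d} -> R;
  pcf_r : R;
  pcf_mu : probability (borel_space R d) R }.

Section Pcf.
Context {R : realType} {d : nat} (X : pcf_data R d).

Local Notation point := 'rV[R]_d.
Local Notation N := (pcf_N X).
Local Notation F := (@pcf_map _ _ X).
Local Notation K := (@pcf_K _ _ X).
Local Notation V0 := (@pcf_V0 _ _ X).
Local Notation gamma0 := (@pcf_gamma0 _ _ X).
Local Notation r := (@pcf_r _ _ X).
Local Notation mu := (@pcf_mu _ _ X).

(* The library norm on row vectors is the supremum norm. *)
Definition euclidean_norm (x : point) : R := Num.sqrt (\sum_i x ord0 i ^+ 2).

Definition word_map m (w : m.-tuple 'I_N) (x : point) : point := foldr F x w.

Fixpoint vertices m : {fset point} :=
  if m is m'.+1 then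
    (\bigcup_(j <- enum 'I_N) [fset F j x | x in vertices m'])%fset
  else V0.

Fixpoint edges m : {fset {fset point}} :=
  if m is m'.+1 then
    (\bigcup_(j <- enum 'I_N)
       [fset [fset F j x | x in (e : {fset point})] | e in edges m'])%fset
  else [fset e in fpowerset V0 | #|` e| == 2%N]%fset.

Definition edge_image m (w : m.-tuple 'I_N) (e : {fset point}) : {fset point} :=
  [fset word_map w x | x in e]%fset.

(* No edge of generation m arises from two different pairs (w, e0). *)
Definition simple_graphs := forall m (w w' : m.-tuple 'I_N) e e',
  e \in edges 0 -> e' \in edges 0 ->
  edge_image w e = edge_image w' e' -> w = w' /\ e = e'.

Definition edge_type m (e : {fset point}) : {fset point} :=
  xget fset0 [set e0 | e0 \in edges 0 /\
                       exists w : m.-tuple 'I_N, e = edge_image w e0].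

Definition edge_weight m (e : {fset point}) : R :=
  r ^- m * gamma0 (edge_type m e).

(* The end points of an edge, listed in an arbitrary order. *)
Definition edge_src (e : {fset point}) : point := nth 0 e 0.
Definition edge_tgt (e : {fset point}) : point := nth 0 e 1.

Definition edge_diff (f : point -> R[i]) (e : {fset point}) : R[i] :=
  f (edge_src e) - f (edge_tgt e).

Definition energy m (f : point -> R[i]) : R :=
  \sum_(e <- edges m) edge_weight m e * Normc.normc (edge_diff f e) ^+ 2.

Definition compatible := forall m (phi : point -> R[i]),
  (exists2 f : point -> R[i], {in vertices m, f =1 phi} &
     energy m.+1 f = energy m phi) /\
  (forall f : point -> R[i], {in vertices m, f =1 phi} ->
     energy m phi <= energy m.+1 f).

(* Elements of C(K) are represented by functions on the ambient space of which
   only the values on K matter. *)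
Definition energyK_dom (u : point -> R[i]) :=
  {within K, continuous (u : point -> R[i]^o)} /\
  cvg (energy m u @[m --> \oo]).

Definition energyK (u : point -> R[i]) : R := lim (energy m u @[m --> \oo]).

Definition harmonic m (v : point) (u : point -> R[i]) :=
  [/\ energyK_dom u, {in vertices m, forall v', u v' = (v' == v)%:R} &
      forall u', energyK_dom u' ->
        {in vertices m, forall v', u' v' = (v' == v)%:R} ->
        energyK u <= energyK u'].

Definition psi m (v : point) : point -> R[i] :=
  xget (fun=> 0) [set u | harmonic m v u].

(* psi is real-valued on K, being unique on K and invariant under complex
   conjugation. *)
Definition vertex_weight m (v : point) : R :=
  \int[mu]_(x in K) complex.Re (psi m v x).

Record pcf_fractal : Prop := PcfFractal {
  pcf_N_ge2 : (2 <= N)%N;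
  pcf_theta_gt0 : 0 < pcf_theta X;
  pcf_theta_lt1 : pcf_theta X < 1;
  pcf_similitude : forall j x y,
    euclidean_norm (F j x - F j y) = pcf_theta X * euclidean_norm (x - y);
  pcf_K_compact : compact K;
  pcf_K_nonempty : K !=set0;
  pcf_K_invariant : K = \bigcup_j (F j @` K);
  pcf_V0_nonempty : V0 != fset0;
  pcf_V0_fixed : forall x, x \in V0 -> exists j, F j x = x;
  pcf_finitely_ramified : forall j j', j != j' ->
    (F j @` K) `&` (F j' @` K) `<=`
    (F j @` [set` V0]) `&` (F j' @` [set` V0]);
  pcf_simple : simple_graphs;
  pcf_gamma0_gt0 : forall e, e \in edges 0 -> 0 < gamma0 e;
  pcf_r_gt0 : 0 < r;
  pcf_r_lt1 : r < 1;
  pcf_compatible : compatible;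
  pcf_mu_K : mu K = 1%E;
  (* the m-harmonic functions are well defined on K *)
  pcf_harmonic_exists : forall m v, v \in vertices m -> exists u, harmonic m v u;
  pcf_harmonic_unique : forall m v u u', v \in vertices m ->
    harmonic m v u -> harmonic m v u' -> {in K, u =1 u'} }.

Record symmetric_fractal (C0 : R) : Prop := SymmetricFractal {
  sym_energy : forall u, energyK_dom u ->
    (forall j, energyK_dom (u \o F j)) /\
    energyK u = \sum_(j < N) r^-1 * energyK (u \o F j);
  sym_measure : forall m (w : m.-tuple 'I_N),
    mu (word_map w @` K) = (N%:R ^- m)%:E;
  sym_boundary_measure : forall v, v \in V0 ->
    vertex_weight 0 v = #|` V0|%:R^-1;
  sym_C0_gt0 : 0 < C0;
  sym_boundary_energy : forall v, v \in V0 ->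
    \sum_(e <- edges 0 | v \in e) (gamma0 e)^-1 = C0 }.

Section Discrete.
Variable m : nat.

Definition vertex_ext (f : {ffun vertices m -> R[i]}) (x : point) : R[i] :=
  oapp f 0 (insub x).

Definition discrete_inner (f g : {ffun vertices m -> R[i]}) : R[i] :=
  \sum_v f v * conjc (g v) * (vertex_weight m (val v))%:C.

Definition discrete_form (f g : {ffun vertices m -> R[i]}) : R[i] :=
  \sum_(e <- edges m) (edge_weight m e)%:C *
    (edge_diff (vertex_ext f) e * conjc (edge_diff (vertex_ext g) e)).

Lemma discrete_form_energy f :
  discrete_form f f = (energy m (vertex_ext f))%:C.
Proof.
rewrite /energy rmorph_sum; apply: eq_bigr => e _.
by rewrite -sqr_normc !(rmorphM (real_complex R)) -expr2.
Qed.

Definition discrete_form_space : form_space R :=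
  FormSpace discrete_inner setT discrete_form.

End Discrete.

Definition fractal_metric_graph (l00 Lambda : R) (m : nat) : metric_graph R :=
  @MetricGraph R point (edges m)
    (fun e => edge_src (val e)) (fun e => edge_tgt (val e))
    (fun e => l00 / gamma0 (edge_type m (val e)) * Lambda ^+ m).

Definition fractal_tau (C0 l00 Lambda : R) (m : nat) : R :=
  l00 ^+ 2 * C0 * #|` V0|%:R / 2 * (N%:R * Lambda ^+ 2 / r) ^+ m.

End Pcf.

(* Main.v *)
Require Import Defs.
From HB Require Import structures.
From mathcomp Require Import all_boot all_order all_algebra finmap.
From mathcomp Require Import all_classical all_reals all_analysis.
From mathcomp Require Import complex.
From mathcomp Require Import measurable_realfun ring lra.

Import Order.TTheory GRing.Theory Num.Theory numFieldNormedType.Exports.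

Local Open Scope classical_set_scope.
Local Open Scope ring_scope.

(** Put [s = sqrt (l00 Lambda^m C0 N^m N0 / 2)].  Gluing minimizers on the cells
    shows that the (m+1)-harmonic functions restrict to m-harmonic functions on the
    cells F_j(K), and Riemann sums over the cells of generation n show that the
    integral against mu is self-similar.  Hence the vertex weights and the sums
    of 1/gamma_0 over the edges at a vertex satisfy the same recursion, and the
    integral of the hat function of M_m at v equals s^2 mu_m(v), while
    tau_m = s^2 gamma_e l_e and l_e^2 <= O((r/N)^m) tau_m.

    With these identities J = J^1 is s^-1 times the piecewise affine extension,
    J' is its exact adjoint, and J'^1 evaluates at the vertices and multiplies
    by s; then the two forms match exactly.  The trapezoidal rule for products of
    affine functions gives <f, g> - <Jf, Jg> = Q(f, g) with Q a nonnegative form bounded by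
    O((r/N)^m) E_m, whence J is a contraction and, since |f - J'Jf|^2 = Q(f, f - J'Jf),
    also |f - J'Jf|^2 <= Q(f, f).  On the metric graph
    |u(x) - u(y)|^2 <= l_e |u'|^2 on each edge bounds u - J J'^1 u.  The remaining
    estimates follow from the triangle inequality. *)

Set Implicit Arguments.
Unset Strict Implicit.
Unset Printing Implicit Defensive.

(** * Test functions and the fundamental lemma of du Bois-Reymond *)

(** The constants are forced. An edge at v contributes half its length to the integral of the hat
    function at v, so this integral is l00 Lambda^m / 2 times the sum of 1/gamma_0 over the edges at
    v. From generation m to m+1 the maps F_j transport that sum without a factor, whereas mu_m
    acquires 1/N; at generation 0 the two quantities are C0 and 1/N0. Their ratio is therefore C0 N0
    N^m, which gives s^2. Since gamma_e l_e = l00 (Lambda/r)^m is the same for all edges, a single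
    factor tau_m makes the forms agree on all edges at once. In l_e^2 / tau_m the powers of Lambda
    cancel and 2 / (gamma_0^2 C0 N0) (r/N)^m is left. Two obstacles shape the rest. The vertex
    weights integrate functions known only as energy minimizers against a measure known only on
    cells. The domain of the form on M_m consists of classes with a weak derivative, so vertex
    values and the fundamental theorem of calculus must first be recovered from C^1 test
    functions. *)

Section Smoothstep.
Context {R : realType}.
Implicit Types t x : R.

Definition sqpos t : R := Num.max t 0 ^+ 2.

Lemma sqpos_taylor t h : `|sqpos (t + h) - sqpos t - 2 * Num.max t 0 * h| <= h ^+ 2.
Proof.
rewrite /sqpos ler_norml.
by case: (leP t 0) => tt; case: (leP (t + h) 0) => ht; apply/andP; split; nra.
Qed.

(** A quadratic remainder determines the derivative, so differentiating a piecewise polynomial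
    reduces to one inequality and needs no case distinction at the break points. *)
Lemma is_derive_taylor (f : R -> R) (t df C : R) :
  (forall h, `|h| <= 1 -> `|f (t + h) - f t - df * h| <= C * h ^+ 2) -> is_derive t (1 : R) f df.
Proof.
move=> H.
have C0 : 0 <= C by have := le_trans (normr_ge0 _) (H 1 _); rewrite normr1 expr1n mulr1; exact.
have cv : h^-1 *: (f (h *: (1 : R) + t) - f t) @[h --> 0^'] --> df.
  apply/cvgrPdist_le => e e0; near=> h.
  have h0 : h != 0 by near: h; exact: nbhs_dnbhs_neq.
  (* [C] may be 0; the shift keeps the quotient meaningful. *)
  have he : `|h| <= e / (C + 1).
    near: h; apply: dnbhs0_le; rewrite divr_gt0//; lra.
  have h1 : `|h| <= 1 by near: h; exact: dnbhs0_le.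
  have -> : h *: (1 : R) + t = t + h by rewrite [h *: _]mulr1 addrC.
  have -> : df - h^-1 *: (f (t + h) - f t) = - (h^-1 * (f (t + h) - f t - df * h)).
    by rewrite [h^-1 *: _]/(h^-1 * _) mulrBr [h^-1 * (df * h)]mulrCA mulVf// mulr1 opprB.
  rewrite normrN normrM normfV ler_pdivrMl ?normr_gt0//.
  apply: (le_trans (H h h1)); rewrite -(real_normK (num_real h)) expr2 mulrA mulrC.
  rewrite ler_wpM2l//; apply: le_trans (_ : (C + 1) * `|h| <= _).
    by rewrite ler_wpM2r// lerDl.
  by rewrite mulrC -ler_pdivlMr//; lra.
by split; [apply/cvg_ex; eexists; exact: cv|apply/cvg_lim].
Unshelve. all: by end_near. Qed.

Definition tent t : R := Num.max t 0 - 2 * Num.max (t - 1) 0 + Num.max (t - 2) 0.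

(* A primitive of the tent function: a C^1 transition from 0 to 1 on [0, 2]. *)
Definition smoothstep t : R := (sqpos t - 2 * sqpos (t - 1) + sqpos (t - 2)) / 2.

Lemma smoothstep_le0 t : t <= 0 -> smoothstep t = 0.
Proof. move=> ?; rewrite /smoothstep /sqpos !max_r; lra. Qed.

Lemma smoothstep_ge2 t : 2 <= t -> smoothstep t = 1.
Proof. move=> ?; rewrite /smoothstep /sqpos !max_l; nra. Qed.

Lemma smoothstep_itv t : 0 <= smoothstep t <= 1.
Proof.
rewrite /smoothstep /sqpos.
case: (leP t 0) => ?; case: (leP (t - 1) 0) => ?; case: (leP (t - 2) 0) => ?;
  apply/andP; split; nra.
Qed.

Lemma tent_ge0 t : 0 <= tent t.
Proof.
by rewrite /tent; case: (leP t 0) => ?; case: (leP (t - 1) 0) => ?;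
  case: (leP (t - 2) 0) => ?; lra.
Qed.

Lemma tent_le0 t : t <= 0 -> tent t = 0.
Proof. move=> ?; rewrite /tent !max_r; lra. Qed.

Lemma tent_ge2 t : 2 <= t -> tent t = 0.
Proof. move=> ?; rewrite /tent !max_l; lra. Qed.

Lemma continuous_pos (a b : R) : continuous (fun t : R => Num.max (a * t + b) 0).
Proof.
move=> t; apply: (@continuous_max _ _ (fun t : R => a * t + b) (cst 0)).
  by apply: cvgD; [apply: cvgM; [exact: cvg_cst|exact: cvg_id]|exact: cvg_cst].
exact: cvg_cst.
Qed.

Lemma is_derive_smoothstep (k x t : R) :
  is_derive t (1 : R) (fun t => smoothstep (k * (t - x))) (k * tent (k * (t - x))).
Proof.
(* The constant is (1 + 2 + 1) / 2, from the coefficients of the three [sqpos] terms, each with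
   remainder at most [(k * h) ^+ 2]. *)
apply: (@is_derive_taylor _ _ _ (2 * k ^+ 2)) => h _.
have := sqpos_taylor (k * (t - x)) (k * h).
have := sqpos_taylor (k * (t - x) - 1) (k * h).
have := sqpos_taylor (k * (t - x) - 2) (k * h).
rewrite /smoothstep /tent -mulrDr.
have -> : k * (t - x) - 1 + k * h = k * (t - x + h) - 1 by ring.
have -> : k * (t - x) - 2 + k * h = k * (t - x + h) - 2 by ring.
have -> : t - x + h = t + h - x by ring.
rewrite !ler_norml exprMn => /andP[? ?] /andP[? ?] /andP[? ?].
by apply/andP; split; lra.
Qed.

Lemma continuous_tent (k x : R) : continuous (fun t => k * tent (k * (t - x))).
Proof.
have -> : (fun t => k * tent (k * (t - x))) = (fun t => k * (Num.max (k * t + - (k * x)) 0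
   - 2 * Num.max (k * t + - (k * x + 1)) 0 + Num.max (k * t + - (k * x + 2)) 0)).
  apply/funext => t; rewrite /tent.
  have -> : k * (t - x) = k * t + - (k * x) by ring.
  by rewrite -[k * t - _ - 1]addrA -[k * t - _ - 2]addrA -!opprD.
move=> t; apply: cvgM; first exact: cvg_cst.
apply: cvgD; last exact: continuous_pos.
apply: cvgB; first exact: continuous_pos.
apply: cvgM; [exact: cvg_cst|exact: continuous_pos].
Qed.

End Smoothstep.

(** * Integration on an interval and recovery of a function from its weak derivative *)

Section Integrals.
Context {R : realType}.
Notation leb := (@lebesgue_measure R).
Implicit Types (f g u phi : R -> R) (a b l x y : R).

Lemma integrable_cmul d (T : measurableType d) (m : {measure set T -> \bar R})
    (D : set T) (h : T -> R) (c : R) : measurable D ->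
  m.-integrable D (EFin \o h) -> m.-integrable D (EFin \o (fun z => c * h z)).
Proof.
move=> mD hi; rewrite (_ : _ \o _ = (fun z => c%:E * (EFin \o h) z)%E)//.
exact: integrableZl.
Qed.

Lemma integrable_add d (T : measurableType d) (m : {measure set T -> \bar R})
    (D : set T) (h k : T -> R) : measurable D ->
  m.-integrable D (EFin \o h) -> m.-integrable D (EFin \o k) ->
  m.-integrable D (EFin \o (fun z => h z + k z)).
Proof.
move=> mD hi ki; rewrite (_ : _ \o _ = (EFin \o h) \+ (EFin \o k))%E//.
exact: integrableD.
Qed.

Lemma integrable_sub d (T : measurableType d) (m : {measure set T -> \bar R})
    (D : set T) (h k : T -> R) : measurable D ->
  m.-integrable D (EFin \o h) -> m.-integrable D (EFin \o k) ->
  m.-integrable D (EFin \o (fun z => h z - k z)).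
Proof.
move=> mD hi ki; rewrite (_ : _ \o _ = (EFin \o h) \- (EFin \o k))%E//.
exact: integrableB.
Qed.

Lemma continuous_integrable f a b : continuous f ->
  leb.-integrable `[a, b] (EFin \o f).
Proof.
move=> cf; apply: continuous_compact_integrable; first exact: segment_compact.
exact: continuous_subspaceT.
Qed.

Lemma integrable_mul_continuous f phi a b :
  leb.-integrable `[a, b] (EFin \o f) -> continuous phi ->
  leb.-integrable `[a, b] (EFin \o (f \* phi)).
Proof.
move=> fi cphi.
have [M phiM] : exists M, forall x, x \in `[a, b] -> `|phi x| <= M.
  have := @compact_bounded _ _ (phi @` `[a, b]).
  have cc : compact (phi @` `[a, b]).
    apply: continuous_compact; last exact: segment_compact.
    exact: continuous_subspaceT.
  move=> /(_ cc) [M [_ /(_ (M + 1))]]; rewrite ltrDl ltr01 => /(_ isT) HM.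
  by exists (M + 1) => x xab; apply: HM; exists x.
have mphi : measurable_fun `[a, b] phi.
  apply: subspace_continuous_measurable_fun => //; exact: continuous_subspaceT.
have mf : measurable_fun `[a, b] f.
  by apply/measurable_EFinP; exact: measurable_int fi.
apply: (@le_integrable _ _ _ leb `[a, b]%classic _ _ (fun x => (M * `|f x|)%:E)) => //.
- by apply/measurable_EFinP; exact: measurable_funM.
- move=> x xab /=; rewrite lee_fin normrM mulrC.
  have M0 : 0 <= M by apply: le_trans (phiM x xab).
  by rewrite [leRHS]ger0_norm ?mulr_ge0// ler_wpM2r// phiM.
- rewrite (_ : (fun x => _) = (fun x => M%:E * (abse (EFin (f x)))))%E//.
  by apply: integrableZl => //; exact: integrable_abse.
Qed.

Lemma derive1_is_derive f (df : R -> R) : (forall t, is_derive t (1 : R) f (df t)) ->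
  derive1 f = df.
Proof. by move=> h; apply/funext => t; rewrite derive1E; exact: derive_val. Qed.

Lemma integral_derive f (df : R -> R) a b : a <= b ->
  (forall t, is_derive t (1 : R) f (df t)) -> continuous df ->
  \int[leb]_(x in `[a, b]) df x = f b - f a.
Proof.
rewrite le_eqVlt => /predU1P[<- _ _|ab dfE cdf].
  by rewrite set_itv1 Rintegral_set1 subrr.
have dr t : derivable f t 1 by have [] := dfE t.
have cf : continuous f.
  by move=> t; apply: differentiable_continuous; apply/derivable1_diffP.
rewrite /Rintegral (@continuous_FTC2 _ df f)//.
- exact: continuous_subspaceT.
- split => //; first [exact: cvg_at_right_filter (cf a) | exact: cvg_at_left_filter (cf b)].
- by move=> t _; rewrite (derive1_is_derive dfE).
Qed.


Lemma continuous_is_derive f (df : R -> R) : (forall t, is_derive t (1 : R) f (df t)) ->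
  continuous f.
Proof.
move=> h t; apply: differentiable_continuous; apply/derivable1_diffP.
by have [] := h t.
Qed.

Lemma integral_quadratic (a b c l : R) : 0 < l ->
  \int[leb]_(x in `[0, l]) (a + b * (x / l) + c * (x / l) ^+ 2) = l * (a + b / 2 + c / 3).
Proof.
move=> l0; have l0' : l != 0 by rewrite gt_eqF.
pose F x := x * (a + b / 2 * (x / l) + c / 3 * (x / l) ^+ 2).
have dF t : is_derive t (1 : R) F (a + b * (t / l) + c * (t / l) ^+ 2).
  (* [F] is cubic, so its remainder after the linear term is exactly [(A + B * h) * h ^+ 2]. *)
  pose A := b / (2 * l) + c / (l ^+ 2) * t; pose B := c / (3 * l ^+ 2).
  apply: (@is_derive_taylor _ _ _ _ (`|A| + `|B|)) => h h1.
  have -> : F (t + h) - F t - (a + b * (t / l) + c * (t / l) ^+ 2) * h =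
     (A + B * h) * h ^+ 2 by rewrite /F /A /B; field.
  rewrite normrM [X in _ * X]ger0_norm ?sqr_ge0// ler_wpM2r ?sqr_ge0//.
  rewrite (le_trans (ler_normD _ _))// lerD2l normrM ler_piMr//.
rewrite (integral_derive (ltW l0) dF); first by rewrite /F; field.
move=> t; apply: cvgD; [apply: cvgD; [exact: cvg_cst|]|].
    by apply: cvgM; [exact: cvg_cst|apply: cvgM; [exact: cvg_id|exact: cvg_cst]].
  apply: cvgM; first exact: cvg_cst.
  by rewrite expr2; under eq_fun do rewrite expr2; apply: cvgM;
    (apply: cvgM; [exact: cvg_id|exact: cvg_cst]).
Qed.

(** The product of the affine function and [phi] vanishes at both ends, because [phi] is supported
    inside the open interval. This identifies the weak derivative of a hat function. *)
Lemma integral_affine_by_parts (al be l : R) (phi : R -> R) : 0 < l ->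
  test_function l phi ->
  \int[leb]_(x in `[0, l]) ((al + be * x) * derive1 phi x) =
  - \int[leb]_(x in `[0, l]) (be * phi x).
Proof.
move=> l0 [dphi cdphi [a [b [a0 bl phi0]]]].
have dp t : is_derive t (1 : R) phi (derive1 phi t).
  by rewrite derive1E; apply: derivableP; exact: dphi.
have cphi := continuous_is_derive dp.
have c1 : continuous (fun x => (al + be * x) * derive1 phi x).
  move=> x; apply: cvgM; last exact: cdphi.
  by apply: cvgD; [exact: cvg_cst|apply: cvgM; [exact: cvg_cst|exact: cvg_id]].
have c2 : continuous (fun x => be * phi x).
  by move=> x; apply: cvgM; [exact: cvg_cst|exact: cphi].
have := @integral_derive (fun x => (al + be * x) * phi x)
  (fun x => (al + be * x) * derive1 phi x + be * phi x) 0 l (ltW l0).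
rewrite RintegralD//; try exact: continuous_integrable.
rewrite !phi0 ?in_itv/= ?negb_and -?ltNge ?a0 ?bl ?orbT// !mulr0 subrr => H.
apply/eqP; rewrite -addr_eq0; apply/eqP; apply: H => [t|t].
  have da : is_derive t (1 : R) (fun x => al + be * x) be.
    apply: (@is_derive_taylor _ _ _ _ 0) => h _; rewrite mul0r.
    by rewrite (_ : _ - _ = 0) ?normr0//; ring.
  have := is_deriveM da (dp t).
  by rewrite [X in is_derive _ _ _ (X + _)]/(_ * _) [X in is_derive _ _ _ (_ + X)]mulrC.
by apply: cvgD; [exact: c1|exact: c2].
Qed.

(** A transition starting at x minus the same transition moved to y, each of width 2/k and lying to
    the right of its base point. *)
Definition bump (k x y t : R) := smoothstep (k * (t - x)) - smoothstep (k * (t - y)).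

Lemma is_derive_bump k x y t :
  is_derive t (1 : R) (bump k x y) (k * tent (k * (t - x)) - k * tent (k * (t - y))).
Proof. exact: is_deriveB (is_derive_smoothstep k x t) (is_derive_smoothstep k y t). Qed.

Lemma test_function_bump l k x y : 0 < k -> 0 < x -> x < y -> y + 2 / k < l ->
  test_function l (bump k x y).
Proof.
move=> k0 x0 xy yl; have d := is_derive_bump k x y.
split; first by move=> t; have [] := d t.
  rewrite (derive1_is_derive d) => t.
  by apply: cvgB; exact: continuous_tent.
exists x, (y + 2 / k); split => // t; rewrite in_itv/= negb_and -!ltNge => tn.
have k0' : k != 0 by rewrite gt_eqF.
case/orP: tn => [tx|ty]; rewrite /bump.
  by rewrite !smoothstep_le0 ?subrr// ?pmulr_rle0//; lra.
have kt : 2 <= k * (t - y).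
  rewrite -(ler_pM2l (_ : 0 < k^-1)) ?invr_gt0// mulrA mulVf// mul1r mulrC; lra.
rewrite !smoothstep_ge2 ?subrr//.
apply: le_trans kt _; rewrite ler_pM2l//; lra.
Qed.

Lemma integral_smoothstep l k x : 0 < k -> 0 <= x -> x + 2 / k <= l ->
  \int[leb]_(t in `[0, l]) (k * tent (k * (t - x))) = 1.
Proof.
move=> k0 x0 xl; have k0' : k != 0 by rewrite gt_eqF.
have := divr_ge0 (ler0n R 2) (ltW k0) => k2.
rewrite (integral_derive _ (is_derive_smoothstep k x)); last exact: continuous_tent; last lra.
rewrite smoothstep_ge2 ?smoothstep_le0 ?subr0// ?pmulr_rle0//; first lra.
rewrite -(ler_pM2l (_ : 0 < k^-1)) ?invr_gt0// mulrA mulVf// mul1r mulrC; lra.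
Qed.

(** The kernel is nonnegative with integral 1 and lives on [x, x + 2/k], so the integral is an
    average of values of [u] that are within [e] of [u x]. *)
Lemma integral_mollifier_close u l k x e : 0 < k -> 0 <= x -> x + 2 / k <= l ->
  leb.-integrable `[0, l] (EFin \o u) ->
  (forall t, x <= t -> t <= x + 2 / k -> `|u t - u x| <= e) ->
  `|\int[leb]_(t in `[0, l]) (u t * (k * tent (k * (t - x)))) - u x| <= e.
Proof.
move=> k0 x0 xl ui ue; have k0' : k != 0 by rewrite gt_eqF.
have e0 : 0 <= e by apply: le_trans (ue x _ _); rewrite ?lexx ?lerDl ?divr_ge0// ltW.
have I1 := integral_smoothstep k0 x0 xl.
have ct := @continuous_tent _ k x.
have ti := continuous_integrable 0 l ct.
have uti := integrable_mul_continuous ui ct.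
have -> : u x = \int[leb]_(t in `[0, l]) (u x * (k * tent (k * (t - x)))).
  by rewrite RintegralZl// I1 mulr1.
have uxi : leb.-integrable `[0, l] (EFin \o (fun t => u x * (k * tent (k * (t - x))))).
  exact: integrable_cmul.
rewrite -RintegralB//.
have di : leb.-integrable `[0, l] (EFin \o (fun t => u t * (k * tent (k * (t - x))) - u x * (k * tent (k * (t - x))))).
  exact: integrable_sub.
apply: le_trans (le_normr_Rintegral _ _) _ => //.
rewrite -[leRHS]mulr1 -I1 -RintegralZl//.
apply: le_Rintegral => //.
- exact: integrable_norm di.
- exact: integrable_cmul.
move=> t /=; rewrite in_itv/= => /andP[t0 tl].
have T0 : 0 <= k * tent (k * (t - x)) by rewrite mulr_ge0 ?tent_ge0// ltW.
rewrite -mulrBl normrM (ger0_norm T0).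
have [tx|xt] := ltP t x.
  by rewrite tent_le0 ?mulr0// pmulr_rle0//; lra.
have [tx|xt2] := leP t (x + 2 / k); first by rewrite ler_wpM2r// ue.
rewrite tent_ge2 ?mulr0//.
rewrite -(ler_pM2l (_ : 0 < k^-1)) ?invr_gt0// mulrA mulVf// mul1r mulrC; lra.
Qed.

(** At a fixed t each transition is eventually constant: always 0 if t is at or before the base
    point, and 1 for large n otherwise. This is why the limit interval is open at x and closed at
    y. *)
Lemma bump_cvg x y t : x <= y ->
  bump n.+1%:R x y t @[n --> \oo] --> (\1_`]x, y] t : R).
Proof.
have S x0 : smoothstep (n.+1%:R * (t - x0)) @[n --> \oo] --> ((x0 < t)%R%:R : R).
  have [xt|tx] := ltP x0 t; last first.
    apply: cvg_near_cst; apply: nearW => n; apply/eqP.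
    by rewrite smoothstep_le0// pmulr_rle0 ?ltr0n// subr_le0.
  apply: cvg_near_cst; near=> n; apply/eqP; rewrite smoothstep_ge2//.
  rewrite -ler_pdivrMr ?subr_gt0//.
  rewrite (@le_trans _ _ n%:R)// ?ler_nat//.
  by near: n; exact: nbhs_infty_ger.
move=> xy; have -> : \1_`]x, y] t = (x < t)%R%:R - (y < t)%R%:R :> R.
  rewrite indicE mem_setE in_itv/=.
  have [ty|yt] := leP t y; first by rewrite subr0 andbT.
  by rewrite andbF (le_lt_trans xy yt) subrr.
exact: cvgB.
Unshelve. all: by end_near. Qed.

Lemma bump_norm_le1 k x y t : `|bump k x y t| <= 1.
Proof.
have /andP[? ?] := smoothstep_itv (k * (t - x)).
have /andP[? ?] := smoothstep_itv (k * (t - y)).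
rewrite /bump ler_norml; apply/andP; split; lra.
Qed.

Lemma within_continuous_eps (A : set R) u x e : {within A, continuous u} -> A x ->
  0 < e -> exists2 d : R, 0 < d & forall t, A t -> `|t - x| < d -> `|u t - u x| <= e.
Proof.
move=> /subspace_continuousP cu Ax e0.
have /cvgrPdist_le/(_ e e0) := cu x Ax.
rewrite near_withinE => /nbhs_ballP[d/= d0 H]; exists d => // t At td.
by rewrite distrC; apply: H => //; rewrite /ball/= distrC.
Qed.

Lemma mollifier_cvg u l x : {within `[0, l], continuous u} -> 0 <= x -> x < l ->
  \int[leb]_(t in `[0, l]) (u t * (n.+1%:R * tent (n.+1%:R * (t - x)))) @[n --> \oo]
  --> u x.
Proof.
move=> cu x0 xl.
have ui : leb.-integrable `[0, l] (EFin \o u).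
  by apply: continuous_compact_integrable => //; exact: segment_compact.
apply/cvgrPdist_le => e e0.
have [|d d0 H] := within_continuous_eps cu _ e0 (x := x).
  by rewrite /= in_itv/= x0 ltW.
near=> n.
have n0 : 0 < n.+1%:R :> R by [].
(* The support of the kernel must fit into the continuity radius at x and into [0, l]. *)
have : 2 / n.+1%:R <= Num.min (d / 2) (l - x).
  rewrite ler_pdivrMr// mulrC -ler_pdivrMr; last first.
    by rewrite lt_min subr_gt0 xl andbT; lra.
  rewrite (@le_trans _ _ n%:R)// ?ler_nat//.
  by near: n; exact: nbhs_infty_ger.
rewrite le_min => /andP[nd nl].
rewrite distrC; apply: integral_mollifier_close => //; first by rewrite addrC -lerBrDr.
set q := 2 / n.+1%:R in nd nl *.
move=> t xt tn; apply: H; first by rewrite /= in_itv/=; apply/andP; split; lra.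
by rewrite ger0_norm; lra.
Unshelve. all: by end_near. Qed.

(** Dominated convergence with majorant |g|, since the bumps are bounded by 1. *)
Lemma bump_integral_cvg g l x y : 0 <= x -> x <= y -> y <= l ->
  leb.-integrable `[0, l] (EFin \o g) ->
  \int[leb]_(t in `[0, l]) (g t * bump n.+1%:R x y t) @[n --> \oo]
  --> \int[leb]_(t in `]x, y]) g t.
Proof.
move=> x0 xy yl gi.
have mg : measurable_fun `[0, l] g.
  by apply/measurable_EFinP; exact: measurable_int gi.
have gI : leb.-integrable `[0, l] (EFin \o (fun t => g t * \1_`]x, y] t)).
  apply: (@le_integrable _ _ _ leb `[0, l]%classic _ _ (EFin \o g)) => //.
    by apply/measurable_EFinP; exact: measurable_funM.
  move=> t _ /=; rewrite lee_fin normrM indicE ler_piMr//.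
  by case: (_ \in _); rewrite ?normr1 ?normr0.
have -> : \int[leb]_(t in `]x, y]) g t = \int[leb]_(t in `[0, l]) (g t * \1_`]x, y] t).
  rewrite [LHS]Rintegral_mkcond [RHS]Rintegral_mkcond; apply: eq_Rintegral => t _.
  rewrite !patchE indicE !mem_setE !in_itv/=.
  case: (ltP x t) => xt /=; case: (leP t y) => ty /=; rewrite ?mulr0 ?mulr1 ?if_same//.
  by rewrite (le_trans ty yl) (le_trans x0 (ltW xt)).
apply: fine_cvg; rewrite fineK; last exact: integrable_fin_num gI.
have cb n : continuous (bump n.+1%:R x y).
  exact: continuous_is_derive (is_derive_bump n.+1%:R x y).
have [||||||_ _] := @dominated_convergence _ _ R leb `[0, l]%classic _
  (fun n t => (g t * bump n.+1%:R x y t)%:E) (fun t => (g t * \1_`]x, y] t)%:E)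
  (fun t => `|g t|%:E) => //.
- by move=> n; exact: measurable_int (integrable_mul_continuous gi (cb n)).
- exact: measurable_int gI.
- apply: nearW => t _; apply: cvg_EFin; first exact: nearW.
  apply: cvgM; [exact: cvg_cst|exact: bump_cvg].
- exact: integrable_norm gi.
- apply: nearW => t n _; rewrite lee_fin normrM ler_piMr//; exact: bump_norm_le1.
Qed.

(* Tested against [bump k x y], which tends to the indicator of ]x, y] while its
   derivative concentrates at x and y. *)
Lemma du_bois_reymond_interior u g l : {within `[0, l], continuous u} ->
  leb.-integrable `[0, l] (EFin \o g) ->
  (forall phi, test_function l phi ->
    \int[leb]_(t in `[0, l]) (u t * derive1 phi t) = - \int[leb]_(t in `[0, l]) (g t * phi t)) ->
  forall x y, 0 < x -> x < y -> y < l -> u y - u x = \int[leb]_(t in `]x, y]) g t.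
Proof.
move=> cu gi H x y x0 xy yl.
have ui : leb.-integrable `[0, l] (EFin \o u).
  by apply: continuous_compact_integrable => //; exact: segment_compact.
suff E0 : u x - u y + \int[leb]_(t in `]x, y]) g t = 0.
  by apply/eqP; rewrite -subr_eq0 -oppr_eq0 -E0; apply/eqP; ring.
have c1 := mollifier_cvg cu (ltW x0) (lt_trans xy yl).
have c2 := mollifier_cvg cu (ltW (lt_trans x0 xy)) yl.
have c3 := bump_integral_cvg (ltW x0) (ltW xy) (ltW yl) gi.
have c4 := cvgD (cvgB c1 c2) c3.
rewrite -(cvg_lim (@Rhausdorff R) (c4 _ _)); apply: cvg_lim; first exact: Rhausdorff.
apply: cvg_near_cst; near=> n; apply/eqP.
have n0 : 0 < n.+1%:R :> R by [].
have tf : test_function l (bump n.+1%:R x y).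
  apply: test_function_bump => //.
  rewrite -ltrBrDl; apply: (@le_lt_trans _ _ ((l - y) / 2)); last by lra.
  rewrite ler_pdivrMr// mulrC -ler_pdivrMr; last lra.
  rewrite (@le_trans _ _ n%:R)// ?ler_nat//.
  by near: n; exact: nbhs_infty_ger.
have := H _ tf; rewrite (derive1_is_derive (is_derive_bump n.+1%:R x y)).
under eq_Rintegral do rewrite mulrBr.
rewrite RintegralB//=; try exact: integrable_mul_continuous ui (@continuous_tent _ _ _).
move=> EH; apply/eqP; rewrite -[RHS](addNr (\int[leb]_(t in `[0, l]) (g t * bump n.+1%:R x y t))) -EH.
by [].
Unshelve. all: by end_near. Qed.

(** The difference [w] of [u] and the primitive of [g] is constant in the interior by the previous
    lemma and continuous up to the boundary, hence constant on [0, l]. *)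
Lemma du_bois_reymond u g l : 0 < l -> {within `[0, l], continuous u} ->
  leb.-integrable `[0, l] (EFin \o g) ->
  (forall phi, test_function l phi ->
    \int[leb]_(t in `[0, l]) (u t * derive1 phi t) = - \int[leb]_(t in `[0, l]) (g t * phi t)) ->
  forall x y, 0 <= x -> x <= y -> y <= l -> u y - u x = \int[leb]_(t in `]x, y]) g t.
Proof.
move=> l0 cu gi H x y x0 xy yl.
pose w t := u t - \int[leb]_(s in `[0, t]) g s.
have gB s t : 0 <= s -> s <= t -> t <= l ->
    \int[leb]_(z in `[0, t]) g z - \int[leb]_(z in `[0, s]) g z = \int[leb]_(z in `]s, t]) g z.
  move=> s0 st tl; apply: Rintegral_itvB; rewrite ?bnd_simp//.
  apply: integrableS gi => //; apply: subset_itvl; by rewrite bnd_simp.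
have cw : {within `[0, l], continuous w}.
  have := parameterized_integral_continuous (ltW l0) gi.
  by move=> cG; apply/subspace_continuousP => t tl; apply: cvgB;
    [move/subspace_continuousP : cu; exact|move/subspace_continuousP : cG; exact].
have wi s t : 0 < s -> s <= t -> t < l -> w t = w s.
  move=> s0; rewrite le_eqVlt => /predU1P[->//|st] tl.
  have := du_bois_reymond_interior cu gi H s0 st tl.
  have := gB s t (ltW s0) (ltW st) (ltW tl); rewrite /w; lra.
have wc t : 0 <= t -> t <= l -> w t = w (l / 2).
  move=> t0 tl; apply/eqP; rewrite -subr_eq0 -normr_le0; apply/ler_addgt0Pl => e e0.
  have [|d d0 Hd] := within_continuous_eps cw _ e0 (x := t).
    by rewrite /= in_itv/= t0.
  (* Moving t by the fraction [eta] towards the midpoint gives an interior point [s] at distance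
     less than [d] from t, also when t is an end point. *)
  pose eta := Num.min 1 (d / l).
  have e1 : 0 < eta by rewrite lt_min ltr01 divr_gt0.
  have e2 : eta <= 1 by rewrite ge_min lexx.
  have e3 : eta * l <= d by rewrite -ler_pdivlMr// ge_min lexx orbT.
  pose s := t + eta * (l / 2 - t).
  have [s0 sl] : 0 < s /\ s < l by split; rewrite /s; nra.
  rewrite addr0 distrC; have -> : w (l / 2) = w s.
    by have [h|h] := leP s (l / 2); [|symmetry; move/ltW: h => h]; apply: wi => //; lra.
  apply: Hd; first by rewrite /= in_itv/= !ltW.
  rewrite /s addrAC subrr add0r normrM (gtr0_norm e1).
  apply: lt_le_trans e3; rewrite ltr_pM2l// ltr_norml; apply/andP; split; lra.
have := gB x y x0 xy yl; have := wc x x0 (le_trans xy yl).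
have := wc y (le_trans x0 xy) yl; rewrite /w; lra.
Qed.

(** The extension of [f] by 0 has vanishing primitive, and almost everywhere it is the derivative of
    its primitive. *)
Lemma integral_eq0_ae f l : leb.-integrable `[0, l] (EFin \o f) ->
  (forall x, 0 <= x -> x <= l -> \int[leb]_(t in `[0, x]) f t = 0) ->
  {ae leb, forall x, `[0, l]%classic x -> f x = 0}.
Proof.
move=> fi f0.
pose f' := f \_ `[0, l].
have f'i (D : set R) : measurable D -> leb.-integrable D (EFin \o f').
  move=> mD; apply: (@integrableS _ _ _ leb setT) => //.
  rewrite /f' -restrict_EFin; apply/integrable_restrict => //; rewrite ?setTI//.
have mI : measurable (`[0, l]%classic : set R) by exact: measurable_itv.
have := @FTC1Ny R f' (fun y => f'i _ (measurable_itv _)) (integrable_locally mI fi) => /=.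
have -> : (fun x => \int[leb]_(t in `]-oo, x]) f' t) = cst 0.
  apply/funext => x /=; rewrite -[LHS]Rintegral_mkcondr.
  have [l0|l0] := ltP l 0.
    by rewrite [X in _ `&` X]set_itv_ge ?setI0 ?Rintegral_set0// bnd_simp -ltNge.
  have -> : `]-oo, x]%classic `&` `[0, l]%classic = `[0, Num.min x l]%classic.
    apply/seteqP; split => t /=; rewrite !in_itv/= le_min.
      by case=> -> /andP[-> ->].
    by move=> /andP[-> /andP[-> ->]].
  have [x0|x0] := ltP x 0.
    rewrite set_itv_ge ?Rintegral_set0// bnd_simp -ltNge.
    by rewrite gt_min x0.
  by rewrite f0// ?le_min ?x0// ge_min lexx orbT.
apply: (@filterS _ _ (ae_filter_ringOfSetsType _)) => x /=; rewrite in_itv/= => -[_ +] /andP[x0 xl].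
by rewrite derive1_cst /f' patchE mem_setE in_itv/= x0 xl.
Qed.

(** Cauchy-Schwarz against the constant 1, read off from the nonnegative variance of [f] on ]x, y];
    the interval is then enlarged to [0, l]. *)
Lemma sqr_integral_le f l x y : 0 <= x -> x <= y -> y <= l ->
  leb.-integrable `[0, l] (EFin \o f) ->
  leb.-integrable `[0, l] (EFin \o (fun t => f t ^+ 2)) ->
  (\int[leb]_(t in `]x, y]) f t) ^+ 2 <= l * \int[leb]_(t in `[0, l]) (f t ^+ 2).
Proof.
move=> x0 xy yl fi fi2.
set I2 := \int[leb]_(t in `[0, l]) (f t ^+ 2).
have I20 : 0 <= I2 by apply: Rintegral_ge0 => t _; exact: sqr_ge0.
have l0 : 0 <= l by rewrite (le_trans x0)// (le_trans xy).
move: xy; rewrite le_eqVlt => /predU1P[<-|xy].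
  rewrite set_itv_ge ?bnd_simp ?ltxx// Rintegral_set0 expr2 mul0r.
  exact: mulr_ge0.
have sub : `]x, y]%classic `<=` `[0, l]%classic.
  by move=> t /=; rewrite !in_itv/= => /andP[? ?]; apply/andP; split; lra.
have gi : leb.-integrable `]x, y] (EFin \o f) by apply: integrableS fi.
have gi2 : leb.-integrable `]x, y] (EFin \o (fun t => f t ^+ 2)) by apply: integrableS fi2.
set J := \int[leb]_(t in `]x, y]) f t.
set J2 := \int[leb]_(t in `]x, y]) (f t ^+ 2).
have J2I : J2 <= I2.
  rewrite /J2 /I2 [leLHS]Rintegral_mkcond [leRHS]Rintegral_mkcond.
  apply: le_Rintegral => //.
  - by rewrite -restrict_EFin; apply/integrable_restrict; rewrite ?setTI.
  - by rewrite -restrict_EFin; apply/integrable_restrict; rewrite ?setTI.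
  move=> t _; rewrite !patchE; case: ifPn => [|_].
    by move=> /set_mem/sub/mem_set ->.
  by case: ifP => _ //; exact: sqr_ge0.
(* The mean of [f] on ]x, y]. *)
pose c := J / (y - x).
have yx0 : 0 < y - x by rewrite subr_gt0.
have cE : c * (y - x) = J by rewrite /c divfK// gt_eqF.
have ci : leb.-integrable `]x, y] (EFin \o cst (c ^+ 2)).
  apply: (@integrableS _ _ _ leb `[x, y]%classic) => //; first exact: subset_itv_oc_cc.
  apply: continuous_integrable; exact: cst_continuous.
have : 0 <= \int[leb]_(t in `]x, y]) (f t - c) ^+ 2.
  by apply: Rintegral_ge0 => t _; exact: sqr_ge0.
have -> : \int[leb]_(t in `]x, y]) (f t - c) ^+ 2 = J2 + (- 2 * c * J + c ^+ 2 * (y - x)).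
  have -> : c ^+ 2 * (y - x) = \int[leb]_(t in `]x, y]) (cst (c ^+ 2) t).
    rewrite Rintegral_cst//; congr (_ * _).
    by have := @lebesgue_measure_itv R `]x, y]%R; rewrite /= lte_fin xy => ->.
  have hi : leb.-integrable `]x, y] (EFin \o (fun t => - 2 * c * f t)) by exact: integrable_cmul.
  rewrite -RintegralZl// -RintegralD// -RintegralD//.
    by apply: eq_Rintegral => t _; rewrite /=; ring.
  exact: integrable_add.
move=> pos; rewrite -cE in pos *.
have : (c * (y - x)) ^+ 2 <= (y - x) * J2.
  rewrite -(ler_pM2l yx0); have := mulr_ge0 (ltW yx0) pos; nra.
move=> /le_trans; apply; apply: (le_trans (ler_wpM2l (ltW yx0) J2I)).
apply: ler_wpM2r => //; clear -x0 yl; lra.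
Qed.

End Integrals.

(** * Semi-inner products and a criterion for quasi-unitary equivalence *)

Section ComplexParts.
Context {R : realType}.
Implicit Types x y : R[i].

Lemma Re_add x y : complex.Re (x + y) = complex.Re x + complex.Re y.
Proof. by case: x y => [a b] [c d]. Qed.

Lemma Im_add x y : complex.Im (x + y) = complex.Im x + complex.Im y.
Proof. by case: x y => [a b] [c d]. Qed.

Lemma Re_opp x : complex.Re (- x) = - complex.Re x.
Proof. by case: x. Qed.

Lemma Im_opp x : complex.Im (- x) = - complex.Im x.
Proof. by case: x. Qed.

Lemma Re_mul x y :
  complex.Re (x * y) = complex.Re x * complex.Re y - complex.Im x * complex.Im y.
Proof. by case: x y => [a b] [c d]. Qed.

Lemma Im_mul x y :
  complex.Im (x * y) = complex.Re x * complex.Im y + complex.Im x * complex.Re y.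
Proof. by case: x y => [a b] [c d]. Qed.

Lemma Re_conj x : complex.Re (conjc x) = complex.Re x.
Proof. by case: x. Qed.

Lemma Im_conj x : complex.Im (conjc x) = - complex.Im x.
Proof. by case: x. Qed.

Lemma Re_sum I (s : seq I) P (F : I -> R[i]) :
  complex.Re (\sum_(i <- s | P i) F i) = \sum_(i <- s | P i) complex.Re (F i).
Proof. by apply: (big_morph _ Re_add). Qed.

Lemma complex_eq x y : complex.Re x = complex.Re y -> complex.Im x = complex.Im y -> x = y.
Proof. by case: x y => [a b] [c d] /= -> ->. Qed.

(** The squared modulus as a polynomial in the two parts, so that estimates stay within real
    polynomial arithmetic. *)
Definition abs2 x : R := complex.Re x ^+ 2 + complex.Im x ^+ 2.

Lemma abs2_ge0 x : 0 <= abs2 x.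
Proof. by rewrite addr_ge0 ?sqr_ge0. Qed.

Lemma normc_sqr x : Normc.normc x ^+ 2 = abs2 x.
Proof. by case: x => a b /=; rewrite sqr_sqrtr// addr_ge0 ?sqr_ge0. Qed.

Lemma abs2_real (a : R) : abs2 a%:C%C = a ^+ 2.
Proof. by rewrite /abs2 /= expr0n addr0. Qed.

Lemma abs2M x y : abs2 (x * y) = abs2 x * abs2 y.
Proof. by rewrite /abs2 Re_mul Im_mul; ring. Qed.

Lemma abs2_conj x y : x * conjc y = complex.Complex
  (complex.Re x * complex.Re y + complex.Im x * complex.Im y)
  (complex.Im x * complex.Re y - complex.Re x * complex.Im y).
Proof.
by apply: complex_eq; rewrite ?Re_mul ?Im_mul Re_conj Im_conj/=; ring.
Qed.

Lemma Re_mul_conj x : complex.Re (x * conjc x) = abs2 x.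
Proof. by rewrite abs2_conj /abs2 /= !expr2. Qed.

Lemma conjcD x y : conjc (x + y) = conjc x + conjc y.
Proof. exact: rmorphD. Qed.

Lemma conjcM x y : conjc (x * y) = conjc x * conjc y.
Proof. exact: rmorphM. Qed.

Lemma conjc_sum I (s : seq I) P (F : I -> R[i]) :
  conjc (\sum_(i <- s | P i) F i) = \sum_(i <- s | P i) conjc (F i).
Proof. exact: rmorph_sum. Qed.

End ComplexParts.

Section InnerProduct.
Context {R : realType} {V : lmodType R[i]}.
Variable ip : V -> V -> R[i].

(** Definiteness is left out so that the record covers, besides the inner products of both spaces,
    forms in differences, which vanish on constants. *)
Record semi_inner_product : Prop := SemiInnerProduct {
  sip_linear : forall (a : R[i]) f g h, ip (a *: f + g) h = a * ip f h + ip g h;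
  sip_conj : forall f g, ip g f = conjc (ip f g);
  sip_ge0 : forall f, 0 <= complex.Re (ip f f) }.

Hypothesis H : semi_inner_product.

Lemma sipD f g h : ip (f + g) h = ip f h + ip g h.
Proof. by have := sip_linear H 1 f g h; rewrite scale1r mul1r. Qed.

Lemma sip0 h : ip 0 h = 0.
Proof. by apply: (addIr (ip 0 h)); rewrite -sipD addr0 add0r. Qed.

Lemma sipZ a f h : ip (a *: f) h = a * ip f h.
Proof. by have := sip_linear H a f 0 h; rewrite addr0 sip0 addr0. Qed.

Lemma sipN f h : ip (- f) h = - ip f h.
Proof. by rewrite -scaleN1r sipZ mulN1r. Qed.

Lemma sipDr f g h : ip f (g + h) = ip f g + ip f h.
Proof.
by rewrite (sip_conj H (g + h) f) (sip_conj H g f) (sip_conj H h f) sipD conjcD.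
Qed.

Lemma sipZr a f h : ip f (a *: h) = conjc a * ip f h.
Proof. by rewrite (sip_conj H (a *: h) f) (sip_conj H h f) sipZ conjcM. Qed.

Lemma sipNr f h : ip f (- h) = - ip f h.
Proof. by rewrite -scaleN1r sipZr rmorphN rmorph1 mulN1r. Qed.

Lemma sip_sum I (s : seq I) (P : pred I) (F : I -> V) h :
  ip (\sum_(i <- s | P i) F i) h = \sum_(i <- s | P i) ip (F i) h.
Proof. by apply: (big_morph (fun f => ip f h)) => [f g|]; rewrite ?sipD ?sip0. Qed.

Definition sqnorm f := complex.Re (ip f f).

Lemma sip_Re_sym f g : complex.Re (ip g f) = complex.Re (ip f g).
Proof. by rewrite (sip_conj H) Re_conj. Qed.

Lemma sqnormD f g : sqnorm (f + g) = sqnorm f + sqnorm g + 2 * complex.Re (ip f g).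
Proof. by rewrite /sqnorm sipD !sipDr !Re_add (sip_Re_sym f g); ring. Qed.

Lemma sqnormN f : sqnorm (- f) = sqnorm f.
Proof. by rewrite /sqnorm sipN sipNr opprK. Qed.

(** Expansion of |f - g|^2 >= 0; it plays the part of the Cauchy-Schwarz inequality below. *)
Lemma sqnormB_ge0 f g : 2 * complex.Re (ip f g) <= sqnorm f + sqnorm g.
Proof.
have := sip_ge0 H (f - g); rewrite -/(sqnorm _) sqnormD sqnormN sipNr Re_opp; lra.
Qed.

Lemma sqnormD_le f g : sqnorm (f + g) <= 2 * (sqnorm f + sqnorm g).
Proof. by rewrite sqnormD; have := sqnormB_ge0 f g; lra. Qed.

End InnerProduct.

(** * A sufficient criterion with exact adjoints and exactly matching forms *)

Section QuasiUnitaryCriterion.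
Context {R : realType} (A B : form_space R).
Hypothesis HA : semi_inner_product (@fs_inner _ A).
Hypothesis HB : semi_inner_product (@fs_inner _ B).
Variables (J : {linear fs_space A -> fs_space B}) (J' : {linear fs_space B -> fs_space A}).
Variables (J1' : B -> A) (e : R).
Local Notation qA := (sqnorm (@fs_inner _ A)).
Local Notation qB := (sqnorm (@fs_inner _ B)).
Local Notation EA f := (complex.Re (@fs_form _ A f f)).
Local Notation EB u := (complex.Re (@fs_form _ B u u)).

Hypothesis e0 : 0 <= e.
Hypothesis domA : forall f, @fs_dom _ A f.
Hypothesis domJ : forall f, @fs_dom _ B (J f).
Hypothesis adj : forall f u, fs_inner (J f) u = fs_inner f (J' u).
Hypothesis J_contr : forall f, qB (J f) <= qA f.
Hypothesis J1'_lin : forall (a : R[i]) u v, @fs_dom _ B u -> @fs_dom _ B v ->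
  J1' (a *: u + v) = a *: J1' u + J1' v.
Hypothesis J1'_J : forall f, J1' (J f) = f.
Hypothesis form_adj : forall f u, @fs_dom _ B u -> fs_form (J f) u = fs_form f (J1' u).
Hypothesis EA_ge0 : forall f, 0 <= EA f.
Hypothesis EB_ge0 : forall u, 0 <= EB u.
Hypothesis EA_J1' : forall u, @fs_dom _ B u -> EA (J1' u) <= EB u.
Hypothesis errA : forall f, qA (f - J' (J f)) <= e ^+ 2 * EA f.
Hypothesis errB : forall u, @fs_dom _ B u -> qB (u - J (J1' u)) <= e ^+ 2 * EB u.

Lemma hnorm_sqr (C : form_space R) (HC : semi_inner_product (@fs_inner _ C)) (f : C) :
  hnorm f ^+ 2 = sqnorm (@fs_inner _ C) f.
Proof. by rewrite /hnorm sqr_sqrtr// (sip_ge0 HC). Qed.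

Lemma hnorm1_sqr (C : form_space R) (HC : semi_inner_product (@fs_inner _ C)) (f : C) :
  0 <= complex.Re (fs_form f f) ->
  hnorm1 f ^+ 2 = sqnorm (@fs_inner _ C) f + complex.Re (fs_form f f).
Proof.
by move=> f0; rewrite /hnorm1 sqr_sqrtr (hnorm_sqr HC)// addr_ge0// (sip_ge0 HC).
Qed.

Lemma hnorm_ge0 (C : form_space R) (f : C) : 0 <= hnorm f.
Proof. exact: sqrtr_ge0. Qed.

Lemma hnorm1_ge0 (C : form_space R) (f : C) : 0 <= hnorm1 f.
Proof. exact: sqrtr_ge0. Qed.

(** As the adjoint of a contraction: 2 |J'u|^2 = 2 Re <JJ'u, u> <= |JJ'u|^2 + |u|^2 <= |J'u|^2 +
    |u|^2. *)
Lemma J'_contr u : qA (J' u) <= qB u.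
Proof.
have := sqnormB_ge0 HB (J (J' u)) u; rewrite adj -/(qA _).
by have := J_contr (J' u); lra.
Qed.

(** Passing through J'JJ'^1 u leaves two terms, one controlled by [errA] and one by [errB] and the
    contraction J'; the factor is 2 (1 + 1). *)
Lemma errJ1' u : @fs_dom _ B u -> qA (J1' u - J' u) <= 4 * e ^+ 2 * EB u.
Proof.
move=> du.
have -> : J1' u - J' u = (J1' u - J' (J (J1' u))) + J' (J (J1' u) - u).
  by rewrite linearB addrA subrK.
apply: le_trans (sqnormD_le HA _ _) _.
have := errA (J1' u); have := J'_contr (J (J1' u) - u).
rewrite -opprB (sqnormN HB); have := errB du; have := EA_J1' du.
have := ler_wpM2l (sqr_ge0 e) (EA_J1' du); lra.
Qed.

(** Passing through JJ'^1 u leaves errors with factors 1 and 4, hence 2 (1 + 4). *)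
Lemma errJJ' u : @fs_dom _ B u -> qB (u - J (J' u)) <= 10 * e ^+ 2 * EB u.
Proof.
move=> du.
have -> : u - J (J' u) = (u - J (J1' u)) + J (J1' u - J' u).
  by rewrite linearB addrA subrK.
apply: le_trans (sqnormD_le HB _ _) _.
have := errB du; have := errJ1' du; have := J_contr (J1' u - J' u); lra.
Qed.

(** Taking J^1 = J makes its error vanish. The squared errors that remain carry the factors 1, 4 and
    10, all below 16, which explains the 4. *)
Lemma quasi_unitary_criterion : quasi_unitary_equivalent (4 * e) A B.
Proof.
have e2 : 0 <= e ^+ 2 by exact: sqr_ge0.
have leh (a b : R) : 0 <= b -> a ^+ 2 <= b ^+ 2 -> a <= b.
  move=> b0 ab; have [a0|a0] := leP a 0; first exact: le_trans b0.
  by rewrite -ler_sqr ?nnegrE// ltW.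
(* Turns a squared error of at most [c * e ^+ 2 * E] into a bound by the first-order norm [h], where
   [h ^+ 2 = q + E]. *)
have bnd (c q h E : R) : 0 <= q -> 0 <= E -> h ^+ 2 = q + E ->
    c * e ^+ 2 * E <= 16 * e ^+ 2 * E -> c * e ^+ 2 * E <= (4 * e * h) ^+ 2.
  move=> q0 E0 hE cE; rewrite !exprMn hE.
  apply: (le_trans cE); have := mulr_ge0 e2 q0; lra.
exists J, J', J, J1'; split.
- split.
  + exists 1 => f; rewrite mul1r; apply: leh; first exact: hnorm_ge0.
    by rewrite (hnorm_sqr HA) (hnorm_sqr HB).
  + exists 1 => f; rewrite mul1r; apply: leh; first exact: hnorm_ge0.
    by rewrite (hnorm_sqr HA) (hnorm_sqr HB) J'_contr.
  + split => [f _|a f g _ _|]; [exact: domJ|exact: linearP|].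
    exists 1 => f _; rewrite mul1r; apply: leh; first exact: hnorm1_ge0.
    rewrite (hnorm1_sqr HA)// (hnorm1_sqr HB)// form_adj// J1'_J.
    by rewrite lerD2r J_contr.
  + split => [u _|//|]; first exact: domA.
    (* With q and E the squared norm and energy of u, |J'^1 u|^2 <= 2 q + 8 e^2 E and its energy is
       at most E; the sum is below 9 (1 + e)^2 (q + E). *)
    exists (3 * (1 + e)) => u du; apply: leh.
      by rewrite mulr_ge0 ?hnorm1_ge0// mulr_ge0// addr_ge0.
    rewrite exprMn (hnorm1_sqr HA)// (hnorm1_sqr HB)//.
    have -> : J1' u = (J1' u - J' u) + J' u by rewrite subrK.
    have := sqnormD_le HA (J1' u - J' u) (J' u); rewrite subrK.
    have := errJ1' du; have := J'_contr u; have := EA_J1' du.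
    have := EB_ge0 u; have := sip_ge0 HB u; rewrite -/(qB u).
    move: (qB u) (EB u) (EA _) (qA (J1' u)) (qA (_ - _)) (qA (J' u)) => b c d f g h.
    move=> b0 c0 dc hb gc fgh.
    have := mulr_ge0 e0 b0; have := mulr_ge0 e0 c0; have := mulr_ge0 e2 b0.
    have := mulr_ge0 e2 c0; nra.
- split=> [f|f u]; last by rewrite adj subrr Normc.normc0 !mulr_ge0 ?hnorm_ge0.
  apply: leh; first by rewrite mulr_ge0 ?hnorm_ge0// addr_ge0// mulr_ge0.
  rewrite exprMn (hnorm_sqr HA) (hnorm_sqr HB); apply: (le_trans (J_contr f)).
  by rewrite ler_peMl ?(sip_ge0 HA)// exprn_ege1// lerDl mulr_ge0.
- split=> [f _|u du]; (apply: leh; first by rewrite !mulr_ge0 ?hnorm1_ge0).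
    rewrite (hnorm_sqr HA) (le_trans (errA f))//.
    have := @bnd 1 _ _ _ (sip_ge0 HA f) (EA_ge0 f) (hnorm1_sqr HA (EA_ge0 f)).
    rewrite mul1r; apply; have := mulr_ge0 e2 (EA_ge0 f); lra.
  rewrite (hnorm_sqr HB) (le_trans (errJJ' du))//.
  apply: (@bnd _ _ _ _ (sip_ge0 HB u) (EB_ge0 u) (hnorm1_sqr HB (EB_ge0 u))).
  by have := mulr_ge0 e2 (EB_ge0 u); lra.
- split=> [f _|u du]; (apply: leh; first by rewrite !mulr_ge0 ?hnorm1_ge0).
    by rewrite subrr (hnorm_sqr HB) /sqnorm (sip0 HB) sqr_ge0.
  rewrite (hnorm_sqr HA) (le_trans (errJ1' du))//.
  apply: (@bnd _ _ _ _ (sip_ge0 HB u) (EB_ge0 u) (hnorm1_sqr HB (EB_ge0 u))).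
  by have := mulr_ge0 e2 (EB_ge0 u); lra.
- move=> f u _ du.
  by rewrite form_adj// subrr Normc.normc0 !mulr_ge0 ?hnorm1_ge0.
Qed.

End QuasiUnitaryCriterion.

(** * Complex-valued functions on an interval *)

Section ComplexContinuity.
Context {R : realType}.

Lemma Re_le_norm (z : R[i]) : `|complex.Re z|%:C%C <= `|z|.
Proof.
rewrite normc_def lecR -sqrtr_sqr ler_wsqrtr// lerDl; exact: sqr_ge0.
Qed.

Lemma Im_le_norm (z : R[i]) : `|complex.Im z|%:C%C <= `|z|.
Proof.
rewrite normc_def lecR -sqrtr_sqr ler_wsqrtr// lerDr; exact: sqr_ge0.
Qed.

Lemma cvg_Re T (F : set_system T) (FF : Filter F) (f : T -> R[i]^o) (z : R[i]^o) :
  f @ F --> z -> complex.Re (f x) @[x --> F] --> complex.Re z.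
Proof.
move=> /cvgrPdist_le fz; apply/cvgrPdist_le => e e0.
have := fz e%:C%C; rewrite ltcR => /(_ e0); apply: filterS => x.
rewrite -Re_opp -Re_add -lecR; exact: le_trans (Re_le_norm _).
Qed.

Lemma cvg_Im T (F : set_system T) (FF : Filter F) (f : T -> R[i]^o) (z : R[i]^o) :
  f @ F --> z -> complex.Im (f x) @[x --> F] --> complex.Im z.
Proof.
move=> /cvgrPdist_le fz; apply/cvgrPdist_le => e e0.
have := fz e%:C%C; rewrite ltcR => /(_ e0); apply: filterS => x.
rewrite -Im_opp -Im_add -lecR; exact: le_trans (Im_le_norm _).
Qed.

Lemma within_continuous_Re (T : topologicalType) (A : set T) (f : T -> R[i]) :
  {within A, continuous (f : T -> R[i]^o)} ->
  {within A, continuous (fun x => complex.Re (f x))}.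
Proof.
move=> /subspace_continuousP cf; apply/subspace_continuousP => x Ax.
exact: cvg_Re (cf x Ax).
Qed.

Lemma within_continuous_Im (T : topologicalType) (A : set T) (f : T -> R[i]) :
  {within A, continuous (f : T -> R[i]^o)} ->
  {within A, continuous (fun x => complex.Im (f x))}.
Proof.
move=> /subspace_continuousP cf; apply/subspace_continuousP => x Ax.
exact: cvg_Im (cf x Ax).
Qed.

Lemma cvg_complex T (F : set_system T) (FF : Filter F) (f : T -> R[i]^o) (z : R[i]^o) :
  complex.Re (f x) @[x --> F] --> complex.Re z ->
  complex.Im (f x) @[x --> F] --> complex.Im z -> f @ F --> z.
Proof.
move=> /cvgrPdist_le fr /cvgrPdist_le fi; apply/cvgrPdist_le => e e0.
(* The radius ranges over complex numbers, but a positive one is real. *)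
have : (complex.Re e)%:C%C = e by apply: RRe_real; exact: gtr0_real.
move: (complex.Re e) => r re; move: e0; rewrite -re (_ : 0 = 0%:C%C)// ltcR => r0.
have r20 : 0 < r / 2 by rewrite divr_gt0.
apply: filterS2 (fr _ r20) (fi _ r20) => x hr hi.
rewrite normc_def lecR Re_add Re_opp Im_add Im_opp.
have -> : r = Num.sqrt (r ^+ 2) by rewrite sqrtr_sqr gtr0_norm.
rewrite ler_wsqrtr//.
rewrite -(real_normK (num_real (_ - _))) -(real_normK (num_real (complex.Im _ - _))).
have := normr_ge0 (complex.Re z - complex.Re (f x)).
have := normr_ge0 (complex.Im z - complex.Im (f x)); nra.
Qed.

Lemma within_continuous_complex (T : topologicalType) (A : set T) (f : T -> R[i]) :
  {within A, continuous (fun x => complex.Re (f x))} ->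
  {within A, continuous (fun x => complex.Im (f x))} ->
  {within A, continuous (f : T -> R[i]^o)}.
Proof.
move=> /subspace_continuousP fr /subspace_continuousP fi.
by apply/subspace_continuousP => x Ax; apply: cvg_complex; [exact: fr|exact: fi].
Qed.

End ComplexContinuity.

Section IntervalIntegrals.
Context {R : realType}.
Notation leb := (@lebesgue_measure R).
Implicit Types (l : R) (f g : R -> R[i]).

Let itv l : set R := `[0, l]%classic.

Lemma integral_interval_measure l (F : R -> \bar R) :
  (\int[interval_measure l]_(x in `[0%R, l]) F x = \int[leb]_(x in `[0%R, l]) F x)%E.
Proof.
apply: eq_measure_integral => A mA Al; rewrite /interval_measure /= /mrestr setIidl//.
Qed.

(** The complement of [0, l] is a null set of the restricted measure. *)
Lemma ge0_integral_interval_measure l (F : R -> \bar R) :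
  measurable_fun setT F -> (forall x, 0 <= F x)%E ->
  (\int[interval_measure l]_x F x = \int[leb]_(x in `[0%R, l]) F x)%E.
Proof.
move=> mF F0; rewrite -(setUv (itv l)) ge0_integral_setU//=; last 4 first.
- exact: measurable_itv.
- by apply: measurableC; exact: measurable_itv.
- by rewrite setUv.
- by apply/disj_setPCl.
rewrite [X in (_ + X)%E]null_set_integral ?adde0 ?integral_interval_measure//.
- by apply: measurableC; exact: measurable_itv.
- exact: measurable_funTS.
- by rewrite /interval_measure /= /mrestr setICl measure0.
Qed.

Lemma Lfun1_lebesgue_integrable l (h : R -> R) :
  h \in Lfun (interval_measure l) 1 -> leb.-integrable `[0, l] (EFin \o h).
Proof.
move=> /Lfun1_integrable hi.
have /integrableP[mh hoo] : (interval_measure l).-integrable `[0, l] (EFin \o h).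
  by apply: integrableS hi => //; exact: measurable_itv.
by apply/integrableP; split => //; rewrite -integral_interval_measure.
Qed.

Lemma interval_measure_fin l : interval_measure l setT \is a fin_num.
Proof.
rewrite /interval_measure /= /mrestr setTI lebesgue_measure_itv/=.
by case: ifP.
Qed.

Lemma Lfun2_lebesgue_integrable l (h : R -> R) :
  h \in Lfun (interval_measure l) 2%:E -> leb.-integrable `[0, l] (EFin \o h).
Proof.
move=> h2; apply: Lfun1_lebesgue_integrable.
exact: (Lfun_subset12 (interval_measure_fin l)).
Qed.

Lemma Lfun2_mul_lebesgue_integrable l (h k : R -> R) :
  h \in Lfun (interval_measure l) 2%:E -> k \in Lfun (interval_measure l) 2%:E ->
  leb.-integrable `[0, l] (EFin \o (fun x => h x * k x)).
Proof.
by move=> h2 k2; apply: Lfun1_lebesgue_integrable; exact: Lfun2_mul_Lfun1.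
Qed.

Lemma continuous_Lfun2 l (h : R -> R) : continuous h ->
  h \in Lfun (interval_measure l) 2%:E.
Proof.
move=> ch.
have mh : measurable_fun setT h by exact: continuous_measurable_fun.
rewrite inE; apply/andP; split; rewrite inE//=.
rewrite /finite_norm unlock /=; apply: poweR_lty.
have mF : measurable_fun setT (fun x => (`|h x| `^ 2)%:E).
  apply/measurable_EFinP.
  apply: (@measurableT_comp _ _ _ _ _ _ (fun x : R => x `^ 2)%R) => //.
  exact/measurableT_comp.
rewrite (ge0_integral_interval_measure l mF); last first.
  by move=> x; rewrite lee_fin powR_ge0.
have : leb.-integrable `[0, l] (EFin \o (fun x => h x * h x)).
  by apply: continuous_integrable => x; apply: cvgM; exact: ch.
move=> /integrableP[_]; apply: le_lt_trans.
rewrite le_eqVlt; apply/orP; left; apply/eqP; apply: eq_integral => x _ /=.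
by rewrite powR_mulrn// -normrX expr2.
Qed.

Definition cintegrable l f :=
  leb.-integrable `[0, l] (EFin \o (fun x => complex.Re (f x))) /\
  leb.-integrable `[0, l] (EFin \o (fun x => complex.Im (f x))).

Lemma cintegrableZ l (c : R[i]) f : cintegrable l f -> cintegrable l (fun x => c * f x).
Proof.
move=> [fr fi]; split.
  rewrite (_ : _ \o _ = EFin \o (fun x => complex.Re c * complex.Re (f x)
      - complex.Im c * complex.Im (f x))).
    by apply: integrable_sub => //; exact: integrable_cmul.
  by apply/funext => x /=; rewrite Re_mul.
rewrite (_ : _ \o _ = EFin \o (fun x => complex.Re c * complex.Im (f x)
    + complex.Im c * complex.Re (f x))).
  by apply: integrable_add => //; exact: integrable_cmul.
by apply/funext => x /=; rewrite Im_mul.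
Qed.

Lemma CintegralD l f g : cintegrable l f -> cintegrable l g ->
  Cintegral l (fun x => f x + g x) = Cintegral l f + Cintegral l g.
Proof.
move=> [fr fi] [gr gi]; apply: complex_eq; rewrite ?Re_add ?Im_add /=.
  by rewrite -RintegralD//; apply: eq_Rintegral => x _; rewrite Re_add.
by rewrite -RintegralD//; apply: eq_Rintegral => x _; rewrite Im_add.
Qed.

Lemma CintegralZ l (c : R[i]) f : cintegrable l f ->
  Cintegral l (fun x => c * f x) = c * Cintegral l f.
Proof.
move=> [fr fi]; apply: complex_eq; rewrite ?Re_mul ?Im_mul /=.
  rewrite -!RintegralZl// -RintegralB//; try exact: integrable_cmul.
  by apply: eq_Rintegral => x _; rewrite Re_mul.
rewrite -!RintegralZl// -RintegralD//; try exact: integrable_cmul.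
by apply: eq_Rintegral => x _; rewrite Im_mul.
Qed.

Lemma Cintegral_conj l f : cintegrable l f ->
  Cintegral l (fun x => conjc (f x)) = conjc (Cintegral l f).
Proof.
move=> [fr fi]; apply: complex_eq; rewrite ?Re_conj ?Im_conj /=.
  by apply: eq_Rintegral => x _; rewrite Re_conj.
rewrite -mulN1r -RintegralZl//.
by apply: eq_Rintegral => x _; rewrite Im_conj mulN1r.
Qed.

Lemma eq_Cintegral l f g : (forall x, 0 <= x -> x <= l -> f x = g x) ->
  Cintegral l f = Cintegral l g.
Proof.
move=> fg; apply: complex_eq => /=; apply: eq_Rintegral => x;
  by rewrite inE/= in_itv/= => /andP[x0 xl]; rewrite fg.
Qed.

Lemma ae_eq_Cintegral l f g : cintegrable l f -> cintegrable l g ->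
  {ae leb, forall x, `[0, l]%classic x -> f x = g x} ->
  Cintegral l f = Cintegral l g.
Proof.
move=> [fr fi] [gr gi] fg; apply: complex_eq; congr fine; apply: ae_eq_integral => //;
  try (by apply: measurable_int; eassumption);
  by apply: (@filterS _ _ (ae_filter_ringOfSetsType _)) fg => x /= fgx xl; rewrite fgx.
Qed.

Definition sqintegrable l f :=
  (@complex.Re R \o f) \in Lfun (interval_measure l) 2%:E /\
  (@complex.Im R \o f) \in Lfun (interval_measure l) 2%:E.

Lemma cintegrable_mul_conj l f g : sqintegrable l f -> sqintegrable l g ->
  cintegrable l (fun x => f x * conjc (g x)).
Proof.
move=> [fr fi] [gr gi]; split.
  rewrite (_ : _ \o _ = EFin \o (fun x => complex.Re (f x) * complex.Re (g x)
      + complex.Im (f x) * complex.Im (g x))).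
    by apply: integrable_add => //; exact: Lfun2_mul_lebesgue_integrable.
  by apply/funext => x /=; rewrite abs2_conj.
rewrite (_ : _ \o _ = EFin \o (fun x => complex.Im (f x) * complex.Re (g x)
    - complex.Re (f x) * complex.Im (g x))).
  by apply: integrable_sub => //; exact: Lfun2_mul_lebesgue_integrable.
by apply/funext => x /=; rewrite abs2_conj.
Qed.

Lemma sqintegrable_cintegrable l f : sqintegrable l f -> cintegrable l f.
Proof. by move=> [fr fi]; split; exact: Lfun2_lebesgue_integrable. Qed.

Lemma sqintegrable_abs2 l f : sqintegrable l f ->
  leb.-integrable `[0, l] (EFin \o (fun x => abs2 (f x))).
Proof.
move=> [fr fi]; rewrite (_ : _ \o _ =
    EFin \o (fun x => complex.Re (f x) * complex.Re (f x)
      + complex.Im (f x) * complex.Im (f x))).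
  by apply: integrable_add => //; exact: Lfun2_mul_lebesgue_integrable.
by apply/funext => x /=; rewrite /abs2 !expr2.
Qed.

Lemma Re_Cintegral_conj l f : complex.Re (Cintegral l (fun x => f x * conjc (f x))) =
  \int[leb]_(x in `[0, l]) abs2 (f x).
Proof. by apply: eq_Rintegral => x _; rewrite Re_mul_conj. Qed.

Lemma continuous_sqintegrable l f : continuous (fun x => complex.Re (f x)) ->
  continuous (fun x => complex.Im (f x)) -> sqintegrable l f.
Proof. by move=> fr fi; split; exact: continuous_Lfun2. Qed.

Lemma ae_interval_measure l (P : R -> Prop) : {ae interval_measure l, forall x, P x} ->
  {ae leb, forall x, `[0, l]%classic x -> P x}.
Proof.
move=> [N [mN N0 sub]]; exists (N `&` itv l); split.
- by apply: measurableI => //; exact: measurable_itv.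
- exact: N0.
- move=> x /= /not_implyP[xl nP]; split => //; exact: sub.
Qed.

(** The exceptional set is enlarged by the complement of [0, l], which is null for the restricted
    measure. *)
Lemma ae_interval_measureI l (P : R -> Prop) :
  {ae leb, forall x, `[0, l]%classic x -> P x} -> {ae interval_measure l, forall x, P x}.
Proof.
move=> [N [mN N0 sub]]; exists (N `|` ~` itv l); split.
- by apply: measurableU => //; apply: measurableC; exact: measurable_itv.
- rewrite /interval_measure /= /mrestr setIUl setICl setU0.
  apply/eqP; rewrite eq_le measure_ge0 andbT -N0.
  apply: le_measure; rewrite ?inE//; apply: measurableI => //; exact: measurable_itv.
- move=> x /= nP; have [xl|] := pselect (itv l x); last by right.
  by left; apply: sub => /= /(_ xl).
Qed.

End IntervalIntegrals.

(** * Weak derivatives on metric graphs *)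

Section GraphL2.
Context {R : realType} (M : metric_graph R).
Notation leb := (@lebesgue_measure R).
Local Notation E := (mg_edge M).
Local Notation len := (@mg_len R M).
Implicit Types (u v g h : L2fun M) (e : E).

Lemma L2fun_sqintegrable u e : sqintegrable (len e) (u e).
Proof. by have /asboolP := L2valP u; exact. Qed.

Lemma L2fun_cintegrable u e : cintegrable (len e) (u e).
Proof. exact/sqintegrable_cintegrable/L2fun_sqintegrable. Qed.

Lemma L2fun_cintegrable_mul u v e : cintegrable (len e) (fun x => u e x * conjc (v e x)).
Proof. by apply: cintegrable_mul_conj; exact: L2fun_sqintegrable. Qed.

Lemma L2fun_linE (a : R[i]) u v e x : (a *: u + v) e x = a * u e x + v e x.
Proof. by []. Qed.

Lemma L2class_eqP u v : L2class u = L2class v <->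
  forall e, {ae leb, forall x, `[0, len e]%classic x -> u e x = v e x}.
Proof.
rewrite L2classE; split.
  move=> + e => /asboolP/(_ e)/ae_interval_measure.
  apply: (@filterS _ _ (ae_filter_ringOfSetsType _)) => x h xl.
  by apply/eqP; rewrite -subr_eq0; apply/eqP; exact: (h xl).
move=> H; apply/asboolP => e; apply: ae_interval_measureI.
apply: (@filterS _ _ (ae_filter_ringOfSetsType _)) (H e) => x h xl.
by rewrite [LHS](_ : _ = u e x - v e x)// h// subrr.
Qed.

(** [L2inner] uses chosen representatives, which agree with [u] and [v] almost everywhere; from here
    on any representative may be used. *)
Lemma L2inner_class u v : L2inner (L2class u) (L2class v) =
  \sum_e Cintegral (len e) (fun x => u e x * conjc (v e x)).
Proof.
rewrite /L2inner; apply: eq_bigr => e _.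
apply: ae_eq_Cintegral; try exact: L2fun_cintegrable_mul.
have /L2class_eqP/(_ e) hu := L2reprK (L2class u).
have /L2class_eqP/(_ e) hv := L2reprK (L2class v).
apply: (@filterS2 _ _ (ae_filter_ringOfSetsType _)) hu hv => x hu hv xl.
by rewrite hu// hv.
Qed.

Lemma L2class_lin (a : R[i]) u v : L2class (a *: u + v) = a *: L2class u + L2class v.
Proof. by rewrite L2classD -L2scale_class. Qed.

Lemma L2class0 : L2class (0 : L2fun M) = 0.
Proof. by apply: (addIr (L2class 0)); rewrite -L2classD addr0 add0r. Qed.

Lemma L2_semi_inner_product : semi_inner_product (@L2inner R M).
Proof.
split.
- move=> a U V W; rewrite -[U]L2reprK -[V]L2reprK -[W]L2reprK.
  rewrite -L2class_lin !L2inner_class mulr_sumr -big_split /=.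
  apply: eq_bigr => e _; rewrite -CintegralZ; last exact: L2fun_cintegrable_mul.
  rewrite -CintegralD; [|apply: cintegrableZ; exact: L2fun_cintegrable_mul
    |exact: L2fun_cintegrable_mul].
  apply: eq_Cintegral => x _ _.
  by rewrite [LHS](_ : _ = (a * L2repr U e x + L2repr V e x) * conjc (L2repr W e x))// mulrDl mulrA.
- move=> U V; rewrite -[U]L2reprK -[V]L2reprK !L2inner_class conjc_sum.
  apply: eq_bigr => e _; rewrite -Cintegral_conj; last exact: L2fun_cintegrable_mul.
  by apply: eq_Cintegral => x _ _; rewrite conjcM conjcK mulrC.
- move=> U; rewrite -[U]L2reprK L2inner_class Re_sum; apply: sumr_ge0 => e _.
  rewrite Re_Cintegral_conj; apply: Rintegral_ge0 => x _; exact: abs2_ge0.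
Qed.

Lemma L2sqnorm_class u : sqnorm (@L2inner R M) (L2class u) =
  \sum_e \int[leb]_(x in `[0, len e]) abs2 (u e x).
Proof.
rewrite /sqnorm L2inner_class Re_sum; apply: eq_bigr => e _; exact: Re_Cintegral_conj.
Qed.

Lemma cintegrable_mul_real l (f : R -> R[i]) (phi : R -> R) :
  cintegrable l f -> continuous phi -> cintegrable l (fun x => f x * (phi x)%:C%C).
Proof.
move=> [fr fi] cphi; split.
  rewrite (_ : _ \o _ = EFin \o ((fun x => complex.Re (f x)) \* phi)).
    exact: integrable_mul_continuous.
  by apply/funext => x /=; rewrite Re_mul /= mulr0 subr0.
rewrite (_ : _ \o _ = EFin \o ((fun x => complex.Im (f x)) \* phi)).
  exact: integrable_mul_continuous.
by apply/funext => x /=; rewrite Im_mul /= mulr0 add0r.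
Qed.

Lemma test_function_continuous l (phi : R -> R) : test_function l phi ->
  continuous phi /\ continuous (derive1 phi : R -> R).
Proof.
move=> [d c _]; split => // x.
by apply: differentiable_continuous; apply/derivable1_diffP.
Qed.

Lemma is_weak_derivative_lin (a : R[i]) u v g h : is_weak_derivative u g ->
  is_weak_derivative v h -> is_weak_derivative (a *: u + v) (a *: g + h).
Proof.
move=> ug vh e phi tphi; have [cphi cdphi] := test_function_continuous tphi.
have lin (f k : L2fun M) (psi : R -> R) : continuous psi ->
   Cintegral (len e) (fun x => (a *: f + k) e x * (psi x)%:C%C) =
   a * Cintegral (len e) (fun x => f e x * (psi x)%:C%C) +
   Cintegral (len e) (fun x => k e x * (psi x)%:C%C).
  move=> cpsi.
  have i1 (w : L2fun M) : cintegrable (len e) (fun x => L2val w e x * (psi x)%:C%C).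
    by apply: cintegrable_mul_real => //; exact: L2fun_cintegrable.
  rewrite -CintegralZ// -CintegralD//; last exact: cintegrableZ.
  by apply: eq_Cintegral => x _ _; rewrite L2fun_linE mulrDl mulrA.
by rewrite !lin// ug// vh// mulrN opprD.
Qed.

Lemma is_weak_derivative_congr u v g : L2class u = L2class v ->
  is_weak_derivative u g -> is_weak_derivative v g.
Proof.
move=> /L2class_eqP uv ug e phi tphi; have [_ cdphi] := test_function_continuous tphi.
rewrite -ug//; apply: ae_eq_Cintegral.
- by apply: cintegrable_mul_real => //; exact: L2fun_cintegrable.
- by apply: cintegrable_mul_real => //; exact: L2fun_cintegrable.
apply: (@filterS _ _ (ae_filter_ringOfSetsType _)) (uv e) => x h xl.
by rewrite h.
Qed.

Lemma weak_derivativeP u g : is_weak_derivative u g ->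
  is_weak_derivative u (weak_derivative u).
Proof. by move=> ug; apply: (@xgetPex _ 0 [set g | is_weak_derivative u g]); exists g. Qed.

Lemma Re_Cintegral_real l (f : R -> R[i]) (phi : R -> R) :
  complex.Re (Cintegral l (fun x => f x * (phi x)%:C%C)) =
  \int[leb]_(t in `[0, l]) (complex.Re (f t) * phi t).
Proof. by apply: eq_Rintegral => x _; rewrite Re_mul /= mulr0 subr0. Qed.

Lemma Im_Cintegral_real l (f : R -> R[i]) (phi : R -> R) :
  complex.Im (Cintegral l (fun x => f x * (phi x)%:C%C)) =
  \int[leb]_(t in `[0, l]) (complex.Im (f t) * phi t).
Proof. by apply: eq_Rintegral => x _; rewrite Im_mul /= mulr0 add0r. Qed.

Hypothesis len_gt0 : forall e, 0 < len e.

(** Test functions are real, so the weak equation separates into real and imaginary parts, and each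
    is a case of [du_bois_reymond]. *)
Lemma weak_derivative_ftc u g e x y : is_weak_derivative u g ->
  {within `[0, len e], continuous (u e : R -> R[i]^o)} ->
  0 <= x -> x <= y -> y <= len e ->
  u e y - u e x = complex.Complex (\int[leb]_(t in `]x, y]) complex.Re (g e t))
                    (\int[leb]_(t in `]x, y]) complex.Im (g e t)).
Proof.
move=> ug cu x0 xy yl; have [gr gi] := L2fun_cintegrable g e.
apply: complex_eq; rewrite ?Re_add ?Im_add ?Re_opp ?Im_opp /=.
  apply: (du_bois_reymond (len_gt0 e) (within_continuous_Re cu) gr _ x0 xy yl).
  by move=> phi tphi; rewrite -!Re_Cintegral_real ug// Re_opp.
apply: (du_bois_reymond (len_gt0 e) (within_continuous_Im cu) gi _ x0 xy yl).
by move=> phi tphi; rewrite -!Im_Cintegral_real ug// Im_opp.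
Qed.

Lemma Rintegral_oc_cc l (f : R -> R) : leb.-integrable `[0, l] (EFin \o f) ->
  \int[leb]_(t in `]0, l]) f t = \int[leb]_(t in `[0, l]) f t.
Proof.
move=> fi; apply: Rintegral_itv_obnd_cbnd.
by apply: integrableS fi => //; exact: subset_itv_oc_cc.
Qed.

Lemma weak_derivative_total u g e : is_weak_derivative u g ->
  {within `[0, len e], continuous (u e : R -> R[i]^o)} ->
  u e (len e) - u e 0 = Cintegral (len e) (g e).
Proof.
move=> ug cu; have [gr gi] := L2fun_cintegrable g e.
rewrite (weak_derivative_ftc ug cu)// ?ltW//.
by rewrite !Rintegral_oc_cc.
Qed.

(** Cauchy-Schwarz in the fundamental theorem. All estimates on the metric graph rest on this
    bound. *)
Lemma weak_derivative_osc u g e x y : is_weak_derivative u g ->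
  {within `[0, len e], continuous (u e : R -> R[i]^o)} ->
  0 <= x <= len e -> 0 <= y <= len e ->
  abs2 (u e x - u e y) <= len e * \int[leb]_(t in `[0, len e]) abs2 (g e t).
Proof.
move=> ug cu; wlog xy : x y / x <= y.
  move=> H hx hy; have [xy|/ltW yx] := leP x y; first exact: H.
  by rewrite -opprB /abs2 Re_opp Im_opp !sqrrN; exact: H.
move=> /andP[x0 xl] /andP[y0 yl].
rewrite -opprB /abs2 Re_opp Im_opp !sqrrN -/(abs2 _).
rewrite (weak_derivative_ftc ug cu x0 xy yl).
have [gr gi] := L2fun_cintegrable g e.
have [gr2 gi2] := L2fun_sqintegrable g e.
have sq (f : R -> R) : f \in Lfun (interval_measure (len e)) 2%:E ->
    leb.-integrable `[0, len e] (EFin \o (fun t => f t ^+ 2)).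
  move=> f2; rewrite (_ : _ \o _ = EFin \o (fun t => f t * f t)).
    exact: Lfun2_mul_lebesgue_integrable.
  by apply/funext => t /=; rewrite expr2.
rewrite /abs2 /= RintegralD//; [|exact: sq gr2|exact: sq gi2].
rewrite mulrDr; apply: lerD; apply: sqr_integral_le => //.
  exact: sq gr2.
exact: sq gi2.
Qed.

(** The difference [k] of two weak derivatives of [u] is a weak derivative of 0, so all its
    primitives from 0 vanish. *)
Lemma is_weak_derivative_unique u g h : is_weak_derivative u g -> is_weak_derivative u h ->
  L2class g = L2class h.
Proof.
move=> ug uh; apply/L2class_eqP => e.
have := is_weak_derivative_lin (-1) uh ug; rewrite scaleN1r addNr => w0.
have c0 : {within `[0, len e], continuous ((0 : L2fun M) e : R -> R[i]^o)}.
  by apply: continuous_subspaceT; exact: cst_continuous.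
set k := -1 *: h + g in w0.
have [kr ki] := L2fun_cintegrable k e.
have z x : 0 <= x -> x <= len e ->
   \int[leb]_(t in `[0, x]) complex.Re (k e t) = 0 /\
   \int[leb]_(t in `[0, x]) complex.Im (k e t) = 0.
  move=> x0 xl.
  have := weak_derivative_ftc w0 c0 (lexx 0) x0 xl.
  rewrite (_ : (0 : L2fun M) e x = 0)// (_ : (0 : L2fun M) e 0 = 0)// subr0.
  have s : `[0, x]%classic `<=` `[0, len e]%classic by apply: subset_itvl; rewrite bnd_simp.
  rewrite !Rintegral_oc_cc; [|exact: integrableS ki|exact: integrableS kr].
  by case=> <- <-.
have zr := integral_eq0_ae kr (fun x x0 xl => (z x x0 xl).1).
have zi := integral_eq0_ae ki (fun x x0 xl => (z x x0 xl).2).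
apply: (@filterS2 _ _ (ae_filter_ringOfSetsType _)) zr zi => x hr hi xl.
apply/eqP; rewrite -subr_eq0; apply/eqP.
rewrite -[LHS](_ : k e x = _); last by rewrite /k L2fun_linE mulN1r addrC.
by apply: complex_eq; [exact: hr|exact: hi].
Qed.

(** By uniqueness the representative and the derivative chosen in [dirichlet_form] may be replaced
    by any others. *)
Lemma dirichlet_form_class u v g h : is_weak_derivative u g -> is_weak_derivative v h ->
  dirichlet_form (L2class u) (L2class v) = L2inner (L2class g) (L2class h).
Proof.
move=> ug vh; rewrite L2inner_class; apply: eq_bigr => e _.
have wd (w k : L2fun M) : is_weak_derivative w k ->
    L2class (weak_derivative (L2repr (L2class w))) = L2class k.
  move=> wk; have wk' := is_weak_derivative_congr (esym (L2reprK (L2class w))) wk.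
  exact: (is_weak_derivative_unique (weak_derivativeP wk') wk').
have /L2class_eqP/(_ e) hu := wd _ _ ug.
have /L2class_eqP/(_ e) hv := wd _ _ vh.
apply: ae_eq_Cintegral; try exact: L2fun_cintegrable_mul.
apply: (@filterS2 _ _ (ae_filter_ringOfSetsType _)) hu hv => x hu' hv' xl.
by rewrite hu'// hv'.
Qed.

Lemma dirichlet_form_ge0 (U : L2 M) : 0 <= complex.Re (dirichlet_form U U).
Proof.
rewrite /dirichlet_form Re_sum; apply: sumr_ge0 => e _.
by rewrite Re_Cintegral_conj; apply: Rintegral_ge0 => x _; exact: abs2_ge0.
Qed.

Lemma continuous_on_graph_lin (a : R[i]) u v : continuous_on_graph u ->
  continuous_on_graph v -> continuous_on_graph (a *: u + v : L2fun M).
Proof.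
move=> [cu [b bu]] [cv [c cv']]; split.
  move=> e; apply: within_continuous_complex.
    rewrite (_ : (fun x => _) = (fun x => complex.Re a * complex.Re (u e x)
      - complex.Im a * complex.Im (u e x) + complex.Re (v e x))); last first.
      by apply/funext => x; rewrite L2fun_linE Re_add Re_mul.
    apply/subspace_continuousP => x xl.
    apply: cvgD; last by move: x xl; apply/subspace_continuousP/within_continuous_Re/cv.
    apply: cvgB; apply: cvgM; try exact: cvg_cst.
      by move: x xl; apply/subspace_continuousP/within_continuous_Re/cu.
    by move: x xl; apply/subspace_continuousP/within_continuous_Im/cu.
  rewrite (_ : (fun x => _) = (fun x => complex.Re a * complex.Im (u e x)
      + complex.Im a * complex.Re (u e x) + complex.Im (v e x))); last first.
    by apply/funext => x; rewrite L2fun_linE Im_add Im_mul.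
  apply/subspace_continuousP => x xl.
  apply: cvgD; last by move: x xl; apply/subspace_continuousP/within_continuous_Im/cv.
  apply: cvgD; apply: cvgM; try exact: cvg_cst.
    by move: x xl; apply/subspace_continuousP/within_continuous_Im/cu.
  by move: x xl; apply/subspace_continuousP/within_continuous_Re/cu.
exists (fun p => a * b p + c p) => e.
by rewrite !L2fun_linE (bu e).1 (bu e).2 (cv' e).1 (cv' e).2.
Qed.

(** The difference [w] vanishes almost everywhere, so it has weak derivative 0 and no oscillation;
    being zero at one point of the edge, it is zero on the edge. This makes evaluation at a vertex
    meaningful for classes. *)
Lemma continuous_on_graph_unique u v e x : L2class u = L2class v ->
  continuous_on_graph u -> continuous_on_graph v -> 0 <= x <= len e ->
  u e x = v e x.
Proof.
move=> uv cu cv xl.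
have cw := (continuous_on_graph_lin (-1) cv cu).1 e.
set w := -1 *: v + u in cw.
have w0 : is_weak_derivative w 0.
  apply: (@is_weak_derivative_congr 0) => [|e' phi tphi].
    by rewrite /w L2class_lin uv scaleN1r addNr L2class0.
  rewrite -[RHS]mulN1r -CintegralZ; last first.
    by apply: cintegrable_mul_real;
      [exact: L2fun_cintegrable|have [] := test_function_continuous tphi].
  apply: eq_Cintegral => z _ _; rewrite (_ : (0 : L2fun M) e' z = 0)//.
  by rewrite !mul0r mulr0.
have wE : {ae leb, forall x, `[0, len e]%classic x -> w e x = 0}.
  have /L2class_eqP/(_ e) := uv.
  apply: (@filterS _ _ (ae_filter_ringOfSetsType _)) => z h zl.
  by rewrite /w L2fun_linE h// mulN1r addNr.
(* Without a zero, the null exceptional set would contain an interval of positive length. *)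
have [z zl wz] : exists2 z, 0 <= z <= len e & w e z = 0.
  apply: contrapT => nz; case: wE => N [mN N0 sub].
  have : (leb `[0%R, len e]%classic <= leb N)%E.
    apply: le_measure; rewrite ?inE//.
    move=> z zl; apply: sub => /= wz; apply: nz; exists z; last exact: wz.
    by move: zl; rewrite /= in_itv.
  by rewrite N0 lebesgue_measure_itv/= lte_fin len_gt0 sube0 lee_fin leNgt len_gt0.
have := weak_derivative_osc w0 cw xl zl.
rewrite (_ : \int[leb]_(t in `[0, len e]) _ = 0); last first.
  rewrite (_ : (fun t => _) = cst 0); last by apply/funext => t; rewrite /abs2 expr0n addr0.
  by rewrite Rintegral_cst// mul0r.
rewrite mulr0 wz subr0 => w2.
have : w e x = 0.
  have := abs2_ge0 (w e x); rewrite /abs2 in w2 * => w3.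
  have := sqr_ge0 (complex.Re (w e x)); have := sqr_ge0 (complex.Im (w e x)) => i0 r0.
  by apply: complex_eq => /=; apply/eqP; rewrite -sqrf_eq0 eq_le ?r0 ?i0 andbT; lra.
by rewrite /w L2fun_linE mulN1r addrC => /eqP; rewrite subr_eq0 => /eqP.
Qed.

End GraphL2.

(** * Piecewise affine functions on weighted metric graphs *)

Lemma ffun_linE (R : realType) (V : finType) (a : R[i]) (f g : {ffun V -> R[i]}) v :
  (a *: f + g) v = a * f v + g v.
Proof. by rewrite !ffunE. Qed.

Lemma ffun_scaleE (R : realType) (V : finType) (a : R[i]) (f : {ffun V -> R[i]}) v :
  (a *: f) v = a * f v.
Proof. by rewrite !ffunE. Qed.

Lemma Re_real_mul (R : realType) (a : R) (z : R[i]) :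
  complex.Re (a%:C%C * z) = a * complex.Re z.
Proof. by rewrite Re_mul /= mul0r subr0. Qed.

Lemma Re_mul_real (R : realType) (a : R) (z : R[i]) :
  complex.Re (z * a%:C%C) = complex.Re z * a.
Proof. by rewrite mulrC Re_real_mul mulrC. Qed.

Lemma Im_mul_real (R : realType) (a : R) (z : R[i]) :
  complex.Im (z * a%:C%C) = complex.Im z * a.
Proof. by rewrite Im_mul /= mulr0 add0r. Qed.

Section WeightedDifferences.
Context {R : realType} {V E : finType} (s t : E -> V) (c : E -> R).

Definition gdiff (f : {ffun V -> R[i]}) (e : E) : R[i] := f (s e) - f (t e).

(** Used with two weights: the conductances, giving the discrete energy, and multiples of the edge
    lengths, giving the defect Q of the trapezoidal rule. *)
Definition diff_form (f g : {ffun V -> R[i]}) : R[i] :=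
  \sum_e (c e)%:C%C * (gdiff f e * conjc (gdiff g e)).

Lemma gdiff_lin (a : R[i]) f g e : gdiff (a *: f + g) e = a * gdiff f e + gdiff g e.
Proof. by rewrite /gdiff !ffun_linE; ring. Qed.

Lemma sqnorm_diff_form f :
  complex.Re (diff_form f f) = \sum_e c e * abs2 (gdiff f e).
Proof.
by rewrite Re_sum; apply: eq_bigr => e _; rewrite Re_real_mul Re_mul_conj.
Qed.

Lemma diff_form_sip : (forall e, 0 <= c e) -> semi_inner_product diff_form.
Proof.
move=> c0; split.
- move=> a f g h; rewrite mulr_sumr -big_split; apply: eq_bigr => e _ /=.
  by rewrite gdiff_lin; ring.
- move=> f g; rewrite conjc_sum; apply: eq_bigr => e _.
  by rewrite !conjcM conjcK conjc_real [conjc _ * _]mulrC.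
- move=> f; rewrite sqnorm_diff_form; apply: sumr_ge0 => e _.
  by rewrite mulr_ge0// abs2_ge0.
Qed.

End WeightedDifferences.

Section WeightedL2.
Context {R : realType} {V : finType} (mu : V -> R).

Definition vertex_inner (f g : {ffun V -> R[i]}) : R[i] :=
  \sum_v f v * conjc (g v) * (mu v)%:C%C.

Lemma vertex_inner_sip : (forall v, 0 <= mu v) -> semi_inner_product vertex_inner.
Proof.
move=> m0; split.
- move=> a f g h; rewrite mulr_sumr -big_split; apply: eq_bigr => v _ /=.
  by rewrite ffun_linE; ring.
- move=> f g; rewrite conjc_sum; apply: eq_bigr => v _.
  by rewrite !conjcM conjcK conjc_real [conjc _ * g v]mulrC.
- move=> f; rewrite Re_sum; apply: sumr_ge0 => v _.
  by rewrite mulrC Re_real_mul Re_mul_conj mulr_ge0// abs2_ge0.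
Qed.

End WeightedL2.

Section HatFunctions.
Context {R : realType} (M : metric_graph R) {V : finType}.
Notation leb := (@lebesgue_measure R).
Local Notation E := (mg_edge M).
Local Notation len := (@mg_len R M).
(** The vertex type of the metric graph need not be finite: for the fractal graphs it is the whole
    ambient space. [pos] places the finite vertex set in it, and [ext] extends vertex functions
    along [pos]. *)
Variables (s t : E -> V) (pos : V -> mg_vertex M).
Variable ext : {ffun V -> R[i]} -> mg_vertex M -> R[i].
Hypothesis srcE : forall e, mg_src e = pos (s e).
Hypothesis tgtE : forall e, mg_tgt e = pos (t e).
Hypothesis extE : forall f v, ext f (pos v) = f v.
Hypothesis len_gt0 : forall e, 0 < len e.
Implicit Types (f g : {ffun V -> R[i]}) (e : E).

Definition hat_fun f (e : E) (x : R) : R[i] :=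
  f (s e) + (f (t e) - f (s e)) * (x / len e)%:C%C.

Lemma hat_fun_Re f e x : complex.Re (hat_fun f e x) =
  complex.Re (f (s e)) + complex.Re (f (t e) - f (s e)) / len e * x.
Proof. by rewrite /hat_fun (Re_add (f (s e))) Re_mul_real; ring. Qed.

Lemma hat_fun_Im f e x : complex.Im (hat_fun f e x) =
  complex.Im (f (s e)) + complex.Im (f (t e) - f (s e)) / len e * x.
Proof. by rewrite /hat_fun (Im_add (f (s e))) Im_mul_real; ring. Qed.

Lemma continuous_affine (a b : R) : continuous (fun x : R => a + b * x).
Proof.
by move=> x; apply: cvgD; [exact: cvg_cst|apply: cvgM; [exact: cvg_cst|exact: cvg_id]].
Qed.

Lemma hat_continuous_Re f e : continuous (fun x => complex.Re (hat_fun f e x)).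
Proof. by under eq_fun do rewrite hat_fun_Re; exact: continuous_affine. Qed.

Lemma hat_continuous_Im f e : continuous (fun x => complex.Im (hat_fun f e x)).
Proof. by under eq_fun do rewrite hat_fun_Im; exact: continuous_affine. Qed.

Lemma hat_L2pred f : (hat_fun f : E -> R -> R[i]) \in @L2pred R M.
Proof.
apply/asboolP => e; apply: continuous_sqintegrable.
  exact: hat_continuous_Re.
exact: hat_continuous_Im.
Qed.

Definition hat f : L2fun M := L2Fun (hat_L2pred f).

Lemma L2fun_eq (u v : L2fun M) : (forall e x, u e x = v e x) -> u = v.
Proof. by move=> uv; apply: val_inj; apply/funext => e; apply/funext => x; exact: uv. Qed.

Lemma hat_lin (a : R[i]) f g : hat (a *: f + g) = a *: hat f + hat g.
Proof.
apply: L2fun_eq => e x; rewrite L2fun_linE /= /hat_fun !ffun_linE; ring.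
Qed.

Lemma hat_continuous_on_graph f : continuous_on_graph (hat f).
Proof.
split => [e|].
  apply: within_continuous_complex; apply: continuous_subspaceT.
    exact: hat_continuous_Re.
  exact: hat_continuous_Im.
exists (ext f) => e; rewrite srcE tgtE !extE /= /hat_fun mul0r mulr0 addr0; split => //.
by rewrite divff ?gt_eqF// mulr1 addrC subrK.
Qed.

Definition hat_slope_fun f (e : E) (x : R) : R[i] :=
  (f (t e) - f (s e)) * (len e)^-1%:C%C.

Lemma hat_slope_L2pred f : (hat_slope_fun f : E -> R -> R[i]) \in @L2pred R M.
Proof. by apply/asboolP => e; apply: continuous_sqintegrable; exact: cst_continuous. Qed.

Definition hat_slope f : L2fun M := L2Fun (hat_slope_L2pred f).

Lemma hat_weak_derivative f : is_weak_derivative (hat f) (hat_slope f).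
Proof.
move=> e phi tphi; apply: complex_eq.
  rewrite Re_opp !Re_Cintegral_real.
  under eq_Rintegral do rewrite /= hat_fun_Re.
  rewrite integral_affine_by_parts//; congr (- _); apply: eq_Rintegral => x _.
  by rewrite /= /hat_slope_fun Re_mul_real.
rewrite Im_opp !Im_Cintegral_real.
under eq_Rintegral do rewrite /= hat_fun_Im.
rewrite integral_affine_by_parts//; congr (- _); apply: eq_Rintegral => x _.
by rewrite /= /hat_slope_fun Im_mul_real.
Qed.

Lemma Cintegral_quadratic l (a b c : R[i]) : 0 < l ->
  Cintegral l (fun x => a + b * (x / l)%:C%C + c * ((x / l) ^+ 2)%:C%C) =
  l%:C%C * (a + b / 2 + c / 3).
Proof.
move=> l0.
have e2 : (2 : R[i])^-1 = (2^-1 : R)%:C%C by rewrite fmorphV rmorph_nat.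
have e3 : (3 : R[i])^-1 = (3^-1 : R)%:C%C by rewrite fmorphV rmorph_nat.
apply: complex_eq.
  rewrite Re_real_mul !Re_add e2 e3 ![_ * _%:C%C]mulrC !Re_real_mul.
  rewrite ![_^-1 * complex.Re _]mulrC -integral_quadratic//.
  by apply: eq_Rintegral => x _; rewrite !Re_add ![_ * _%:C%C]mulrC !Re_real_mul; ring.
rewrite Im_mul /= mul0r addr0 !Im_add e2 e3 !Im_mul /= !mulr0 !add0r.
rewrite -integral_quadratic//.
by apply: eq_Rintegral => x _; rewrite !Im_add !Im_mul /= !mulr0 !add0r.
Qed.

(* On an edge with end values f0, f1 and g0, g1 the trapezoidal rule
   l/2 (f0 g0 + f1 g1) exceeds the exact integral by l/6 (f0 - f1) (g0 - g1). *)
Lemma Cintegral_hat f g e :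
  Cintegral (len e) (fun x => hat f e x * conjc (hat g e x)) =
  (len e / 2)%:C%C * (f (s e) * conjc (g (s e)) + f (t e) * conjc (g (t e))) -
  (len e / 6)%:C%C * (gdiff s t f e * conjc (gdiff s t g e)).
Proof.
set a := f (s e) * conjc (g (s e)).
set b := f (s e) * conjc (g (t e) - g (s e)) + (f (t e) - f (s e)) * conjc (g (s e)).
set c := (f (t e) - f (s e)) * conjc (g (t e) - g (s e)).
rewrite (@eq_Cintegral _ _ _
  (fun x => a + b * (x / len e)%:C%C + c * ((x / len e) ^+ 2)%:C%C)).
  rewrite Cintegral_quadratic//.
  have -> : (len e / 2)%:C%C = (len e)%:C%C / 2 by rewrite rmorphM fmorphV rmorph_nat.
  have -> : (len e / 6)%:C%C = (len e)%:C%C / 6 by rewrite rmorphM fmorphV rmorph_nat.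
  by rewrite /a /b /c /gdiff !(rmorphB conjc); field.
move=> x _ _; rewrite /= /hat_fun conjcD conjcM conjc_real /a /b /c.
have -> : ((x / len e) ^+ 2)%:C%C = (x / len e)%:C%C * (x / len e)%:C%C.
  by rewrite expr2 (rmorphM (real_complex R)).
ring.
Qed.


(** The slope is constant on an edge, so only the total integral of the other factor enters; for a
    weak derivative this is a difference of end values. Hence the forms can match exactly. *)
Lemma Cintegral_hat_slope f (g : L2fun M) e :
  Cintegral (len e) (fun x => hat_slope f e x * conjc (g e x)) =
  - ((len e)^-1%:C%C * gdiff s t f e) * conjc (Cintegral (len e) (g e)).
Proof.
have gi := L2fun_cintegrable g e.
rewrite -Cintegral_conj// -CintegralZ; last first.
  split.
    rewrite (_ : _ \o _ = EFin \o (fun x => complex.Re (g e x))); first exact: gi.1.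
    by apply/funext => x /=; rewrite Re_conj.
  rewrite (_ : _ \o _ = EFin \o (fun x => -1 * complex.Im (g e x))).
    by apply: integrable_cmul gi.2.
  by apply/funext => x /=; rewrite Im_conj mulN1r.
apply: eq_Cintegral => x _ _; rewrite /= /hat_slope_fun /gdiff; ring.
Qed.

(** On the edge the affine function is a convex combination of the end values of [u], so by
    convexity of the squared modulus the oscillation bound holds pointwise. *)
Lemma hat_interpolation_error f (u : L2fun M) e K : u e 0 = f (s e) -> u e (len e) = f (t e) ->
  (forall x y, 0 <= x <= len e -> 0 <= y <= len e -> abs2 (u e x - u e y) <= K) ->
  \int[leb]_(x in `[0, len e]) abs2 ((u - hat f : L2fun M) e x) <= len e * K.
Proof.
move=> u0 u1 osc; have l0 := len_gt0 e.
have -> : len e * K = \int[leb]_(x in `[0, len e]) cst K x.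
  rewrite Rintegral_cst// mulrC; congr (_ * _).
  by have := @lebesgue_measure_itv R `[0, len e]%R; rewrite /= lte_fin l0 sube0 => ->.
apply: le_Rintegral => //.
- exact/sqintegrable_abs2/L2fun_sqintegrable.
- by apply: continuous_integrable; exact: cst_continuous.
move=> x; rewrite /= in_itv /= => xl.
have x0 := osc x 0 xl; have x1 := osc x (len e) xl.
rewrite !lexx (ltW l0) in x0 x1; move: (x0 isT) (x1 isT).
rewrite [X in _ -> _ -> abs2 X <= _](_ : _ = u e x - hat_fun f e x)//.
rewrite /abs2 !(Re_add (u e x)) !(Im_add (u e x)) !Re_opp !Im_opp hat_fun_Re hat_fun_Im.
rewrite u0 u1 !(Re_add (f (t e))) !(Im_add (f (t e))) Re_opp Im_opp.
have : 0 <= x / len e <= 1.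
  by case/andP: xl => xl0 xl1; rewrite divr_ge0// ?(ltW l0)//= ler_pdivrMr// mul1r.
have -> p q : (p - q) / len e * x = (p - q) * (x / len e) by ring.
have -> p q : (p - q) / len e * x = (p - q) * (x / len e) by ring.
move: (x / len e) => z /andP[z0 z1].
move: (complex.Re (u e x)) (complex.Im (u e x)) (complex.Re (f (s e)))
  (complex.Im (f (s e))) (complex.Re (f (t e))) (complex.Im (f (t e))) => a a' b b' c c'.
move=> h0 h1.
have z1' : 0 <= 1 - z by lra.
(* The convexity gap is exactly z (1 - z) times the squared difference of the end values. *)
have := mulr_ge0 (mulr_ge0 z0 z1') (sqr_ge0 (b - c)).
have := mulr_ge0 (mulr_ge0 z0 z1') (sqr_ge0 (b' - c')).
have := ler_wpM2l z1' h0; have := ler_wpM2l z0 h1; nra.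
Qed.

End HatFunctions.

(** * Quasi-unitary equivalence for a weighted graph with matching lengths *)

Section WeightedMetricGraph.
Context {R : realType} (M : metric_graph R) {V : finType}.
Notation leb := (@lebesgue_measure R).
Local Notation E := (mg_edge M).
Local Notation len := (@mg_len R M).
Variables (s t : E -> V) (pos : V -> mg_vertex M).
Variable ext : {ffun V -> R[i]} -> mg_vertex M -> R[i].
Hypothesis srcE : forall e, mg_src e = pos (s e).
Hypothesis tgtE : forall e, mg_tgt e = pos (t e).
Hypothesis extE : forall f v, ext f (pos v) = f v.
Hypothesis len_gt0 : forall e, 0 < len e.
Variables (mu : V -> R) (gamma : E -> R) (c tau eps : R).
Hypothesis mu_gt0 : forall v, 0 < mu v.
Hypothesis gamma_ge0 : forall e, 0 <= gamma e.
Hypothesis c_gt0 : 0 < c.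
Hypothesis tau_ge0 : 0 <= tau.
Hypothesis eps_ge0 : 0 <= eps.
Hypothesis mu_len : forall v, c ^+ 2 * mu v =
  \sum_e ((s e == v)%:R + (t e == v)%:R) * (len e / 2).
Hypothesis tau_len : forall e, tau = c ^+ 2 * gamma e * len e.
Hypothesis len_small : forall e, len e ^+ 2 <= eps ^+ 2 * tau.
Implicit Types (f g : {ffun V -> R[i]}) (e : E) (U : L2 M).

Definition vertex_form_space : form_space R :=
  @FormSpace R {ffun V -> R[i]} (vertex_inner mu) setT (diff_form s t gamma).

Local Notation A := vertex_form_space.
Local Notation B := (metric_form_space M tau).
Local Notation hat := (hat s t).

Let c_neq0 : c != 0. Proof. by rewrite gt_eqF. Qed.

Let HA : semi_inner_product (vertex_inner mu).
Proof. by apply: vertex_inner_sip => v; exact: ltW. Qed.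

Let HB : semi_inner_product (@L2inner R M) := L2_semi_inner_product M.

Definition interpolation f : L2 M := L2class (c^-1%:C%C *: hat f).

Lemma interpolation_linear : GRing.linear_for *:%R interpolation.
Proof.
move=> a f g; rewrite /interpolation hat_lin scalerDr scalerA mulrC -scalerA.
by rewrite L2class_lin.
Qed.

HB.instance Definition _ :=
  GRing.isLinear.Build R[i] {ffun V -> R[i]} (L2 M) _ interpolation interpolation_linear.

Definition vertex_delta (v : V) : {ffun V -> R[i]} := [ffun w => (w == v)%:R].

(** The formula forced by adjointness when tested on [vertex_delta v]. *)
Definition average U : {ffun V -> R[i]} :=
  [ffun v => (mu v)^-1%:C%C * L2inner U (interpolation (vertex_delta v))].

Lemma average_linear : GRing.linear_for *:%R average.
Proof.
move=> a U W; apply/ffunP => v; rewrite ffun_linE !ffunE (sip_linear HB); ring.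
Qed.

HB.instance Definition _ :=
  GRing.isLinear.Build R[i] (L2 M) {ffun V -> R[i]} _ average average_linear.

Lemma ffun_delta f : f = \sum_v f v *: vertex_delta v.
Proof.
apply/ffunP => w; rewrite sum_ffunE (bigD1 w)//= big1 ?addr0 => [|v vw].
  by rewrite !ffunE eqxx [_ *: _]mulr1.
by rewrite !ffunE eq_sym (negbTE vw) [_ *: _]mulr0.
Qed.

Lemma interpolation_average f U :
  L2inner (interpolation f) U = vertex_inner mu f (average U).
Proof.
rewrite {1}(ffun_delta f) linear_sum (sip_sum HB); apply: eq_bigr => v _.
rewrite linearZ (sipZ HB) ffunE conjcM conjc_real -(sip_conj HB U).
rewrite -mulrA; congr (_ * _).
by rewrite mulrC mulrA -rmorphM divff ?gt_eqF// mul1r.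
Qed.

Local Notation Q := (diff_form s t (fun e => c ^- 2 * (len e / 6))).

Let Q_ge0 e : 0 <= c ^- 2 * (len e / 6).
Proof. by rewrite mulr_ge0 ?invr_ge0 ?sqr_ge0 ?divr_ge0// ltW. Qed.

Lemma interpolation_inner f g :
  L2inner (interpolation f) (interpolation g) = vertex_inner mu f g - Q f g.
Proof.
have L2cZ (w : L2fun M) a : L2class (a *: w) = a *: L2class w by rewrite -L2scale_class.
rewrite /interpolation !L2cZ (sipZ HB) (sipZr HB) L2inner_class conjc_real mulrA.
under eq_bigr do rewrite Cintegral_hat//.
rewrite sumrB mulrBr; congr (_ - _); last first.
  rewrite mulr_sumr; apply: eq_bigr => e _; rewrite !mulrA -!rmorphM; congr (_ * _ * _).
  by congr (real_complex R _); rewrite -invfM -expr2 mulrA.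
rewrite /vertex_inner.
(* Writing [mu v] through [mu_len] turns the vertex sum into the trapezoidal sum over the edges. *)
have -> : \sum_v f v * conjc (g v) * (mu v)%:C%C =
    \sum_v \sum_e (c ^- 2)%:C%C * ((len e / 2)%:C%C *
      ((s e == v)%:R * (f v * conjc (g v)) + (t e == v)%:R * (f v * conjc (g v)))).
  apply: eq_bigr => v _.
  have -> : mu v = c ^- 2 * \sum_e ((s e == v)%:R + (t e == v)%:R) * (len e / 2).
    by rewrite -mu_len mulKf// expf_neq0.
  rewrite rmorphM rmorph_sum mulrCA mulr_sumr mulr_sumr; apply: eq_bigr => e _.
  by rewrite rmorphM rmorphD !rmorph_nat; ring.
rewrite exchange_big mulr_sumr; apply: eq_bigr => e _.
rewrite -mulr_sumr -mulr_sumr big_split /=.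
rewrite -rmorphM -invfM -expr2; congr (_ * (_ * (_ + _))).
  rewrite (bigD1 (s e))//= eqxx mul1r big1 ?addr0// => v vs.
  by rewrite eq_sym (negbTE vs) mul0r.
rewrite (bigD1 (t e))//= eqxx mul1r big1 ?addr0// => v vs.
by rewrite eq_sym (negbTE vs) mul0r.
Qed.

Let HQ : semi_inner_product Q.
Proof. exact: diff_form_sip. Qed.

Lemma interpolation_contr f :
  sqnorm (@L2inner R M) (interpolation f) <= sqnorm (vertex_inner mu) f.
Proof.
by rewrite /sqnorm interpolation_inner Re_add Re_opp gerDl oppr_le0 (sip_ge0 HQ).
Qed.

Lemma average_interpolation_error f :
  sqnorm (vertex_inner mu) (f - average (interpolation f)) <=
  eps ^+ 2 * complex.Re (diff_form s t gamma f f).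
Proof.
set h := f - _.
have hE g : vertex_inner mu h g = Q f g.
  rewrite /h (sipD HA) (sipN HA) (sip_conj HA g (average _)) -interpolation_average.
  by rewrite -(sip_conj HB) interpolation_inner opprB addrC subrK.
(* Here |h|^2 = Q(f, h), and Q(h, h) <= |h|^2 because |Jh|^2 = |h|^2 - Q(h, h) is nonnegative. So 2
   |h|^2 <= Q(f, f) + Q(h, h) <= Q(f, f) + |h|^2. *)
have qh : sqnorm (vertex_inner mu) h <= complex.Re (Q f f).
  have := sqnormB_ge0 HQ f h; have := interpolation_contr h.
  rewrite {1}/sqnorm interpolation_inner Re_add Re_opp.
  have := sip_ge0 HB (interpolation h); rewrite interpolation_inner Re_add Re_opp.
  rewrite /sqnorm -!hE; lra.
apply: le_trans qh _; rewrite !sqnorm_diff_form mulr_sumr; apply: ler_sum => e _.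
rewrite mulrA ler_wpM2r ?abs2_ge0//.
(* Multiplied by c^2 len, the claim c^-2 len / 6 <= eps^2 gamma becomes len^2 / 6 <= eps^2 tau. *)
have := len_small e; rewrite (tau_len e) => h1.
rewrite mulrC ler_pdivrMr ?exprn_gt0//.
have l0 := len_gt0 e; rewrite -(ler_pM2l l0).
apply: (@le_trans _ _ (len e ^+ 2)); first by rewrite expr2 ler_pM2l//; lra.
by apply: le_trans h1 _; rewrite le_eqVlt; apply/orP; left; apply/eqP; ring.
Qed.

(** A class has no point values, so the value is read off a continuous representative; the default 0
    is taken if there is none. *)
Definition vertex_values U : {ffun V -> R[i]} := [ffun v => c%:C%C * xget 0
  [set z | exists (u : L2fun M) (a : mg_vertex M -> R[i]),
    [/\ U = L2class u, continuous_on_graph u,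
        forall e, u e 0 = a (mg_src e) /\ u e (len e) = a (mg_tgt e) & z = a (pos v)]]].

(** A vertex of positive weight has an edge, since otherwise the sum in [mu_len] is 0. At an
    isolated vertex the function [a] of vertex values would be arbitrary. *)
Lemma incident_edge v : exists e, s e = v \/ t e = v.
Proof.
apply: contrapT => H; have := mu_len v.
rewrite big1 => [/eqP|e _].
  by rewrite mulf_eq0 expf_eq0/= (negbTE c_neq0)/= gt_eqF.
have [/eqP se|_] := boolP (s e == v); first by case: H; exists e; left.
have [/eqP se|_] := boolP (t e == v); first by case: H; exists e; right.
by rewrite addr0 mul0r.
Qed.

Lemma vertex_valuesE (u : L2fun M) (a : mg_vertex M -> R[i]) v : continuous_on_graph u ->
  (forall e, u e 0 = a (mg_src e) /\ u e (len e) = a (mg_tgt e)) ->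
  vertex_values (L2class u) v = c%:C%C * a (pos v).
Proof.
move=> cu ua; rewrite ffunE; congr (_ * _).
case: xgetP => [z _ [u' [a' [uu' cu' ua' ->]]]|H].
  have uniq e x := @continuous_on_graph_unique _ _ len_gt0 u u' e x uu' cu cu'.
  have [e [<-|<-]] := incident_edge v.
    by rewrite -srcE -(ua e).1 -(ua' e).1 uniq// lexx ltW.
  by rewrite -tgtE -(ua e).2 -(ua' e).2 uniq// lexx ltW.
by case: (H (a (pos v))); exists u, a.
Qed.

Let dom_rep U : dirichlet_dom U -> exists (u : L2fun M) (a : mg_vertex M -> R[i]) (g : L2fun M),
  [/\ U = L2class u, continuous_on_graph u,
    forall e, u e 0 = a (mg_src e) /\ u e (len e) = a (mg_tgt e) & is_weak_derivative u g].
Proof. by case=> u [-> cu [g ug]]; case: (cu) => _ [a ua]; exists u, a, g. Qed.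

Lemma vertex_values_linear (b : R[i]) U W : dirichlet_dom U -> dirichlet_dom W ->
  vertex_values (b *: U + W) = b *: vertex_values U + vertex_values W.
Proof.
move=> /dom_rep[u [a [_ [-> cu ua _]]]] /dom_rep[w [d [_ [-> cw wd _]]]].
rewrite -L2class_lin; apply/ffunP => v; rewrite ffun_linE.
rewrite (vertex_valuesE v cu ua) (vertex_valuesE v cw wd).
rewrite (@vertex_valuesE _ (fun p => b * a p + d p)); first ring.
  exact: continuous_on_graph_lin.
by move=> e; rewrite !L2fun_linE (ua e).1 (ua e).2 (wd e).1 (wd e).2.
Qed.

Let hatc f : c^-1%:C%C *: hat f = hat (c^-1%:C%C *: f).
Proof. by have := hat_lin s t c^-1%:C%C f 0; rewrite addr0 => ->; rewrite (_ : hat 0 = 0) ?addr0//;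
  apply: L2fun_eq => e x; rewrite /= /hat_fun !ffunE subrr mul0r addr0. Qed.

Lemma vertex_values_interpolation f : vertex_values (interpolation f) = f.
Proof.
apply/ffunP => v; rewrite /interpolation hatc.
have cg := hat_continuous_on_graph srcE tgtE extE len_gt0 (c^-1%:C%C *: f).
rewrite (@vertex_valuesE _ (ext (c^-1%:C%C *: f)))//.
  by rewrite extE ffun_scaleE mulrA -rmorphM divff// mul1r.
move=> e; rewrite srcE tgtE !extE /= /hat_fun mul0r mulr0 addr0; split => //.
by rewrite divff ?gt_eqF// mulr1 addrC subrK.
Qed.

Lemma interpolation_dom f : dirichlet_dom (interpolation f).
Proof.
exists (c^-1%:C%C *: hat f); rewrite hatc; split => //.
- by rewrite /interpolation hatc.
- exact: (hat_continuous_on_graph srcE tgtE extE len_gt0).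
- by exists (hat_slope s t (c^-1%:C%C *: f)); exact: hat_weak_derivative.
Qed.

(** On each edge the derivative of the second argument integrates to the difference of its end
    values, and tau / (c len) = c gamma by [tau_len]. *)
Lemma interpolation_form f U : dirichlet_dom U ->
  tau%:C%C * dirichlet_form (interpolation f) U =
  diff_form s t gamma f (vertex_values U).
Proof.
move=> /dom_rep[u [a [g [-> cu ua ug]]]].
rewrite /interpolation hatc.
rewrite (dirichlet_form_class len_gt0 (hat_weak_derivative s t len_gt0 _) ug) L2inner_class.
rewrite mulr_sumr; apply: eq_bigr => e _.
rewrite Cintegral_hat_slope// -(weak_derivative_total len_gt0 ug (cu.1 e)).
rewrite (ua e).1 (ua e).2 srcE tgtE /gdiff !(vertex_valuesE _ cu ua).
rewrite !ffun_scaleE -!mulrBr conjcM conjc_real (tau_len e) !rmorphM !fmorphV !rmorphB /=.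
have cc : c%:C%C != 0 by rewrite fmorph_eq0.
have ll : (len e)%:C%C != 0 by rewrite fmorph_eq0 gt_eqF.
move: cc ll; set C := c%:C%C; set L := (len e)%:C%C => cc ll.
by field; rewrite cc ll.
Qed.

(** Edge by edge, the oscillation bound between the two end points multiplied by c^2 gamma. *)
Lemma vertex_values_energy U : dirichlet_dom U ->
  complex.Re (diff_form s t gamma (vertex_values U) (vertex_values U)) <=
  complex.Re (tau%:C%C * dirichlet_form U U).
Proof.
move=> /dom_rep[u [a [g [-> cu ua ug]]]].
rewrite sqnorm_diff_form Re_real_mul (dirichlet_form_class len_gt0 ug ug).
rewrite -/(sqnorm _ _) L2sqnorm_class mulr_sumr; apply: ler_sum => e _.
rewrite /gdiff !(vertex_valuesE _ cu ua) -mulrBr abs2M abs2_real -srcE -tgtE.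
rewrite -(ua e).1 -(ua e).2 mulrA (tau_len e) -[leRHS]mulrA.
have cg : 0 <= c ^+ 2 * gamma e by rewrite mulr_ge0// sqr_ge0.
rewrite [gamma e * _]mulrC ler_wpM2l//.
by apply: (weak_derivative_osc len_gt0 ug (cu.1 e)); rewrite ?lexx ltW/=.
Qed.

Lemma vertex_values_error U : dirichlet_dom U ->
  sqnorm (@L2inner R M) (U - interpolation (vertex_values U)) <=
  eps ^+ 2 * complex.Re (tau%:C%C * dirichlet_form U U).
Proof.
move=> /dom_rep[u [a [g [-> cu ua ug]]]].
rewrite Re_real_mul (dirichlet_form_class len_gt0 ug ug) -/(sqnorm _ _).
(* The factors [c] and its inverse cancel, so the plain affine interpolation of [u] is compared with
   [u]. *)
set w := c^-1%:C%C *: vertex_values (L2class u).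
have wE v : w v = a (pos v).
  by rewrite /w ffun_scaleE (vertex_valuesE _ cu ua) mulrA -rmorphM mulVf// mul1r.
have -> : L2class u - interpolation (vertex_values (L2class u)) = L2class (u - hat w).
  by rewrite /interpolation hatc -/w [u - _]addrC -[- hat w]scaleN1r L2class_lin scaleN1r addrC.
rewrite !L2sqnorm_class mulrA mulr_sumr; apply: ler_sum => e _.
have := @hat_interpolation_error _ M V s t len_gt0 w u e
  (len e * \int[leb]_(x in `[0, len e]) abs2 (g e x)).
rewrite !wE -srcE -tgtE => /(_ (ua e).1 (ua e).2) H.
apply: (le_trans (H _)) => [x y xl yl|].
  exact: (weak_derivative_osc len_gt0 ug (cu.1 e)).
rewrite mulrA -expr2 ler_wpM2r ?len_small//.
by apply: Rintegral_ge0 => x _; exact: abs2_ge0.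
Qed.

Theorem weighted_metric_graph_equivalence : quasi_unitary_equivalent (4 * eps) A B.
Proof.
apply: (@quasi_unitary_criterion _ A B HA HB interpolation average vertex_values eps) => //.
- exact: interpolation_dom.
- exact: interpolation_average.
- exact: interpolation_contr.
- exact: vertex_values_linear.
- exact: vertex_values_interpolation.
- exact: interpolation_form.
- by move=> f; apply: (sip_ge0 (diff_form_sip s t gamma_ge0)).
- by move=> U; rewrite Re_real_mul mulr_ge0// dirichlet_form_ge0.
- exact: vertex_values_energy.
- exact: average_interpolation_error.
- exact: vertex_values_error.
Qed.

End WeightedMetricGraph.

(** * Geometry of the fractal *)

Section EuclideanNorm.
Context {R : realType} {d : nat}.
Implicit Types x y : 'rV[R]_d.

Lemma coord_le_norm x i : `|x ord0 i| <= `|x|.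
Proof.
by rewrite [leRHS]/Num.Def.normr /= mx_normrE; apply/bigmax_geP; right; exists (ord0, i).
Qed.

Lemma norm_le_euclidean x : `|x| <= euclidean_norm x.
Proof.
rewrite {1}/Num.Def.normr /= mx_normrE; apply/bigmax_leP; split; first exact: sqrtr_ge0.
case=> k i _ /=; rewrite (ord1 k) -sqrtr_sqr ler_wsqrtr//.
by rewrite (bigD1 i)//= lerDl; apply: sumr_ge0 => j _; exact: sqr_ge0.
Qed.

Lemma rV_hausdorff : hausdorff_space 'rV[R]_d.
Proof. exact: (@norm_hausdorff R 'rV[R]_d). Qed.

(** The similitudes are stated in the Euclidean norm and the topology comes from the supremum norm.
    The crude factor stays positive for d = 0, so it can be divided by. *)
Lemma euclidean_le_norm x : euclidean_norm x <= d.+1%:R * `|x|.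
Proof.
have d0 : 0 <= d.+1%:R * `|x| by rewrite mulr_ge0.
rewrite -(ger0_norm d0) -sqrtr_sqr ler_wsqrtr//.
apply: (@le_trans _ _ (\sum_(i < d) `|x| ^+ 2)).
  apply: ler_sum => i _; rewrite -[leLHS]real_normK ?num_real//.
  by rewrite ler_sqr ?nnegrE// coord_le_norm.
rewrite sumr_const card_ord exprMn -[leLHS]mulr_natl ler_wpM2r ?sqr_ge0//.
by rewrite -natrX ler_nat; apply: leq_trans (leqnSn d) _; rewrite leq_pmulr.
Qed.

End EuclideanNorm.

Section FractalGeometry.
Context {R : realType} {d : nat} (X : pcf_data R d).
Hypothesis HX : pcf_fractal X.
Local Notation point := 'rV[R]_d.
Local Notation N := (pcf_N X).
Local Notation F := (@pcf_map _ _ X).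
Local Notation K := (@pcf_K _ _ X).
Local Notation V0 := (@pcf_V0 _ _ X).
Local Notation theta := (pcf_theta X).
Implicit Types (x y : point) (j : 'I_N) (w : seq 'I_N).

Lemma map_dist j x y : `|F j x - F j y| <= theta * (d.+1%:R * `|x - y|).
Proof.
apply: le_trans (norm_le_euclidean _) _.
rewrite (pcf_similitude HX) ler_wpM2l ?(ltW (pcf_theta_gt0 HX))//.
exact: euclidean_le_norm.
Qed.

Lemma map_dist_inv j x y : `|x - y| <= theta^-1 * (d.+1%:R * `|F j x - F j y|).
Proof.
rewrite -(ler_pM2l (pcf_theta_gt0 HX)) mulrA divff ?gt_eqF ?(pcf_theta_gt0 HX)// mul1r.
apply: le_trans (euclidean_le_norm _); rewrite (pcf_similitude HX).
by rewrite ler_wpM2l ?norm_le_euclidean// ltW// (pcf_theta_gt0 HX).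
Qed.

Lemma map_inj j : injective (F j).
Proof.
move=> x y Fxy; apply/eqP; rewrite -subr_eq0 -normr_le0.
by have := map_dist_inv j x y; rewrite Fxy subrr normr0 !mulr0.
Qed.

Lemma map_continuous j : continuous (F j).
Proof.
move=> x; apply/(@cvgrPdist_le _ _ _ (nbhs x) (nbhs_filter x)) => e e0.
have c0 : 0 < theta * d.+1%:R by rewrite mulr_gt0 ?(pcf_theta_gt0 HX).
near=> y; apply: le_trans (map_dist _ _ _) _; rewrite mulrA mulrC -ler_pdivlMr//.
near: y; apply/(@nbhs_ballP R 'rV[R]_d); exists (e / (theta * d.+1%:R)).
  by rewrite /= divr_gt0.
by move=> z; rewrite -ball_normE => /ltW.
Unshelve. all: by end_near. Qed.

(** [word_map] on plain sequences, for induction on the word without its length. *)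
Definition word_fun w x : point := foldr F x w.

Lemma word_fun_continuous w : continuous (word_fun w).
Proof.
elim: w => [|j w IH] x; first exact: cvg_id.
exact: (@continuous_comp _ _ _ (word_fun w) (F j) x (IH x) (@map_continuous j _)).
Qed.

Lemma word_fun_dist w x y :
  euclidean_norm (word_fun w x - word_fun w y) = theta ^+ size w * euclidean_norm (x - y).
Proof.
elim: w => [|j w IH] /=; first by rewrite mul1r.
by rewrite (pcf_similitude HX) IH mulrA exprS.
Qed.

Lemma K_closed : closed K.
Proof. exact: compact_closed rV_hausdorff (pcf_K_compact HX). Qed.

Lemma map_K j x : K x -> K (F j x).
Proof. by move=> Kx; rewrite (pcf_K_invariant HX); exists j => //; exists x. Qed.

Lemma word_fun_K w x : K x -> K (word_fun w x).
Proof. by move=> Kx; elim: w => //= j w; exact: map_K. Qed.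

Lemma word_image_closed w : closed (word_fun w @` K).
Proof.
apply: compact_closed rV_hausdorff _; apply: continuous_compact (pcf_K_compact HX).
by apply: continuous_subspaceT => x; exact: word_fun_continuous.
Qed.

Lemma map_image_closed j : closed (F j @` K).
Proof. exact: (@word_image_closed [:: j]). Qed.

Lemma K_diameter : exists2 D : R, 0 < D &
  forall x y, K x -> K y -> euclidean_norm (x - y) <= D.
Proof.
have [M [_ /(_ (`|M| + 1))]] := compact_bounded (pcf_K_compact HX).
rewrite (le_lt_trans (ler_norm M)) ?ltrDl// => /(_ isT) KM.
exists (d.+1%:R * (`|M| + 1 + (`|M| + 1))); first by rewrite mulr_gt0// !addr_gt0 ?ltr_wpDl.
move=> x y Kx Ky; apply: le_trans (euclidean_le_norm _) _.
rewrite ler_wpM2l// (le_trans (ler_normB _ _))// lerD//; exact: KM.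
Qed.

Lemma theta_expr_small (e : R) : 0 < e -> \forall n \near \oo, theta ^+ n <= e.
Proof.
move=> e0; have t0 := pcf_theta_gt0 HX.
have t1 : `|theta| < 1 by rewrite gtr0_norm// (pcf_theta_lt1 HX).
have /cvgrPdist_le/(_ e e0) := cvg_expr t1; apply: filterS => n.
by rewrite sub0r normrN ger0_norm// exprn_ge0// ltW.
Qed.

(** A fixed point of F_j is the limit of the iterates of F_j at any point of K, and K is closed and
    invariant. *)
Lemma V0_K x : x \in V0 -> K x.
Proof.
move=> xV; have [j Fjx] := pcf_V0_fixed HX xV.
have [z Kz] := pcf_K_nonempty HX.
apply: (@closed_cvg _ _ \oo _ (fun n => word_fun (nseq n j) z) K K_closed).
  by apply: nearW => n; exact: word_fun_K.
have fx n : word_fun (nseq n j) x = x by elim: n => //= n ->.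
apply/cvgrPdist_le => e e0; have [D D0 KD] := K_diameter.
have E0 : 0 <= euclidean_norm (x - z) by exact: sqrtr_ge0.
near=> n; apply: le_trans (norm_le_euclidean _) _.
rewrite -{1}(fx n) word_fun_dist size_nseq.
apply: (@le_trans _ _ (theta ^+ n * (euclidean_norm (x - z) + 1))).
  by rewrite ler_wpM2l ?lerDl// exprn_ge0// ltW// (pcf_theta_gt0 HX).
rewrite -ler_pdivlMr ?ltr_wpDl//; near: n; apply: theta_expr_small.
by rewrite divr_gt0// ltr_wpDl.
Unshelve. all: by end_near. Qed.

Lemma verticesSP m x : reflect (exists j y, y \in vertices X m /\ x = F j y)
  (x \in vertices X m.+1).
Proof.
apply: (iffP idP) => [/bigfcupP[j _ /imfsetP[y yV ->]]|[j [y [yV ->]]]].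
  by exists j, y.
by apply/bigfcupP; exists j; rewrite ?mem_enum//; apply/imfsetP; exists y.
Qed.

Lemma V0_vertices m x : x \in V0 -> x \in vertices X m.
Proof.
move=> xV; elim: m => // m IH; have [j Fjx] := pcf_V0_fixed HX xV.
by apply/verticesSP; exists j, x; rewrite Fjx.
Qed.

Lemma vertices_K m x : x \in vertices X m -> K x.
Proof.
elim: m x => [|m IH] x; first exact: V0_K.
by move=> /verticesSP[j [y [yV ->]]]; apply: map_K; exact: IH.
Qed.

Lemma N_gt0 : (0 < N)%N.
Proof. by apply: leq_trans (pcf_N_ge2 HX). Qed.

Lemma N_neq0 : N%:R != 0 :> R.
Proof. by rewrite pnatr_eq0 -lt0n N_gt0. Qed.

Fixpoint words n : seq (seq 'I_N) :=
  if n is n'.+1 then [seq j :: w | j <- enum 'I_N, w <- words n'] else [:: [::]].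

Lemma size_words n w : w \in words n -> size w = n.
Proof. by elim: n w => [|n IH] w; [rewrite inE => /eqP ->|case/allpairsP => -[j v] [/= _ /IH <- ->]]. Qed.

Lemma size_words_count n : size (words n) = (N ^ n)%N.
Proof. by elim: n => //= n IH; rewrite size_allpairs size_enum_ord IH expnS. Qed.

Lemma words_cover n x : K x -> exists2 w, w \in words n & (word_fun w @` K) x.
Proof.
elim: n x => [|n IH] x Kx; first by exists [::]; rewrite ?inE//; exists x.
move: (Kx); rewrite {1}(pcf_K_invariant HX) => -[j _ [y Ky <-]].
have [w wn [z Kz zy]] := IH y Ky.
exists (j :: w); first by apply: allpairs_f; rewrite ?mem_enum.
by exists z => //=; rewrite zy.
Qed.

(** Uniform continuity on the compact K, applied to cells whose diameter is at most theta^n D. *)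
Lemma uniform_on_words (g : point -> R) (e : R) : {within K, continuous g} -> 0 < e ->
  \forall n \near \oo, forall w, size w = n -> forall x y, K x -> K y ->
    `|g (word_fun w x) - g (word_fun w y)| <= e.
Proof.
move=> cg e0; have [D D0 KD] := K_diameter.
have e20 : 0 < e / 2 by rewrite divr_gt0.
suff H : \forall n \near \oo, K `<=` (fun x => K x -> forall y, K y ->
    `|x - y| <= theta ^+ n * D -> `|g x - g y| <= e).
  apply: filterS H => n H w wn x y Kx Ky.
  apply: H; [exact: word_fun_K|exact: word_fun_K|exact: word_fun_K|].
  apply: le_trans (norm_le_euclidean _) _; rewrite word_fun_dist wn.
  by rewrite ler_wpM2l ?KD// exprn_ge0// ltW// (pcf_theta_gt0 HX).
apply: ((compact_near_coveringP K).1 (pcf_K_compact HX) nat \oo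
  (fun n x => K x -> forall y, K y -> `|x - y| <= theta ^+ n * D -> `|g x - g y| <= e)) => x Kx.
move: cg => /subspace_continuousP/(_ x Kx)/cvgrPdist_le/(_ _ e20).
rewrite near_withinE => /nbhs_ballP[r/= r0 H].
have Hr y : K y -> `|x - y| < r -> `|g x - g y| <= e / 2.
  by move=> Ky xy; apply: H => //; rewrite -ball_normE.
have r20 : 0 < r / 2 by rewrite divr_gt0.
(* For such n, theta^n D is at most r / 4, so y stays within the continuity radius r of x. *)
exists ([set x' | `|x - x'| < r / 2], [set n | theta ^+ n <= r / 2 / D / 2]).
  split => /=; last by apply: theta_expr_small; rewrite !divr_gt0.
  by apply/nbhs_ballP; exists (r / 2) => //= y; rewrite -ball_normE.
move=> [x' n] [/= xx' tn] Kx' y Ky x'y.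
have x'y2 : `|x' - y| < r / 2.
  apply: le_lt_trans x'y _; rewrite -ltr_pdivlMr//; apply: le_lt_trans tn _.
  by rewrite ltr_pdivrMr// ltr_pMr ?divr_gt0// ltr1n.
have h1 := Hr x' Kx' (lt_trans xx' (_ : r / 2 < r)).
have h2 : `|g x - g y| <= e / 2.
  apply: Hr => //; rewrite (splitr r) -(subrK x' x) -addrA.
  by apply: le_lt_trans (ler_normD _ _) _; rewrite ltrD.
rewrite (splitr e) -(subrK (g x) (g x')) -addrA.
apply: le_trans (ler_normD _ _) _; rewrite lerD//.
by rewrite distrC h1// ltr_pdivrMr// ltr_pMr// ltr1n.
Qed.

End FractalGeometry.

(** * Self-similarity of the measure *)

Section FractalMeasure.
Context {R : realType} {d : nat} (X : pcf_data R d) (C0 : R).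
Hypothesis HX : pcf_fractal X.
Hypothesis HS : symmetric_fractal X C0.
Local Notation point := 'rV[R]_d.
Local Notation N := (pcf_N X).
Local Notation F := (@pcf_map _ _ X).
Local Notation K := (@pcf_K _ _ X).
Local Notation mu := (@pcf_mu _ _ X).

Lemma closed_borel (A : set point) : closed A -> measurable (A : set (borel_space R d)).
Proof.
move=> cA; rewrite -(setCK A); apply: measurableC; apply: sub_sigma_algebra.
exact: closed_openC.
Qed.

Lemma within_continuous_borel (A : set point) (g : point -> R) : closed A ->
  {within A, continuous g} -> measurable_fun (A : set (borel_space R d)) g.
Proof.
move=> cA cg; apply: (measurability _ (RGenOpens.measurableE R)).
move=> _ [_ [x [y ->]] <-].
have : open ((g : subspace A -> R) @^-1` `]x, y[%classic).
  by move/continuousP: cg; apply; exact: interval_open.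
move=> /open_subspaceP[V oV VA].
rewrite setIC -VA; apply: measurableI; last exact: closed_borel.
exact: sub_sigma_algebra.
Qed.

Lemma K_measurable : measurable (K : set (borel_space R d)).
Proof. by apply: closed_borel; exact: K_closed. Qed.

Lemma K_bounded_fun (g : point -> R) : {within K, continuous g} ->
  exists M : R, forall x, K x -> `|g x| <= M.
Proof.
move=> cg; have cK : compact (g @` K) by exact: continuous_compact (pcf_K_compact HX).
have [M [_ /(_ (M + 1))]] := compact_bounded cK.
by rewrite ltrDl ltr01 => /(_ isT) H; exists (M + 1) => x Kx; apply: H; exists x.
Qed.

Lemma K_integrable (g : point -> R) : {within K, continuous g} ->
  mu.-integrable (K : set (borel_space R d)) (EFin \o g).
Proof.
move=> cg; have [M gM] := K_bounded_fun cg.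
apply: measurable_bounded_integrable.
- exact: K_measurable.
- by rewrite [X in (X < _)%E](pcf_mu_K HX) ltry.
- exact: within_continuous_borel (K_closed HX) cg.
- exists M; split; first exact: num_real.
  by move=> x Mx y Ky; apply: le_trans (gM y Ky) (ltW Mx).
Qed.

Lemma K_Rintegral_cst (c : R) : \int[mu]_(x in (K : set (borel_space R d))) c = c.
Proof. by rewrite (Rintegral_cst _ K_measurable) [X in fine X](pcf_mu_K HX) mulr1. Qed.

Lemma word_image_measure n w : w \in words X n ->
  mu (word_fun w @` K : set (borel_space R d)) = (N%:R ^- n)%:E.
Proof.
by move=> wn; have := sym_measure HS (Tuple (introT eqP (size_words wn))).
Qed.

Variable x0 : point.
Hypothesis Kx0 : K x0.

Definition riemann n (g : point -> R) : R :=
  N%:R ^- n * \sum_(w <- words X n) g (word_fun w x0).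

(** Sorting the words by their first letter: self-similarity holds exactly before the limit. *)
Lemma riemannS n g : riemann n.+1 g = N%:R^-1 * \sum_j riemann n (g \o F j).
Proof.
rewrite /riemann /= big_allpairs_dep /= -mulr_sumr mulrA exprS invfM.
by congr (_ * _); rewrite [LHS]big_enum.
Qed.

Lemma riemann_addc n (g : point -> R) (c : R) :
  riemann n (fun x => g x + c) = riemann n g + c.
Proof.
rewrite /riemann big_split mulrDr /= big_const_seq count_predT size_words_count.
rewrite iter_addr addr0 -[c *+ _]mulr_natl natrX mulKf// expf_neq0//.
exact: N_neq0.
Qed.

Lemma riemann_opp n (g : point -> R) : riemann n (fun x => - g x) = - riemann n g.
Proof. by rewrite /riemann sumrN mulrN. Qed.

(* The cells of generation n may overlap, but together they have total mass 1,
   so that for a nonnegative integrand the sum over the cells is an upper bound. *)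
Lemma integral_le_riemann n (g : point -> R) (e : R) : {within K, continuous g} ->
  (forall x, K x -> 0 <= g x) -> 0 <= e ->
  (forall w : seq 'I_N, size w = n -> forall x y, K x -> K y ->
    `|g (word_fun w x) - g (word_fun w y)| <= e) ->
  \int[mu]_(x in (K : set (borel_space R d))) g x <= riemann n g + e.
Proof.
move=> cg g0 e0 osc.
have mK := K_measurable.
have mW (w : seq 'I_N) : measurable (word_fun w @` K : set (borel_space R d)).
  by apply: closed_borel; exact: word_image_closed.
have c0 (w : seq 'I_N) : 0 <= g (word_fun w x0) + e by rewrite addr_ge0// g0//; exact: word_fun_K.
rewrite -lee_fin [X in (X <= _)%E]fineK; last exact: integrable_fin_num (K_integrable cg).
have -> : (riemann n g + e)%:E =
    (\int[mu]_(x in (K : set (borel_space R d)))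
      (\sum_(w <- words X n) ((g (word_fun w x0) + e)%:E * (\1_(word_fun w @` K) x)%:E)))%E.
  rewrite ge0_integral_sum//; last 2 first.
  - move=> w; apply/measurable_EFinP; apply: measurable_funM => //.
  - by move=> w x _; rewrite mule_ge0// lee_fin// indicE.
  rewrite -riemann_addc /riemann mulr_sumr -sumEFin big_seq [RHS]big_seq.
  apply: eq_bigr => w wn.
  rewrite ge0_integralZl_EFin//; last exact/measurable_EFinP.
  rewrite integral_indic// setIidl; last by move=> _ [y Ky <-]; exact: word_fun_K.
  by rewrite [X in (_ * X)%E](word_image_measure wn) -EFinM mulrC.
apply: ge0_le_integral => //.
- by apply/measurable_EFinP; exact: within_continuous_borel (K_closed HX) cg.
- apply: emeasurable_sum => w; apply/measurable_EFinP; apply: measurable_funM => //.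
move=> x Kx; have [w wn [y Ky yx]] := words_cover HX n Kx.
rewrite (big_rem w wn) /=.
apply: (@le_trans _ _ ((g (word_fun w x0) + e)%:E * (\1_(word_fun w @` K) x)%:E)%E).
  rewrite indicE mem_set; last by exists y.
  rewrite mule1 lee_fin -yx.
  have := osc w (size_words wn) y x0 Ky Kx0; rewrite ler_norml; lra.
by rewrite leeDl// sume_ge0// => v _; rewrite mule_ge0// lee_fin// indicE.
Qed.

(** The upper bound, applied to the nonnegative functions g + M and M - g, bounds the error from
    both sides. *)
Lemma riemann_cvg (g : point -> R) : {within K, continuous g} ->
  riemann n g @[n --> \oo] --> \int[mu]_(x in (K : set (borel_space R d))) g x.
Proof.
move=> cg; have [M gM] := K_bounded_fun cg.
have gi := K_integrable cg.
apply/cvgrPdist_le => e e0.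
near=> n.
have osc : forall w : seq 'I_N, size w = n -> forall x y, K x -> K y ->
    `|g (word_fun w x) - g (word_fun w y)| <= e.
  by near: n; exact: uniform_on_words.
have c1 : {within K, continuous (fun x => g x + M)}.
  apply/subspace_continuousP => x Kx; apply: cvgD; last exact: cvg_cst.
  by move: x Kx; exact/subspace_continuousP.
have c2 : {within K, continuous (fun x => - g x + M)}.
  apply/subspace_continuousP => x Kx; apply: cvgD; last exact: cvg_cst.
  by apply: cvgN; move: x Kx; exact/subspace_continuousP.
have Mi : mu.-integrable (K : set (borel_space R d)) (EFin \o cst M).
  by apply: K_integrable; apply: continuous_subspaceT; exact: cst_continuous.
have mK := K_measurable.
have c3 : {within K, continuous (fun x => - g x)}.
  apply/subspace_continuousP => x Kx; apply: cvgN; move: x Kx.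
  exact/subspace_continuousP.
have h1 := @integral_le_riemann n _ e c1 _ (ltW e0) _.
have h2 := @integral_le_riemann n _ e c2 _ (ltW e0) _.
rewrite !riemann_addc RintegralD// K_Rintegral_cst in h1.
rewrite !riemann_addc riemann_opp (RintegralD mK (K_integrable c3) Mi) K_Rintegral_cst in h2.
have e2 : \int[mu]_(x in (K : set (borel_space R d))) - g x =
    - \int[mu]_(x in (K : set (borel_space R d))) g x.
  by rewrite -mulN1r -RintegralZl//; apply: eq_Rintegral => x _; rewrite mulN1r.
rewrite e2 in h2.
have {}h1 : \int[mu]_(x in (K : set (borel_space R d))) g x + M <= riemann n g + M + e.
  apply: h1 => [x Kx|w wn x y Kx Ky].
    by have := gM x Kx; rewrite ler_norml; lra.
  by rewrite opprD addrACA subrr addr0; exact: osc.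
have {}h2 : (- \int[mu]_(x in (K : set (borel_space R d))) g x) + M <= - riemann n g + M + e.
  apply: h2 => [x Kx|w wn x y Kx Ky].
    by have := gM x Kx; rewrite ler_norml; lra.
  by rewrite opprD addrACA subrr addr0 -opprD normrN; exact: osc.
by rewrite ler_norml; apply/andP; split; lra.
Unshelve. all: by end_near. Qed.

End FractalMeasure.

Lemma cvg_fin_sum (R : realType) (I : Type) (s : seq I) (f : I -> nat -> R) (l : I -> R) :
  (forall i, f i n @[n --> \oo] --> l i) ->
  \sum_(i <- s) f i n @[n --> \oo] --> \sum_(i <- s) l i.
Proof.
move=> fl; elim: s => [|i s IH].
  rewrite big_nil; under eq_fun do rewrite big_nil; exact: cvg_cst.
by rewrite big_cons; under eq_fun do rewrite big_cons; exact: cvgD.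
Qed.

Section SelfSimilarIntegral.
Context {R : realType} {d : nat} (X : pcf_data R d) (C0 : R).
Hypothesis HX : pcf_fractal X.
Hypothesis HS : symmetric_fractal X C0.
Local Notation F := (@pcf_map _ _ X).
Local Notation K := (@pcf_K _ _ X).
Local Notation mu := (@pcf_mu _ _ X).

Lemma within_continuous_map (S : topologicalType) (g : 'rV[R]_d -> S) j :
  {within K, continuous g} -> {within K, continuous (g \o F j)}.
Proof.
move=> /subspace_continuousP cg; apply/subspace_continuousP => x Kx.
apply: cvg_comp (cg _ (map_K HX j Kx)).
move=> A nA; have := @map_continuous _ _ _ HX j x _ nA.
move=> h; change (nbhs x (fun z => K z -> A (F j z))).
by apply: (@filterS _ _ (nbhs_filter x) _ _ _ h) => z hz Kz; apply: hz; exact: map_K.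
Qed.

(** The measure is given only through the masses of cells; [riemannS] carries their self-similarity
    over to integrals in the limit. *)
Lemma integral_self_similar (g : 'rV[R]_d -> R) : {within K, continuous g} ->
  \int[mu]_(x in (K : set (borel_space R d))) g x = (pcf_N X)%:R^-1 *
  \sum_j \int[mu]_(x in (K : set (borel_space R d))) g (F j x).
Proof.
move=> cg; have [x0 Kx0] := pcf_K_nonempty HX.
have c1 := riemann_cvg HX HS Kx0 cg; have c2 := c1.
rewrite -(cvg_shiftS (riemann X x0 ^~ g)) in c2.
apply: (cvg_unique (@Rhausdorff R) c2).
rewrite (_ : (fun n => _) = (fun n => (pcf_N X)%:R^-1 * \sum_j riemann X x0 n (g \o F j))).
  apply: cvgM; first exact: cvg_cst.
  apply: cvg_fin_sum => j; apply: (riemann_cvg HX HS Kx0).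
  exact: within_continuous_map.
by apply/funext => n; rewrite riemannS.
Qed.

End SelfSimilarIntegral.

(** * Harmonic functions and vertex weights *)

Section EdgeEnds.
Context {R : realType} {d : nat}.
Local Notation point := 'rV[R]_d.
Implicit Types (e : {fset point}) (f : point -> R[i]).

Lemma edge_endsP e : #|` e| = 2%N ->
  edge_src e != edge_tgt e /\ forall x, (x \in e) = (x == edge_src e) || (x == edge_tgt e).
Proof.
rewrite /edge_src /edge_tgt => e2.
have ue := fset_uniq e.
have me x : (x \in e) = (x \in (e : seq point)) by [].
move: ue me e2; case: (e : seq point) => [|a [|b [|c s]]]//= /andP[+ _] me _.
by rewrite inE => ab; split => // x; rewrite me !inE.
Qed.

(** The maps F_j may reverse the order in which the end points of an edge are listed; the squared
    modulus does not see it. *)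
Lemma edge_diff_abs2 e f a b : #|` e| = 2%N -> a \in e -> b \in e -> a != b ->
  abs2 (edge_diff f e) = abs2 (f a - f b).
Proof.
move=> /edge_endsP[st me]; rewrite !me /edge_diff => /orP[]/eqP-> /orP[]/eqP->;
  rewrite ?eqxx// => _; by rewrite -opprB /abs2 Re_opp Im_opp !sqrrN.
Qed.

End EdgeEnds.

Section FractalGraphs.
Context {R : realType} {d : nat} (X : pcf_data R d).
Hypothesis HX : pcf_fractal X.
Local Notation point := 'rV[R]_d.
Local Notation N := (pcf_N X).
Local Notation F := (@pcf_map _ _ X).
Local Notation K := (@pcf_K _ _ X).
Local Notation gamma0 := (@pcf_gamma0 _ _ X).
Local Notation r := (pcf_r X).
Implicit Types (j : 'I_N) (e : {fset point}) (x y v : point).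

Definition map_edge j e : {fset point} := [fset F j x | x in e]%fset.

Lemma mem_map_edge j e x : (F j x \in map_edge j e) = (x \in e).
Proof. by rewrite /map_edge mem_imfset//; exact: map_inj. Qed.

Lemma card_map_edge j e : #|` map_edge j e| = #|` e|.
Proof. by rewrite /map_edge card_imfset//; exact: map_inj. Qed.

Lemma edgesSP m e : reflect (exists j e', e' \in edges X m /\ e = map_edge j e')
  (e \in edges X m.+1).
Proof.
apply: (iffP idP) => [/bigfcupP[j _ /imfsetP[e' eE ->]]|[j [e' [eE ->]]]].
  by exists j, e'.
by apply/bigfcupP; exists j; rewrite ?mem_enum//; apply/imfsetP; exists e'.
Qed.

Lemma edge_image_nil (w : 0.-tuple 'I_N) e : edge_image w e = e.
Proof.
rewrite tuple0; apply/fsetP => x; apply/imfsetP/idP => [[y /= ye ->]|xe]//.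
by exists x.
Qed.

Lemma edge_image_cons m j (w : m.-tuple 'I_N) e :
  edge_image [tuple of j :: w] e = map_edge j (edge_image w e).
Proof.
apply/fsetP => x; apply/imfsetP/imfsetP => -[y /= yE ->].
  by exists (word_map w y) => //=; apply/imfsetP; exists y.
by case/imfsetP: yE => z /= ze ->; exists z.
Qed.

Lemma edges_image m e : e \in edges X m ->
  exists (w : m.-tuple 'I_N) e0, e0 \in edges X 0 /\ e = edge_image w e0.
Proof.
elim: m e => [|m IH] e; first by move=> e0E; exists [tuple], e; rewrite edge_image_nil.
case/edgesSP => j [e' [/IH[w [e0 [e0E ->]]] ->]].
by exists [tuple of j :: w], e0; rewrite edge_image_cons.
Qed.

Lemma edge_type_image m (w : m.-tuple 'I_N) e0 : e0 \in edges X 0 ->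
  edge_type X m (edge_image w e0) = e0.
Proof.
move=> e0E; rewrite /edge_type; case: xgetP => [e1 _ [e1E [w' we]]|H].
  by have [_ ->] := pcf_simple HX e0E e1E we.
by case: (H e0); split => //; exists w.
Qed.

Lemma edge_type_edges m e : e \in edges X m -> edge_type X m e \in edges X 0.
Proof. by move=> /edges_image[w [e0 [e0E ->]]]; rewrite edge_type_image. Qed.

Lemma edge_typeS m j e : e \in edges X m ->
  edge_type X m.+1 (map_edge j e) = edge_type X m e.
Proof.
move=> /edges_image[w [e0 [e0E ->]]].
by rewrite -edge_image_cons !edge_type_image.
Qed.

Lemma edge_type0 e : e \in edges X 0 -> edge_type X 0 e = e.
Proof. by move=> eE; rewrite -{1}(edge_image_nil [tuple] e) edge_type_image. Qed.

Lemma map_edge_inj m j j' e e' : e \in edges X m -> e' \in edges X m ->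
  map_edge j e = map_edge j' e' -> j = j' /\ e = e'.
Proof.
move=> /edges_image[w [e0 [e0E ->]]] /edges_image[w' [e1 [e1E ->]]].
rewrite -!edge_image_cons => /(pcf_simple HX e0E e1E)[/(congr1 val)[-> /val_inj ->] ->].
by [].
Qed.

(** Simplicity of the graphs makes the union over the cells disjoint, so no edge is counted
    twice. *)
Lemma big_edgesS m (phi : {fset point} -> R) :
  \sum_(e <- edges X m.+1) phi e = \sum_j \sum_(e <- edges X m) phi (map_edge j e).
Proof.
transitivity (\sum_(e <- [seq map_edge j e | j <- enum 'I_N, e <- edges X m]) phi e);
  last by rewrite big_allpairs_dep [LHS]big_enum.
apply: perm_big; apply: uniq_perm.
- exact: fset_uniq.
- apply: allpairs_uniq; [exact: enum_uniq|exact: fset_uniq|].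
  move=> _ _ /allpairsP[[j e] [_ /= eE ->]] /allpairsP[[j' e'] [_ /= eE' ->]] /=.
  by move=> /(map_edge_inj eE eE')[-> ->].
- move=> e; apply/edgesSP/allpairsP => [[j [e' [eE ->]]]|[[j e'] [_ /= eE ->]]].
    by exists (j, e'); rewrite mem_enum.
  by exists j, e'.
Qed.

Lemma card_edge m e : e \in edges X m -> #|` e| = 2%N.
Proof.
elim: m e => [|m IH] e; first by rewrite !inE /= => /andP[_ /eqP].
by case/edgesSP => j [e' [/IH eE ->]]; rewrite card_map_edge.
Qed.

Lemma edge_vertices m e x : e \in edges X m -> x \in e -> x \in vertices X m.
Proof.
elim: m e x => [|m IH] e x.
  by rewrite !inE /= fpowersetE => /andP[/fsubsetP eV _]; exact: eV.
case/edgesSP => j [e' [eE ->]] /imfsetP[y /= ye ->].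
by apply/verticesSP; exists j, y; split => //; exact: IH ye.
Qed.

Lemma edge_src_mem m e : e \in edges X m -> edge_src e \in e.
Proof. by move=> /card_edge/edge_endsP[_ ->]; rewrite eqxx. Qed.

Lemma edge_tgt_mem m e : e \in edges X m -> edge_tgt e \in e.
Proof. by move=> /card_edge/edge_endsP[_ ->]; rewrite eqxx orbT. Qed.

Lemma edge_diff_map_edge m (f : point -> R[i]) j e : e \in edges X m ->
  abs2 (edge_diff f (map_edge j e)) = abs2 (edge_diff (f \o F j) e).
Proof.
move=> eE; have [st _] := edge_endsP (card_edge eE).
apply: edge_diff_abs2; rewrite ?mem_map_edge ?(edge_src_mem eE) ?(edge_tgt_mem eE)//.
  by rewrite card_map_edge (card_edge eE).
by rewrite (inj_eq (@map_inj _ _ _ HX j)).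
Qed.

Lemma energyS m (f : point -> R[i]) :
  energy X m.+1 f = \sum_j r^-1 * energy X m (f \o F j).
Proof.
rewrite /energy big_edgesS; apply: eq_bigr => j _.
rewrite mulr_sumr big_seq [RHS]big_seq; apply: eq_bigr => e eE.
rewrite !normc_sqr (edge_diff_map_edge _ _ eE) mulrA; congr (_ * _).
by rewrite /edge_weight (edge_typeS _ eE) exprS invfM mulrA.
Qed.

Lemma eq_energy m (f g : point -> R[i]) : {in vertices X m, f =1 g} ->
  energy X m f = energy X m g.
Proof.
move=> fg; rewrite /energy big_seq [RHS]big_seq; apply: eq_bigr => e eE.
by rewrite /edge_diff !fg ?(edge_vertices eE)// ?(edge_src_mem eE) ?(edge_tgt_mem eE).
Qed.

Lemma edge_weight_gt0 m e : e \in edges X m -> 0 < edge_weight X m e.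
Proof.
move=> eE; rewrite /edge_weight mulr_gt0//; last first.
  by rewrite (pcf_gamma0_gt0 HX)// edge_type_edges.
by rewrite invr_gt0 exprn_gt0// (pcf_r_gt0 HX).
Qed.

Lemma energy_ge0 m (f : point -> R[i]) : 0 <= energy X m f.
Proof.
rewrite /energy big_seq; apply: sumr_ge0 => e eE.
by rewrite mulr_ge0 ?sqr_ge0// ltW// edge_weight_gt0.
Qed.

(** Up to the factor l00 Lambda^m / 2, the integral of the hat function of M_m at v. *)
Definition edge_resistance m v : R :=
  \sum_(e <- edges X m | v \in e) (gamma0 (edge_type X m e))^-1.

Lemma edge_resistanceS m v : edge_resistance m.+1 v =
  \sum_j \sum_(v' <- vertices X m | F j v' == v) edge_resistance m v'.
Proof.
rewrite /edge_resistance big_mkcond big_edgesS; apply: eq_bigr => j _.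
(* By injectivity of F_j at most one v' contributes to the inner sum. *)
transitivity (\sum_(e <- edges X m) \sum_(v' <- vertices X m)
    if (F j v' == v) && (v' \in e) then (gamma0 (edge_type X m e))^-1 else 0).
  rewrite big_seq [RHS]big_seq; apply: eq_bigr => e eE.
  case: ifPn => [/imfsetP[y /= ye ->]|vn].
    rewrite (bigD1_seq y) ?fset_uniq ?(edge_vertices eE ye)//= eqxx ye edge_typeS//.
    rewrite big1 ?addr0// => v' v'y.
    by rewrite (inj_eq (@map_inj _ _ _ HX j)) (negbTE v'y).
  rewrite big1// => v' _; case: ifP => // /andP[/eqP vE v'e].
  by move: vn; rewrite -vE mem_map_edge v'e.
rewrite exchange_big [RHS]big_mkcond /=; apply: eq_bigr => v' _.
by case: eqP => _ /=; [rewrite -big_mkcond|rewrite big1].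
Qed.

Lemma psi_harmonic m v : v \in vertices X m -> Defs.harmonic X m v (psi X m v).
Proof.
by move=> /(pcf_harmonic_exists HX) H; exact: (@xgetPex _ _ [set u | Defs.harmonic X m v u]).
Qed.

Lemma energyK_ge0 (u : point -> R[i]) : energyK_dom X u -> 0 <= energyK X u.
Proof.
by case=> _ cu; apply: limr_ge => //; apply: nearW => m; exact: energy_ge0.
Qed.

Lemma energy_fun0 m : energy X m (fun=> 0) = 0.
Proof.
rewrite /energy big1// => e _; rewrite /edge_diff subrr Normc.normc0 expr0n mulr0//.
Qed.

Lemma energyK_dom0 : energyK_dom X (fun=> 0).
Proof.
split; first by apply: continuous_subspaceT; exact: cst_continuous.
by under eq_fun do rewrite energy_fun0; exact: is_cvg_cst.
Qed.

Lemma energyK0 : energyK X (fun=> 0) = 0.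
Proof.
by rewrite /energyK; under eq_fun do rewrite energy_fun0; apply: lim_cst; exact: Rhausdorff.
Qed.

End FractalGraphs.

Lemma within_bigU_continuous (T S : topologicalType) (I : Type) (s : seq I) (A : I -> set T)
    (f : T -> S) : (forall i, closed (A i)) -> (forall i, {within A i, continuous f}) ->
  {within \big[setU/set0]_(i <- s) A i, continuous f}.
Proof.
move=> cA cf; elim: s => [|i s IH].
  by rewrite big_nil; apply/subspace_continuousP => x.
rewrite big_cons; apply: withinU_continuous => //.
apply: (big_ind closed) => [||j _]; [exact: closed0|exact: closedU|exact: cA].
Qed.

(** * Restriction of harmonic functions to the cells *)

Section Gluing.
Context {R : realType} {d : nat} (X : pcf_data R d) (C0 : R).
Hypothesis HX : pcf_fractal X.
Hypothesis HS : symmetric_fractal X C0.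
Local Notation point := 'rV[R]_d.
Local Notation N := (pcf_N X).
Local Notation F := (@pcf_map _ _ X).
Local Notation K := (@pcf_K _ _ X).
Local Notation r := (pcf_r X).
Variables (m : nat) (v : point).
Hypothesis vV : v \in vertices X m.+1.

(* On the cell F_j(K) the (m+1)-harmonic function with pole v is the transplanted
   m-harmonic function with pole F_j^-1(v), or 0 if v is not a vertex of the cell. *)
Definition cell_psi (j : 'I_N) : point -> R[i] :=
  if [pick v' : vertices X m | F j (val v') == v] is Some v' then psi X m (val v')
  else fun=> 0.

Lemma cell_psi_vertices j v' : v' \in vertices X m -> cell_psi j v' = (F j v' == v)%:R.
Proof.
move=> v'V; rewrite /cell_psi; case: pickP => [v0 /eqP <-|H].
  have [_ -> //] := psi_harmonic HX (valP v0).
  by rewrite (inj_eq (@map_inj _ _ _ HX j)).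
by have /= := H [` v'V]%fset => ->.
Qed.

(** If v is not a vertex of the cell, the prescribed values are all 0 and the zero function has the
    least possible energy. *)
Lemma cell_psi_min j : energyK_dom X (cell_psi j) /\
  forall u, energyK_dom X u ->
    {in vertices X m, forall v', u v' = (F j v' == v)%:R} ->
    energyK X (cell_psi j) <= energyK X u.
Proof.
rewrite /cell_psi; case: pickP => [v0 /eqP vE|H].
  have [ud _ umin] := psi_harmonic HX (valP v0).
  split=> // u du uV; apply: umin => // v' v'V; rewrite uV// -vE.
  by rewrite (inj_eq (@map_inj _ _ _ HX j)).
by split=> [|u du _]; [exact: energyK_dom0|rewrite energyK0; exact: energyK_ge0].
Qed.

Definition glued (x : point) : R[i] := xget 0
  [set z | exists j y, [/\ K y, F j y = x & z = cell_psi j y]].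

(** Two different cells meet only in images of boundary vertices, where each cell function takes the
    value dictated by the common point. *)
Lemma gluedE j y : K y -> glued (F j y) = cell_psi j y.
Proof.
move=> Ky; rewrite /glued; case: xgetP => [z _ [j' [y' [Ky' FE ->]]]|H]; last first.
  by case: (H (cell_psi j y)); exists j, y.
have [jE|jj] := eqVneq j' j.
  by move: FE; rewrite jE => /(@map_inj _ _ _ HX) ->.
have [|] := pcf_finitely_ramified HX jj (t := F j y).
  by split; [exists y'|exists y].
move=> [a /= aV aE] [b /= bV bE].
have ya : y' = a by apply: (@map_inj _ _ _ HX j'); rewrite aE.
have yb : b = y by exact: (@map_inj _ _ _ HX j).
by rewrite !cell_psi_vertices ?FE// -?yb ?ya; exact: V0_vertices.
Qed.

Lemma glued_vertices p : p \in vertices X m.+1 -> glued p = (p == v)%:R.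
Proof.
move=> /verticesSP[j [y [yV ->]]].
by rewrite gluedE ?cell_psi_vertices//; exact: vertices_K yV.
Qed.

(** K is a finite union of closed cells, and on each of them the inverse of F_j is Lipschitz. *)
Lemma glued_continuous : {within K, continuous (glued : point -> R[i]^o)}.
Proof.
have -> : K = \big[setU/set0]_(j <- enum 'I_N) (F j @` K).
  rewrite -bigcup_seq {1}(pcf_K_invariant HX); apply: eq_bigcupl.
  by split => j _ //=; rewrite mem_enum.
apply: within_bigU_continuous => j; first exact: map_image_closed.
apply/subspace_continuousP => _ [y Ky <-].
have [[/subspace_continuousP/(_ y Ky)/cvgrPdist_le cy _] _] := cell_psi_min j.
apply/(@cvgrPdist_le _ _ _ (within (F j @` K) (nbhs (F j y))) _) => e e0.
have := cy e e0; rewrite near_withinE => /(@nbhs_ballP R)[del /= del0 H].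
rewrite near_withinE; apply/(@nbhs_ballP R).
have c0 : 0 < (pcf_theta X)^-1 * d.+1%:R by rewrite mulr_gt0 ?invr_gt0 ?(pcf_theta_gt0 HX).
exists (del / ((pcf_theta X)^-1 * d.+1%:R)); first by rewrite /= divr_gt0.
move=> z yz [y' Ky' zE]; move: yz; rewrite -zE -ball_normE /= => yy'.
rewrite /from_subspace !gluedE//; apply: H => //; rewrite -ball_normE /=.
apply: le_lt_trans (map_dist_inv HX j y y') _.
by rewrite mulrA mulrC -ltr_pdivlMr.
Qed.

Lemma glued_energyS n : energy X n.+1 glued = \sum_j r^-1 * energy X n (cell_psi j).
Proof.
rewrite energyS//; apply: eq_bigr => j _; congr (_ * _); apply: eq_energy => // p pV.
by rewrite /= gluedE//; exact: vertices_K pV.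
Qed.

Lemma glued_energy_cvg : energy X n glued @[n --> \oo] --> \sum_j r^-1 * energyK X (cell_psi j).
Proof.
rewrite -cvg_shiftS; under eq_fun do rewrite /= glued_energyS.
apply: cvg_fin_sum => j; apply: cvgM; first exact: cvg_cst.
exact: (cell_psi_min j).1.2.
Qed.

(** The energy of [psi] splits over the cells, and its restriction to each cell competes with the
    minimizer [cell_psi] there; so the glued function has no more energy than [psi]. *)
Lemma glued_harmonic : Defs.harmonic X m.+1 v glued.
Proof.
have [hd hV hmin] := psi_harmonic HX vV.
split.
- by split; [exact: glued_continuous|apply/cvg_ex; eexists; exact: glued_energy_cvg].
- by move=> p pV; exact: glued_vertices.
move=> u' ud' uV'; apply: le_trans (hmin u' ud' uV').
have -> : energyK X glued = \sum_j r^-1 * energyK X (cell_psi j).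
  by apply: cvg_lim; [exact: Rhausdorff|exact: glued_energy_cvg].
have [hj ->] := sym_energy HS hd.
apply: ler_sum => j _; rewrite ler_wpM2l ?invr_ge0 ?(ltW (pcf_r_gt0 HX))//.
apply: (cell_psi_min j).2; first exact: hj.
by move=> v' v'V; rewrite /= hV//; apply/verticesSP; exists j, v'.
Qed.

Lemma psi_cell j y : K y -> psi X m.+1 v (F j y) = cell_psi j y.
Proof.
move=> Ky; rewrite -gluedE//.
apply: (pcf_harmonic_unique HX vV (psi_harmonic HX vV) glued_harmonic).
by rewrite inE; exact: map_K.
Qed.

(** The sum has at most one term by injectivity of F_j; it is empty exactly when the cell function
    is 0 by default. *)
Lemma cell_psi_sum j (G : (point -> R[i]) -> R) : G (fun=> 0) = 0 ->
  G (cell_psi j) = \sum_(v' <- vertices X m | F j v' == v) G (psi X m v').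
Proof.
move=> G0; rewrite /cell_psi; case: pickP => [v0 /eqP vE|H].
  rewrite big_mkcond (bigD1_seq (val v0)) ?fset_uniq ?(valP v0)//= vE eqxx.
  rewrite big1 ?addr0// => v' v'v; rewrite -vE.
  by rewrite (inj_eq (@map_inj _ _ _ HX j)) (negbTE v'v).
rewrite G0 big_seq_cond big1// => v' /andP[v'V vE].
by have /= := H [` v'V]%fset; rewrite vE.
Qed.

Lemma vertex_weightS : vertex_weight X m.+1 v =
  N%:R^-1 * \sum_j \sum_(v' <- vertices X m | F j v' == v) vertex_weight X m v'.
Proof.
have [[cpsi _] _ _] := psi_harmonic HX vV.
rewrite /vertex_weight (integral_self_similar HX HS (within_continuous_Re cpsi)).
congr (_ * _); apply: eq_bigr => j _.
rewrite -(@cell_psi_sum j (fun u => \int[@pcf_mu _ _ X]_(x in (K : set (borel_space R d))) complex.Re (u x))).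
  by apply: eq_Rintegral => x; rewrite inE => Kx; rewrite psi_cell.
by rewrite /= (K_Rintegral_cst HX).
Qed.

End Gluing.

(** * Positivity of the vertex weights and their relation to the edge sums *)

Section VertexWeights.
Context {R : realType} {d : nat} (X : pcf_data R d) (C0 : R).
Hypothesis HX : pcf_fractal X.
Hypothesis HS : symmetric_fractal X C0.
Local Notation N := (pcf_N X).
Local Notation N0 := #|` pcf_V0 X|.

Lemma N0_gt0 : (0 < N0)%N.
Proof. by rewrite cardfs_gt0 (pcf_V0_nonempty HX). Qed.

(** Positivity propagates from the boundary value 1/N0 through the recursion, so the sign of [psi]
    never has to be discussed. *)
Lemma vertex_weight_gt0 m v : v \in vertices X m -> 0 < vertex_weight X m v.
Proof.
elim: m v => [|m IH] v vV.
  by rewrite (sym_boundary_measure HS)// invr_gt0 ltr0n N0_gt0.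
rewrite (vertex_weightS HX HS vV) mulr_gt0// ?invr_gt0 ?ltr0n ?(N_gt0 HX)//.
have /verticesSP[j [y [yV vE]]] := vV.
have ge0 (j' : 'I_N) : 0 <= \sum_(v' <- vertices X m | pcf_map j' v' == v) vertex_weight X m v'.
  by rewrite big_seq_cond; apply: sumr_ge0 => v' /andP[v'V _]; exact/ltW/IH.
rewrite (bigD1 j)//= ltr_wpDr//; first by apply: sumr_ge0 => j' _.
rewrite big_mkcond (bigD1_seq y) ?fset_uniq//= vE eqxx ltr_wpDr ?IH//.
rewrite big_seq_cond; apply: sumr_ge0 => v' /andP[v'V _].
by case: ifP => // _; exact/ltW/IH.
Qed.

(** The two recursions differ by the factor 1/N per generation, and C0 N0 is the ratio at generation
    0. *)
Lemma edge_resistance_weight m v : v \in vertices X m ->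
  edge_resistance X m v = C0 * N0%:R * N%:R ^+ m * vertex_weight X m v.
Proof.
elim: m v => [|m IH] v vV.
  rewrite (sym_boundary_measure HS)// mulr1 mulfK ?pnatr_eq0 -?lt0n ?N0_gt0//.
  rewrite -(sym_boundary_energy HS vV) /edge_resistance big_seq_cond [RHS]big_seq_cond.
  by apply: eq_bigr => e /andP[eE _]; rewrite edge_type0.
rewrite (edge_resistanceS HX) (vertex_weightS HX HS vV) exprSr.
rewrite [RHS]mulrA mulrA mulfK ?(N_neq0 HX)// mulr_sumr; apply: eq_bigr => j _.
rewrite mulr_sumr big_seq_cond [RHS]big_seq_cond.
by apply: eq_bigr => v' /andP[v'V _]; rewrite IH.
Qed.

End VertexWeights.

(** * The fractal metric graphs *)

Section FractalMetricGraph.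
Context {R : realType} {d : nat} (X : pcf_data R d) (C0 Lambda l00 : R).
Hypothesis HX : pcf_fractal X.
Hypothesis HS : symmetric_fractal X C0.
Hypothesis Lambda_gt0 : 0 < Lambda.
Hypothesis l00_gt0 : 0 < l00.
Variable m : nat.
Local Notation N := (pcf_N X).
Local Notation N0 := #|` pcf_V0 X|.
Local Notation gamma0 := (@pcf_gamma0 _ _ X).
Local Notation r := (pcf_r X).
Local Notation M := (fractal_metric_graph X l00 Lambda m).
Local Notation V := (vertices X m : finType).
Local Notation E := (edges X m : finType).

Definition edge_source (e : edges X m) : vertices X m :=
  [` edge_vertices (fsvalP e) (edge_src_mem HX (fsvalP e))]%fset.

Definition edge_target (e : edges X m) : vertices X m :=
  [` edge_vertices (fsvalP e) (edge_tgt_mem HX (fsvalP e))]%fset.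

Definition rescaling : R := Num.sqrt (l00 * Lambda ^+ m * C0 * N%:R ^+ m * N0%:R / 2).

Let C0_gt0 : 0 < C0. Proof. exact: sym_C0_gt0 HS. Qed.
Let r_gt0 : 0 < r. Proof. exact: pcf_r_gt0 HX. Qed.
Let N_gt0' : 0 < N%:R :> R. Proof. by rewrite ltr0n (N_gt0 HX). Qed.
Let N0_gt0' : 0 < N0%:R :> R. Proof. by rewrite ltr0n (N0_gt0 HX). Qed.
Let gamma_gt0 (e : edges X m) : 0 < gamma0 (edge_type X m (val e)).
Proof. exact: (pcf_gamma0_gt0 HX (edge_type_edges HX (fsvalP e))). Qed.

Let rescaling_arg : 0 < l00 * Lambda ^+ m * C0 * N%:R ^+ m * N0%:R / 2.
Proof. by rewrite divr_gt0// !mulr_gt0// exprn_gt0. Qed.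

Lemma rescaling_gt0 : 0 < rescaling.
Proof. by rewrite sqrtr_gt0. Qed.

Lemma rescaling_sqr : rescaling ^+ 2 = l00 * Lambda ^+ m * C0 * N%:R ^+ m * N0%:R / 2.
Proof. by rewrite sqr_sqrtr// ltW. Qed.

Lemma fractal_len_gt0 (e : mg_edge M) : 0 < mg_len e.
Proof. by apply: mulr_gt0; [exact: divr_gt0|exact: exprn_gt0]. Qed.

Lemma fractal_vertex_len (v : vertices X m) :
  rescaling ^+ 2 * vertex_weight X m (val v) =
  \sum_(e : mg_edge M) ((edge_source e == v)%:R + (edge_target e == v)%:R) * (mg_len e / 2).
Proof.
(* The end points of an edge are distinct, so at most one of the two indicators is 1. *)
have incident (e : edges X m) :
    (edge_source e == v)%:R + (edge_target e == v)%:R = (val v \in val e)%:R :> R.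
  have [st ->] := edge_endsP (card_edge HX (fsvalP e)).
  rewrite -(val_eqE (edge_source e) v) -(val_eqE (edge_target e) v) /=.
  rewrite ![val v == _]eq_sym -[\val v]/(fsval v); move: st.
  case: (edge_src (fsval e) =P fsval v) => [->|_];
    case: (edge_tgt (fsval e) =P fsval v) => [->|_]; rewrite ?eqxx ?addr0 ?add0r//.
transitivity (l00 * Lambda ^+ m / 2 * edge_resistance X m (val v)).
  by rewrite (edge_resistance_weight HX HS (fsvalP v)) rescaling_sqr; ring.
rewrite /edge_resistance big_mkcond big_seq_fsetE mulr_sumr; apply: eq_bigr => e _.
rewrite incident /=; case: ifP => _; last by rewrite mul0r mulr0.
by rewrite mul1r; ring.
Qed.

Lemma fractal_tau_len (e : mg_edge M) : fractal_tau X C0 l00 Lambda m =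
  rescaling ^+ 2 * edge_weight X m (val e) * mg_len e.
Proof.
rewrite rescaling_sqr /fractal_tau /edge_weight /= !exprMn exprVn expr2.
have g0 := gamma_gt0 e; have rm : 0 < r ^+ m by rewrite exprn_gt0.
by field; rewrite ?gt_eqF.
Qed.

Let tau_factor_ge0 : 0 <= l00 ^+ 2 * C0 * N0%:R / 2.
Proof. by rewrite ltW// divr_gt0// !mulr_gt0 ?exprn_gt0. Qed.

(** Each term is the value of (N/r)^m l_e^2 / tau_m for edges of that type; the sum bounds all of
    them. *)
Definition edge_constant : R :=
  \sum_(e <- edges X 0) 2 / (gamma0 e ^+ 2 * C0 * N0%:R).

Let edge_term_ge0 (e : {fset 'rV[R]_d}) : 0 <= 2 / (gamma0 e ^+ 2 * C0 * N0%:R).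
Proof.
by apply: divr_ge0 => //; apply: mulr_ge0 => //; apply: mulr_ge0; [exact: sqr_ge0|exact: ltW].
Qed.

Lemma edge_constant_ge0 : 0 <= edge_constant.
Proof. by apply: sumr_ge0 => e _; exact: edge_term_ge0. Qed.

Definition error_scale : R := Num.sqrt edge_constant * (r / N%:R) `^ (m%:R / 2).

Lemma error_scale_sqr : error_scale ^+ 2 = edge_constant * (r / N%:R) ^+ m.
Proof.
rewrite exprMn sqr_sqrtr ?edge_constant_ge0//; congr (_ * _).
rewrite -[LHS]powR_mulrn ?powR_ge0// -powRrM divfK// powR_mulrn//.
by rewrite divr_ge0// ltW.
Qed.

Lemma fractal_len_small (e : mg_edge M) :
  mg_len e ^+ 2 <= error_scale ^+ 2 * fractal_tau X C0 l00 Lambda m.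
Proof.
have g0 := gamma_gt0 e; have rm : 0 < r ^+ m by rewrite exprn_gt0.
have Nm : 0 < N%:R ^+ m :> R by rewrite exprn_gt0.
rewrite error_scale_sqr /fractal_tau /=.
have eE : edge_type X m (val e) \in edges X 0 by exact: edge_type_edges (fsvalP e).
set ga := gamma0 _ in g0 *.
have kE : 2 / (ga ^+ 2 * C0 * N0%:R) <= edge_constant.
  rewrite /edge_constant (bigD1_seq _ eE) ?fset_uniq//= lerDl.
  by apply: sumr_ge0 => e' _; exact: edge_term_ge0.
have -> : edge_constant * (r / N%:R) ^+ m *
    (l00 ^+ 2 * C0 * N0%:R / 2 * (N%:R * Lambda ^+ 2 / r) ^+ m) =
    edge_constant * (l00 ^+ 2 * C0 * N0%:R / 2 * (Lambda ^+ m) ^+ 2).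
  rewrite !exprMn !exprVn; field.
  by rewrite !gt_eqF.
apply: le_trans (ler_wpM2r _ kE); last first.
  by apply: mulr_ge0; [exact: tau_factor_ge0|exact: sqr_ge0].
rewrite le_eqVlt; apply/orP; left; apply/eqP; field.
by rewrite !gt_eqF.
Qed.

Lemma vertex_extE (f : {ffun vertices X m -> R[i]}) v : vertex_ext f (val v) = f v.
Proof. by rewrite /vertex_ext valK. Qed.

Lemma discrete_formE : @discrete_form _ _ X m =
  diff_form edge_source edge_target (fun e => edge_weight X m (val e)).
Proof.
apply/funext => f; apply/funext => g; rewrite /discrete_form big_seq_fsetE.
apply: eq_bigr => e _; rewrite /edge_diff /gdiff.
by rewrite -!(vertex_extE f) -!(vertex_extE g).
Qed.

Lemma fractal_quasi_unitary : quasi_unitary_equivalent (4 * error_scale)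
  (discrete_form_space X m)
  (metric_form_space M (fractal_tau X C0 l00 Lambda m)).
Proof.
have es0 : 0 <= error_scale by rewrite mulr_ge0 ?sqrtr_ge0 ?powR_ge0.
have tau0 : 0 <= fractal_tau X C0 l00 Lambda m.
  rewrite /fractal_tau; apply: mulr_ge0; first exact: tau_factor_ge0.
  apply: exprn_ge0.
  by apply: divr_ge0; [apply: mulr_ge0; [exact: ltW|exact: sqr_ge0]|exact: ltW].
have := @weighted_metric_graph_equivalence R M V edge_source edge_target
  val (@vertex_ext _ _ X m) (fun=> erefl) (fun=> erefl) vertex_extE fractal_len_gt0
  (fun v => vertex_weight X m (val v)) (fun e => edge_weight X m (val e))
  rescaling _ error_scale
  (fun v => vertex_weight_gt0 HX HS (fsvalP v))
  (fun e => ltW (edge_weight_gt0 HX (fsvalP e)))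
  rescaling_gt0 tau0 es0 fractal_vertex_len fractal_tau_len fractal_len_small.
by rewrite /discrete_form_space discrete_formE.
Qed.

End FractalMetricGraph.

Unset Implicit Arguments.

Theorem theorem5p4 (R : realType) (d : nat) (X : pcf_data R d)
    (C0 Lambda l00 : R) :
  pcf_fractal X -> symmetric_fractal X C0 ->
  0 < Lambda -> Lambda < 1 -> 0 < l00 ->
  exists delta : nat -> R,
    (forall m : nat, 0 <= delta m /\
       quasi_unitary_equivalent (delta m)
         (discrete_form_space X m)
         (metric_form_space (fractal_metric_graph X l00 Lambda m)
            (fractal_tau X C0 l00 Lambda m))) /\
    delta =O_\oo (fun m : nat => (pcf_r X / (pcf_N X)%:R) `^ (m%:R / 2)).
Proof.
move=> HX HS Lambda_gt0 _ l00_gt0.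
exists (fun m => 4 * error_scale X C0 m); split.
  move=> m; split; last exact: fractal_quasi_unitary.
  by rewrite !mulr_ge0 ?sqrtr_ge0 ?powR_ge0.
(* In this form the bound has to hold with every sufficiently large constant. *)
apply/eqOP.
have := nbhs_pinfty_ge (num_real (4 * Num.sqrt (edge_constant X C0))).
apply: filterS => k hk; apply: nearW => m.
rewrite /error_scale mulrA normrM ler_wpM2r//.
by rewrite ger0_norm ?mulr_ge0 ?sqrtr_ge0.
Qed.
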